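(* Let $F^N$ be a Finsler space on $M$ and let $a_{mn}(x)$ be a Riemannian metric tensor on $M$. If the indicatrix supported by a point $x\in M$ is a space of constant curvature, then the conformal property holds at the point $x$: there are a transformation $y\mapsto\zeta(x,y)$ of tangent vectors in $T_xM$ and a positive function $k(x,y)$ such that $$g_{mn}(x,y)=k^2(x,y)\,\frac{\partial\zeta^i}{\partial y^m}(x,y)\,\frac{\partial\zeta^j}{\partial y^n}(x,y)\,a_{ij}(x).$$
   Context: $M$ is an $N$-dimensional differentiable manifold with local coordinates $x^i$, and $y^i$ are the induced components of tangent vectors $y\in T_xM$. The Finsler space $F^N$ is given by a Finsler metric function $K(x,y)>0$ on $TM\setminus 0$ (positively homogeneous of degree 1 in $y$ and strongly convex), with metric tensor $g_{mn}=\frac12\,\partial^2K^2/\partial y^m\partial y^n$. The indicatrix supported by $x$ is $\{y\in T_xM:K(x,y)=1\}$, endowed with the Riemannian metric induced from the tangent Riemannian space $(T_xM,g_{mn}(x,\cdot))$ ($x$ fixed); ''space of constant curvature'' refers to this induced metric. The transformation $y\mapsto\zeta(x,y)$ is a diffeomorphism between open regions of $T_xM\setminus\{0\}$; the considerations are local with respect to $y$. *)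

(* Defs.v *)
From mathcomp Require Import all_boot all_order all_algebra.
From mathcomp Require Import all_classical all_reals all_analysis.
Set Implicit Arguments.
Unset Strict Implicit.
Unset Printing Implicit Defensive.
Import Order.TTheory GRing.Theory Num.Theory numFieldNormedType.Exports.
Local Open Scope classical_set_scope.
Local Open Scope ring_scope.

Section Smooth.
Context {R : realType}.

Fixpoint iter_derive (V W : normedModType R) (s : seq V) (f : V -> W) : V -> W :=
  if s is v :: s' then fun p => 'D_v (iter_derive s' f) p else f.

(* C^oo on an open set [D]: every iterated directional derivative is
   (Frechet) differentiable at every point of [D]. Values of [f] outside [D]
   are irrelevant, [D] being open in every use. *)
Definition smooth_on (V W : normedModType R) (D : set V) (f : V -> W) :=
  forall (s : seq V) (p : V), D p -> differentiable (iter_derive s f) p.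

Definition partial n (W : normedModType R) (i : 'I_n) (f : 'rV[R]_n -> W) :
    'rV[R]_n -> W :=
  fun u => 'D_(delta_mx 0 i) f u.

Definition diffeo n (U V : set 'rV[R]_n) (f : 'rV[R]_n -> 'rV[R]_n) :=
  [/\ open U, open V, smooth_on U f, f @` U = V &
    exists g : 'rV[R]_n -> 'rV[R]_n,
      smooth_on V g /\ (forall u, U u -> g (f u) = u)].

End Smooth.

Definition bilin (R : realType) n (G : 'M[R]_n) (v w : 'rV[R]_n) : R :=
  (v *m G *m w^T) 0 0.

Definition posdef (R : realType) n (G : 'M[R]_n) :=
  forall v : 'rV[R]_n, v != 0 -> 0 < bilin G v v.

(* An [N]-dimensional smooth manifold structure on [M]. [coord c] and
   [point c] are total functions; only [coord c] on [dom c] and [point c] on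
   the open set [coord c @` dom c] of R^N are meaningful. *)
Record manifold (R : realType) (N : nat) (M : topologicalType) := Manifold {
  chart : Type;
  dom : chart -> set M;
  coord : chart -> M -> 'rV[R]_N;
  point : chart -> 'rV[R]_N -> M;
  manifold_hausdorff : hausdorff_space M;
  manifold_second_countable : @second_countable M;
  dom_open : forall c, open (dom c);
  dom_cover : forall x, exists c, dom c x;
  coord_open : forall c, open (coord c @` dom c);
  coordK : forall c x, dom c x -> point c (coord c x) = x;
  coord_continuous : forall c x, dom c x -> {for x, continuous (coord c)};
  point_continuous : forall c u, (coord c @` dom c) u ->
    {for u, continuous (point c)};
  transition_smooth : forall c d,
    smooth_on (coord c @` (dom c `&` dom d)) (coord d \o point c)
}.

Section Metrics.
Context {R : realType} {N : nat} {M : topologicalType}.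
Variable A : manifold R N M.

(* Jacobian at [x] of the change of coordinates from [c] to [d]. In the
   library's row-vector convention, tangent vectors at [x] with components
   [y] in the chart [c] have components [y *m transition_jac c d x] in [d]. *)
Definition transition_jac (c d : chart A) (x : M) : 'M[R]_N :=
  'J (coord d \o point c) (coord c x).

(* g_mn = 1/2 d^2 F^2 / dy^m dy^n *)
Definition metric_tensor (F : 'rV[R]_N -> R) (y : 'rV[R]_N) : 'M[R]_N :=
  \matrix_(m, n) (2^-1 * partial m (partial n (fun z => F z ^+ 2)) y).

(* [K c x y] is the value of the metric function at the tangent vector at [x]
   whose components in the chart [c] are [y]; it is meaningful only for
   [x] in [dom c] and [y != 0]. *)
Record finsler_metric := FinslerMetric {
  finsler_fun :> chart A -> M -> 'rV[R]_N -> R;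
  finsler_smooth : forall c,
    smooth_on [set p : 'rV[R]_N * 'rV[R]_N | (coord c @` dom c) p.1 /\ p.2 != 0]
      (fun p => finsler_fun c (point c p.1) p.2);
  finsler_invariant : forall c d x y, dom c x -> dom d x -> y != 0 ->
    finsler_fun d x (y *m transition_jac c d x) = finsler_fun c x y;
  finsler_gt0 : forall c x y, dom c x -> y != 0 -> 0 < finsler_fun c x y;
  finsler_homogeneous : forall c x y (t : R), dom c x -> y != 0 -> 0 < t ->
    finsler_fun c x (t *: y) = t * finsler_fun c x y;
  finsler_convex : forall c x y, dom c x -> y != 0 ->
    posdef (metric_tensor (finsler_fun c x) y)
}.

(* [a c x] is the matrix a_mn(x) in the chart [c]. *)
Record riemannian_metric := RiemannianMetric {
  riemannian_fun :> chart A -> M -> 'M[R]_N;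
  riemannian_smooth : forall c,
    smooth_on (coord c @` dom c) (riemannian_fun c \o point c);
  riemannian_invariant : forall c d x, dom c x -> dom d x ->
    riemannian_fun c x =
      transition_jac c d x *m riemannian_fun d x *m (transition_jac c d x)^T;
  riemannian_sym : forall c x, dom c x ->
    (riemannian_fun c x)^T = riemannian_fun c x;
  riemannian_posdef : forall c x, dom c x -> posdef (riemannian_fun c x)
}.

End Metrics.

Section Curvature.
Context {R : realType} {n : nat}.
Variable h : 'rV[R]_n -> 'M[R]_n.

(* Gamma^c_ab *)
Definition christoffel (c a b : 'I_n) (u : 'rV[R]_n) : R :=
  2^-1 * \sum_d invmx (h u) c d *
    (partial a (fun v => h v d b) u + partial b (fun v => h v d a) u
     - partial d (fun v => h v a b) u).

(* R^d_cab, with R(e_a, e_b) e_c = R^d_cab e_d *)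
Definition riemann (d c a b : 'I_n) (u : 'rV[R]_n) : R :=
  partial a (christoffel d b c) u - partial b (christoffel d a c) u
  + \sum_e (christoffel d a e u * christoffel e b c u
            - christoffel d b e u * christoffel e a c u).

(* <R(X, Y)Y, X> / (|X|^2 |Y|^2 - <X, Y>^2) *)
Definition sectional_curvature (u X Y : 'rV[R]_n) : R :=
  (\sum_d \sum_c \sum_a \sum_b \sum_e
     h u e d * riemann d c a b u * X 0 e * Y 0 c * X 0 a * Y 0 b)
  / (bilin (h u) X X * bilin (h u) Y Y - bilin (h u) X Y ^+ 2).

End Curvature.

Section Indicatrix.
Context {R : realType} {N : nat}.
Variable F : 'rV[R]_N -> R.

(* [y != 0] is required because the value of [F] at 0 is not meaningful. *)
Definition indicatrix : set 'rV[R]_N := [set y | y != 0 /\ F y = 1].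

(* Smooth immersions of an open set of R^(N-1) that are homeomorphisms onto
   an open subset of the indicatrix. *)
Definition indicatrix_param (W : set 'rV[R]_N.-1)
    (phi : 'rV[R]_N.-1 -> 'rV[R]_N) :=
  [/\ open W, smooth_on W phi,
      forall u, W u -> row_free ('J phi u),
      forall u v, W u -> W v -> phi u = phi v -> u = v &
      forall B, open B -> B `<=` W ->
        exists2 O, open O & phi @` B = O `&` indicatrix].

Definition induced_metric (phi : 'rV[R]_N.-1 -> 'rV[R]_N)
    (u : 'rV[R]_N.-1) : 'M[R]_N.-1 :=
  \matrix_(a, b) \sum_m \sum_n
    metric_tensor F (phi u) m n
    * (partial a phi u) 0 m * (partial b phi u) 0 n.

Definition indicatrix_constant_curvature :=
  exists C : R, forall W phi, indicatrix_param W phi ->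
    forall u (X Y : 'rV[R]_N.-1), W u -> row_free (col_mx X Y) ->
      sectional_curvature (induced_metric phi) u X Y = C.

End Indicatrix.

(* Main.v *)
From HB Require Import structures.
Require Import Defs.
From mathcomp Require Import all_boot all_order all_algebra.
From mathcomp Require Import all_classical all_reals all_analysis.
From mathcomp Require Import ring lra.
Set Implicit Arguments.
Unset Strict Implicit.
Unset Printing Implicit Defensive.
Import Order.TTheory GRing.Theory Num.Theory numFieldNormedType.Exports.
Local Open Scope classical_set_scope.
Local Open Scope ring_scope.

(** Fix [x] and put [F = K c x] on the punctured tangent space.  By Euler's
   identity the tensor [g = metric_tensor F] is the cone over the indicatrix: in
   polar coordinates, g = dF^2 + F^2 h, where h is the metric induced on the
   indicatrix, pulled back by the central projection ([cone_metric]).  Hence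
   g = F^2 (ds^2 + h) with s = ln F, and it remains to see that the product of a
   line with a space of constant curvature C is conformally flat.

   The space of constant curvature C is realized near a point in a quadric: there
   are functions f_1, ..., f_(N-1) and p, vanishing at the point, such that
     sum_a f_a^2 = 2 p - C p^2  and  sum_a df_a^2 + C dp^2 = h
   ([model_functions]).  Applied to the line with the curvature - C, which is
   allowed since a line has no curvature, this also gives functions phi and pi of
   s with phi^2 = 2 pi + C pi^2 and dphi^2 - C dpi^2 = ds^2 ([line_coordinates]).
   Adding the two,
     |f|^2 + phi^2 = (p + pi) sg,  sg = 2 + C (pi - p),
   so that (x, u, w) = ((phi, f), p + pi, sg) runs through the cone |x|^2 = u w, on
   which the ambient form |dx|^2 - du dw is ds^2 + h.  Rescaling the points of the
   cone rescales this form conformally, and on the slice w = 1 it is flat: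
   X = (phi, f) / sg satisfies |dX|^2 = (ds^2 + h) / sg^2 ([stereographic]).  One
   formula covers all signs of C.  Composing X with a linear map that takes the
   Euclidean norm to that of [a], and with a translation, gives zeta, with
   k = F sg.  The metric identity itself shows that the differential of zeta is
   injective, so the inverse function theorem ([inverse_function]) makes zeta a
   diffeomorphism near the given vector.

   The functions f_a and p are solutions of Hess f = (c - C f) h, with c = 0 and
   c = 1.  As a first order system this is linear, and its integrability condition
   says that the curvature tensor of h is that of constant curvature; it is then
   solved along rays ([frobenius], [hessian_solution]).  The quadratic identities
   follow by uniqueness, because their defects solve a homogeneous linear system
   ([linear_system_zero]).  The curvature tensor is recovered from the sectional
   curvatures by polarization ([constant_curvature_tensor]); in dimension less
   than two, where there are no sectional curvatures, the tensor identity is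
   trivial and any C will do. *)

(** * Row vectors and directional derivatives *)

Section RowVectors.
Context {R : realType}.

Lemma norm_coord_le m n (M : 'M[R]_(m, n)) i j : `|M i j| <= `|M|.
Proof.
rewrite [leRHS]/Num.Def.normr/= mx_normrE.
exact: (le_bigmax _ (fun ij : 'I_m * 'I_n => `|M ij.1 ij.2|) (i, j)).
Qed.

Lemma norm_mx_le p q (M : 'M[R]_(p, q)) (b : R) :
  0 <= b -> (forall i j, `|M i j| <= b) -> `|M| <= b.
Proof.
move=> b0 vb; rewrite [leLHS]/Num.Def.normr/= mx_normrE.
by apply/bigmax_leP; split=> // -[i j] _ /=.
Qed.

Lemma norm_rV_le n (v : 'rV[R]_n) (b : R) :
  0 <= b -> (forall i, `|v 0 i| <= b) -> `|v| <= b.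
Proof.
by move=> b0 vb; apply: norm_mx_le => // i j; rewrite (ord1 i).
Qed.

Variable V : normedModType R.

Lemma diff_rVP n (f : V -> 'rV[R]_n) p :
  differentiable f p <-> forall i, differentiable (fun x => f x 0 i) p.
Proof.
split=> [df i|df].
  apply: (@differentiable_comp _ _ _ _ f (fun M : 'rV[R]_n => M 0 i)) => //.
  exact: differentiable_coord.
have -> : f = \sum_(i < n) (fun x => f x 0 i *: delta_mx 0 i).
  apply/funext => x; rewrite fct_sumE [LHS]row_sum_delta.
  by apply: eq_bigr.
by apply: differentiable_sum => i; apply: differentiableZl.
Qed.

Lemma derive_coord n (f : V -> 'rV[R]_n) p v i : differentiable f p ->
  ('D_v f p) 0 i = 'D_v (fun x => f x 0 i) p.
Proof.
move=> /diff_derivable df; rewrite derive_mx; last exact: df.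
by rewrite mxE.
Qed.

Lemma derive_rowE n (W : normedModType R) (g : 'rV[R]_n -> W) q w :
  differentiable g q -> 'D_w g q = \sum_i w 0 i *: partial i g q.
Proof.
move=> dg; rewrite deriveE// {1}(row_sum_delta w) linear_sum.
by apply: eq_bigr => i _; rewrite linearZ /partial deriveE.
Qed.

Lemma derive_chain n (W : normedModType R) (f : V -> 'rV[R]_n)
    (g : 'rV[R]_n -> W) p v : differentiable f p -> differentiable g (f p) ->
  'D_v (fun x => g (f x)) p = 'D_('D_v f p) g (f p).
Proof.
move=> df dg; have dc := differentiable_comp df dg.
by rewrite deriveE// diff_comp//= -!deriveE.
Qed.

Lemma derive_comp n (W : normedModType R) (f : V -> 'rV[R]_n)
    (g : 'rV[R]_n -> W) p v :
  differentiable f p -> differentiable g (f p) ->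
  'D_v (g \o f) p = \sum_i 'D_v (fun x => f x 0 i) p *: partial i g (f p).
Proof.
move=> df dg; rewrite [LHS]derive_chain// derive_rowE//.
by apply: eq_bigr => i _; rewrite derive_coord.
Qed.

Lemma is_derive_line (W : normedModType R) (f : V -> W) p v (t : R) :
  differentiable f (p + t *: v) ->
  is_derive t 1 (fun s => f (p + s *: v)) ('D_v f (p + t *: v)).
Proof.
move=> df.
have dl : is_diff t (fun s : R => p + s *: v) (fun h : R => h *: v).
  have := @is_diffD _ _ _ (cst p) (fun s : R => s *: v) 0 _ t _
    (is_diff_scalel t v).
  by move=> /(_ _)/is_diff_eq; apply; apply/funext => h; rewrite !fctE /= add0r.
have d1 : differentiable (fun s : R => p + s *: v) t by case: dl.
have dfl : differentiable (f \o (fun s : R => p + s *: v)) t.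
  exact: differentiable_comp.
apply: DeriveDef; first exact: diff_derivable.
rewrite deriveE// diff_comp//=.
by rewrite deriveE// diff_val /= scale1r.
Qed.

(** The continuity of the differential is automatic in finite dimension, so
   that a linear map approximating the increments to first order suffices. *)
Lemma differentiable_lin (n : nat) (f : 'rV[R]_n -> R) (l : 'rV[R]_n -> R) p :
  linear l ->
  (forall e : R, 0 < e ->
    \forall h \near (0 : 'rV[R]_n), `|f (h + p) - f p - l h| <= e * `|h|) ->
  differentiable f p /\ forall v, 'D_v f p = l v.
Proof.
move=> ll H.
pose Lm := GRing.isLinear.Build _ _ _ _ l ll.
pose L : {linear 'rV[R]_n -> R} := HB.pack l Lm.
have cL : continuous L.
  have lE v : l v = \sum_i v 0 i * l (delta_mx 0 i).
    rewrite -[LHS]/(L v) {1}(row_sum_delta v) linear_sum.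
    by apply: eq_bigr => i _; rewrite linearZ.
  have -> : (L : 'rV[R]_n -> R) =
      \sum_(i < n) (fun v : 'rV[R]_n => v 0 i * l (delta_mx 0 i)).
    by apply/funext => v; rewrite fct_sumE -lE.
  move=> v; apply: differentiable_continuous.
  apply: differentiable_sum => i; apply: differentiableM => //.
  exact: differentiable_coord.
have E : f \o shift p = cst (f p) + L +o_ (0 : 'rV[R]_n) id.
  apply/eqaddoP => e e0; have := H e e0.
  apply: filterS => h; rewrite /= => hh.
  by rewrite !fctE /= opprD addrA.
have dE := @diff_unique R _ _ f L p cL E.
have df : differentiable f p.
  by apply/diff_locallyP; split; rewrite dE.
by split=> // v; rewrite deriveE// dE.
Qed.

End RowVectors.

(** * Smooth functions *)

Section Smooth.
Context {R : realType}.
Implicit Types V W : normedModType R.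

(** Differentiability of order [k + 1].  Induction on [k] proves the closure
   properties that have no direct proof for all orders at once, such as those
   of products, inverses and compositions, whose derivatives involve the
   function itself. *)
Fixpoint ck V W (k : nat) (D : set V) (f : V -> W) : Prop :=
  if k is k'.+1 then
    (forall p, D p -> differentiable f p) /\
    (forall v, ck k' D (fun p => 'D_v f p))
  else forall p, D p -> differentiable f p.

Lemma ck_diff V W k (D : set V) (f : V -> W) p :
  ck k D f -> D p -> differentiable f p.
Proof. by case: k => [|k /= []] => H => [|_] Dp; exact: H. Qed.

Lemma ckW V W k (D : set V) (f : V -> W) : ck k.+1 D f -> ck k D f.
Proof.
elim: k f => [|k IH] f; first by case.
by move=> [df Hf]; split=> // v; exact/IH/Hf.
Qed.

Lemma near_open V W (D : set V) (f g : V -> W) p : open D -> D p ->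
  {in D, f =1 g} -> {near p, f =1 g}.
Proof.
move=> oD Dp fg; apply: filterS (open_nbhs_nbhs (conj oD Dp)) => q Dq.
by apply: fg; rewrite inE.
Qed.

(** Differentiability is local: [f] and [g] share the first order expansion
   that characterizes it. *)
Lemma differentiable_near V W (f g : V -> W) p : {near p, f =1 g} ->
  differentiable f p -> differentiable g p.
Proof.
move=> fg df; have cd : continuous ('d f p) by exact: diff_continuous.
have E : g \o shift p = cst (g p) + 'd f p +o_ (0 : V) id.
  have fs : \forall h \near (0 : V), f (h + p) = g (h + p).
    by move: fg; rewrite [X in X -> _](near_shift 0) subr0.
  apply/eqaddoP => e e0; have /eqaddoP/(_ e e0) := diff_locally df.
  apply: filterS2 fs => h fgh; rewrite /= !fctE /=.
  by rewrite fgh (nbhs_singleton fg).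
by apply/diff_locallyP; split; rewrite (diff_unique cd E).
Qed.

Lemma ck_ext V W k (D : set V) (f g : V -> W) : open D ->
  {in D, f =1 g} -> ck k D f -> ck k D g.
Proof.
move=> oD; elim: k f g => [|k IH] f g fg.
  move=> df p Dp; exact: (differentiable_near (near_open oD Dp fg) (df _ Dp)).
move=> [df Hf]; split=> [p Dp|v].
  by exact: (differentiable_near (near_open oD Dp fg) (df _ Dp)).
apply: IH (Hf v) => p; rewrite inE => Dp.
exact/near_eq_derive/(near_open oD Dp fg).
Qed.

(** The two orders of differentiation differ: [smooth_on] adds directions
   outside, [ck] inside, whence the induction on lists from the right. *)
Lemma smooth_ckP V W (D : set V) (f : V -> W) :
  smooth_on D f <-> forall k, ck k D f.
Proof.
have itE s v (g : V -> W) :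
    iter_derive (rcons s v) g = iter_derive s (fun p => 'D_v g p).
  by elim: s => //= w s ->.
split=> [sf k|Hf s].
  elim: k f sf => [|k IH] f sf; first exact: (sf [::]).
  split; first exact: (sf [::]).
  by move=> v; apply: IH => s p Dp; rewrite -itE; apply: sf.
elim/last_ind: s f Hf => [|s v IH] f Hf p Dp; first exact: (Hf 0%N).
by rewrite itE; apply: IH => // k; have [_ H] := Hf k.+1; exact: H.
Qed.

Lemma smooth_diff V W (D : set V) (f : V -> W) p :
  smooth_on D f -> D p -> differentiable f p.
Proof. by move=> sf; exact: (sf [::] p). Qed.

Lemma smooth_derive V W (D : set V) (f : V -> W) v :
  smooth_on D f -> smooth_on D (fun p => 'D_v f p).
Proof.
by move=> /smooth_ckP sf; apply/smooth_ckP => k; have [_ H] := sf k.+1; exact: H.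
Qed.

Lemma smooth_ext V W (D : set V) (f g : V -> W) : open D ->
  {in D, f =1 g} -> smooth_on D f -> smooth_on D g.
Proof.
by move=> oD fg /smooth_ckP sf; apply/smooth_ckP => k; apply: ck_ext fg _.
Qed.

Lemma smooth_sub V W (D D' : set V) (f : V -> W) : D' `<=` D ->
  smooth_on D f -> smooth_on D' f.
Proof. by move=> DD sf s p Dp; apply: (sf s p); exact: DD. Qed.

Lemma ck_cst V W k (D : set V) (w : W) : ck k D (fun=> w).
Proof.
elim: k w => [|k IH] w /=; first by move=> p _; exact: differentiable_cst.
split=> [p _|v]; first exact: differentiable_cst.
have -> : (fun p : V => 'D_v (fun=> w) p) = fun=> (0 : W).
  by apply/funext => p; exact: derive_cst.
exact: IH.
Qed.

Lemma ckD V W k (D : set V) (f g : V -> W) : open D ->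
  ck k D f -> ck k D g -> ck k D (fun p => f p + g p).
Proof.
move=> oD; elim: k f g => [|k IH] f g.
  by move=> df dg p Dp; apply: differentiableD; [apply: df|apply: dg].
move=> [df Hf] [dg Hg]; split=> [p Dp|v].
  by apply: differentiableD; [apply: df|apply: dg].
apply: (ck_ext oD) (IH _ _ (Hf v) (Hg v)) => p; rewrite inE => Dp.
by rewrite deriveD//; apply: diff_derivable; [apply: df|apply: dg].
Qed.

Lemma ckM V k (D : set V) (f g : V -> R) : open D ->
  ck k D f -> ck k D g -> ck k D (fun p => f p * g p).
Proof.
move=> oD; elim: k f g => [|k IH] f g.
  by move=> df dg p Dp; apply: differentiableM; [apply: df|apply: dg].
move=> Hf Hg; have [df Hf'] := Hf; have [dg Hg'] := Hg.
split=> [p Dp|v].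
  by apply: differentiableM; [apply: df|apply: dg].
apply: (ck_ext oD); last first.
  apply: (ckD oD); [exact: (IH _ _ (ckW Hf) (Hg' v))|
                    exact: (IH _ _ (ckW Hg) (Hf' v))].
move=> p; rewrite inE => Dp /=.
by rewrite deriveM//; apply: diff_derivable; [apply: df|apply: dg].
Qed.

Lemma ck_sum V k (D : set V) (I : Type) (r : seq I) (P : pred I)
    (f : I -> V -> R) : open D ->
  (forall i, P i -> ck k D (f i)) -> ck k D (fun p => \sum_(i <- r | P i) f i p).
Proof.
move=> oD Hf; elim: r => [|i r IH].
  have -> : (fun p : V => \sum_(i <- [::] | P i) f i p) = fun=> (0 : R).
    by apply/funext => p; rewrite big_nil.
  exact: ck_cst.
have -> : (fun p : V => \sum_(j <- i :: r | P j) f j p) =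
    fun p => (if P i then f i p else 0) + \sum_(j <- r | P j) f j p.
  by apply/funext => p; rewrite big_cons; case: ifP => //; rewrite add0r.
apply: (ckD oD) IH.
by case Pi : (P i); [exact: Hf|exact: ck_cst].
Qed.

Lemma ck_prod V k (D : set V) (I : Type) (r : seq I) (P : pred I)
    (f : I -> V -> R) : open D ->
  (forall i, P i -> ck k D (f i)) ->
  ck k D (fun p => \prod_(i <- r | P i) f i p).
Proof.
move=> oD Hf; elim: r => [|i r IH].
  have -> : (fun p : V => \prod_(i <- [::] | P i) f i p) = fun=> (1 : R).
    by apply/funext => p; rewrite big_nil.
  exact: ck_cst.
have -> : (fun p : V => \prod_(j <- i :: r | P j) f j p) =
    fun p => (if P i then f i p else 1) * \prod_(j <- r | P j) f j p.
  by apply/funext => p; rewrite big_cons; case: ifP => //; rewrite mul1r.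
apply: (ckM oD) IH.
by case Pi : (P i); [exact: Hf|exact: ck_cst].
Qed.

Lemma ckV V k (D : set V) (f : V -> R) : open D ->
  (forall p, D p -> f p != 0) -> ck k D f -> ck k D (fun p => (f p)^-1).
Proof.
move=> oD f0; elim: k => [|k IH].
  by move=> df p Dp; apply: differentiableV; [apply: df|apply: f0].
move=> Hf; have [df Hf'] := Hf.
split=> [p Dp|v].
  by apply: differentiableV; [apply: df|apply: f0].
have Hi := IH (ckW Hf).
apply: (ck_ext oD); last first.
  exact: (ckM oD (ckM oD (@ck_cst V R k D (-1)) (ckM oD Hi Hi)) (Hf' v)).
move=> p; rewrite inE => Dp /=.
rewrite deriveV//; [|exact: f0|by apply: diff_derivable; apply: df].
by rewrite expr2 invfM /GRing.scale /= mulN1r.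
Qed.

Lemma derive_ln V (f : V -> R) p v : differentiable f p -> 0 < f p ->
  'D_v (fun x => ln (f x)) p = 'D_v f p / f p.
Proof.
move=> df f0; have dl := is_derive1_ln f0.
have dln : differentiable (@ln R) (f p) by apply/derivable1_diffP; case: dl.
have dc := @differentiable_comp _ _ _ _ f (@ln R) p df dln.
rewrite (deriveE _ dc) (@diff_comp _ _ _ _ f (@ln R))//= -(deriveE _ df) diff1E//.
by rewrite derive1E (@derive_val _ _ _ _ _ _ _ dl) /GRing.scale.
Qed.

Lemma ck_ln V k (D : set V) (f : V -> R) : open D ->
  (forall p, D p -> 0 < f p) -> ck k D f -> ck k D (fun p => ln (f p)).
Proof.
move=> oD f0 Hf.
have dln (x : R) : 0 < x -> differentiable (@ln R) x.
  by move=> x0; apply/derivable1_diffP; have [] := is_derive1_ln x0.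
have dlnf p : D p -> differentiable (fun p => ln (f p)) p.
  move=> Dp; apply: (@differentiable_comp _ _ _ _ f (@ln R)).
    exact: (ck_diff Hf).
  exact/dln/f0.
case: k Hf => [|k] Hf; first exact: dlnf.
split=> // v; have [df Hf'] := Hf.
apply: (ck_ext oD); last first.
  refine (ckM oD (ckV oD _ (ckW Hf)) (Hf' v)).
  by move=> p Dp; rewrite gt_eqF// f0.
move=> p; rewrite inE => Dp /=.
exact: etrans (mulrC _ _) (esym (derive_ln v (df _ Dp) (f0 _ Dp))).
Qed.

(** The chain rule expresses the derivative by derivatives of [g] composed with
   [f], so the induction is on [k] with [g] generalized. *)
Lemma ck_comp V n k (D : set V) (E : set 'rV[R]_n) (f : V -> 'rV[R]_n)
    (g : 'rV[R]_n -> R) : open D -> (forall p, D p -> E (f p)) ->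
  (forall i, ck k D (fun p => f p 0 i)) -> ck k E g ->
  ck k D (fun p => g (f p)).
Proof.
move=> oD fE Hf.
have df p : D p -> differentiable f p.
  by move=> Dp; apply/diff_rVP => i; exact: ck_diff (Hf i) Dp.
elim: k g Hf => [|k IH] g Hf Hg.
  move=> p Dp; apply: (differentiable_comp (df p Dp)); exact/Hg/fE.
have dgf p : D p -> differentiable (g \o f) p.
  by move=> Dp; apply: (differentiable_comp (df p Dp)); exact/(ck_diff Hg)/fE.
split=> // v; apply: (ck_ext oD); last first.
  apply: (@ck_sum V k D 'I_n (index_enum 'I_n) xpredT
    (fun i p => 'D_v (fun x => f x 0 i) p * partial i g (f p)) oD) => i _.
  have [_ Hfi] := Hf i; have [_ Hgi] := Hg.
  apply: (ckM oD (Hfi v)); apply: IH; last exact: Hgi.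
  by move=> j; exact: ckW.
move=> p; rewrite inE => Dp /=.
rewrite -[LHS]/(\sum_i _ *: _) -(@derive_comp R V n R f g)//; first exact: df.
by apply: ck_diff Hg _; exact: fE.
Qed.

Lemma ck_coord n k (D : set 'rV[R]_n) i : ck k D (fun v => v 0 i).
Proof.
have dc p : differentiable (fun v : 'rV[R]_n => v 0 i) p.
  exact: differentiable_coord.
case: k => [|k]; first by move=> p _.
split=> // v.
have -> : (fun p : 'rV[R]_n => 'D_v (fun w : 'rV[R]_n => w 0 i) p) = fun=> v 0 i.
  by apply/funext => p; rewrite -(@derive_coord R 'rV[R]_n n id)// derive_id.
exact: ck_cst.
Qed.

Lemma ck_rVP V n k (D : set V) (f : V -> 'rV[R]_n) : open D ->
  ck k D f <-> forall i, ck k D (fun p => f p 0 i).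
Proof.
move=> oD; elim: k f => [|k IH] f.
  split=> [df i p Dp|df p Dp]; first by move/diff_rVP: (df p Dp).
  by apply/diff_rVP => i; exact: df.
split=> [[df Hf] i|Hf].
  split=> [p Dp|v]; first by move/diff_rVP: (df p Dp).
  move/IH: (Hf v) => /(_ i); apply: (ck_ext oD) => p; rewrite inE => Dp.
  by rewrite derive_coord//; exact: df.
have df p : D p -> differentiable f p.
  by move=> Dp; apply/diff_rVP => i; have [H _] := Hf i; exact: H.
split=> // v; apply/IH => i; case: (Hf i) => _ /(_ v).
apply: (ck_ext oD) => p; rewrite inE => Dp.
by rewrite derive_coord//; exact: df.
Qed.

End Smooth.

Section SmoothAlgebra.
Context {R : realType}.
Implicit Types V W : normedModType R.

Lemma smooth_cst V W (D : set V) (w : W) : smooth_on D (fun=> w).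
Proof. by apply/smooth_ckP => k; exact: ck_cst. Qed.

Lemma smoothD V W (D : set V) (f g : V -> W) : open D ->
  smooth_on D f -> smooth_on D g -> smooth_on D (fun p => f p + g p).
Proof.
by move=> oD /smooth_ckP sf /smooth_ckP sg; apply/smooth_ckP => k; apply: ckD.
Qed.

Lemma smoothM V (D : set V) (f g : V -> R) : open D ->
  smooth_on D f -> smooth_on D g -> smooth_on D (fun p => f p * g p).
Proof.
by move=> oD /smooth_ckP sf /smooth_ckP sg; apply/smooth_ckP => k; apply: ckM.
Qed.

Lemma smoothN V (D : set V) (f : V -> R) : open D ->
  smooth_on D f -> smooth_on D (fun p => - f p).
Proof.
move=> oD sf.
have -> : (fun p => - f p) = fun p => -1 * f p.
  by apply/funext => p; rewrite mulN1r.
by apply: smoothM sf => //; exact: smooth_cst.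
Qed.

Lemma smoothB V (D : set V) (f g : V -> R) : open D ->
  smooth_on D f -> smooth_on D g -> smooth_on D (fun p => f p - g p).
Proof. by move=> oD sf sg; apply: smoothD => //; exact: smoothN. Qed.

Lemma smooth_sum V (D : set V) (I : Type) (r : seq I) (P : pred I)
    (f : I -> V -> R) : open D -> (forall i, smooth_on D (f i)) ->
  smooth_on D (fun p => \sum_(i <- r | P i) f i p).
Proof.
move=> oD sf; apply/smooth_ckP => k; apply: ck_sum => // i _.
by move/smooth_ckP: (sf i).
Qed.

Lemma smooth_prod V (D : set V) (I : Type) (r : seq I) (P : pred I)
    (f : I -> V -> R) : open D -> (forall i, smooth_on D (f i)) ->
  smooth_on D (fun p => \prod_(i <- r | P i) f i p).
Proof.
move=> oD sf; apply/smooth_ckP => k; apply: ck_prod => // i _.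
by move/smooth_ckP: (sf i).
Qed.

Lemma smoothV V (D : set V) (f : V -> R) : open D ->
  (forall p, D p -> f p != 0) ->
  smooth_on D f -> smooth_on D (fun p => (f p)^-1).
Proof.
by move=> oD f0 /smooth_ckP sf; apply/smooth_ckP => k; apply: ckV.
Qed.

Lemma smooth_ln V (D : set V) (f : V -> R) : open D ->
  (forall p, D p -> 0 < f p) ->
  smooth_on D f -> smooth_on D (fun p => ln (f p)).
Proof.
by move=> oD f0 /smooth_ckP sf; apply/smooth_ckP => k; apply: ck_ln.
Qed.

Lemma smooth_coord n (D : set 'rV[R]_n) i :
  smooth_on D (fun v : 'rV[R]_n => v 0 i).
Proof. by apply/smooth_ckP => k; exact: ck_coord. Qed.

Lemma smooth_rVP V n (D : set V) (f : V -> 'rV[R]_n) : open D ->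
  smooth_on D f <-> forall i, smooth_on D (fun p => f p 0 i).
Proof.
move=> oD; split=> [/smooth_ckP sf i|sf].
  by apply/smooth_ckP => k; move: (sf k) => /(ck_rVP _ _ oD).
apply/smooth_ckP => k; apply/(ck_rVP _ _ oD) => i.
by move/smooth_ckP: (sf i).
Qed.

Lemma smooth_comp V n (D : set V) (E : set 'rV[R]_n) (f : V -> 'rV[R]_n)
    (g : 'rV[R]_n -> R) : open D -> (forall p, D p -> E (f p)) ->
  smooth_on D f -> smooth_on E g -> smooth_on D (fun p => g (f p)).
Proof.
move=> oD fE /(smooth_rVP _ oD) sf /smooth_ckP sg; apply/smooth_ckP => k.
by apply: (ck_comp oD fE) => // i; move/smooth_ckP: (sf i).
Qed.

Lemma smooth_det V n (D : set V) (A : V -> 'M[R]_n) : open D ->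
  (forall i j, smooth_on D (fun p => A p i j)) ->
  smooth_on D (fun p => \det (A p)).
Proof.
move=> oD sA; apply: smooth_sum => // s; apply: smoothM => //.
  exact: smooth_cst.
exact: smooth_prod.
Qed.

(** Cramer's rule writes the entries of the inverse as quotients of
   polynomials. *)
Lemma smooth_invmx V n (D : set V) (A : V -> 'M[R]_n) i j : open D ->
  (forall p, D p -> A p \in unitmx) ->
  (forall i j, smooth_on D (fun p => A p i j)) ->
  smooth_on D (fun p => invmx (A p) i j).
Proof.
move=> oD uA sA.
apply: (@smooth_ext R V R D (fun p => (\det (A p))^-1 * cofactor (A p) j i)) => //.
  by move=> p; rewrite inE => /uA Ap; rewrite /invmx Ap !mxE.
apply: smoothM => //.
  apply: smoothV => //; last exact: smooth_det.
  by move=> p /uA; rewrite unitmxE unitfE.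
apply: smoothM => //; first exact: smooth_cst.
apply: smooth_det => // k l.
by under eq_fun do rewrite !mxE; exact: sA.
Qed.

End SmoothAlgebra.

(** * Mean values and the symmetry of second derivatives *)

Section MeanValue.
Context {R : realType}.

Lemma mvt (f df : R -> R) (a b : R) : a < b ->
  (forall x, a <= x <= b -> is_derive x 1 f (df x)) ->
  exists2 c, a < c < b & f b - f a = df c * (b - a).
Proof.
move=> ab fd.
have [||c cab E] := @MVT R f df a b ab.
- by move=> x; rewrite in_itv /= => /andP[ax xb]; apply: fd; rewrite !ltW.
- apply: derivable_within_continuous => x; rewrite in_itv /= => xab.
  by have [] := fd x xab.
by exists c => //; move: cab; rewrite in_itv.
Qed.

Lemma mean_value_bound (f df : R -> R) (a b M : R) : a <= b ->
  (forall x, a <= x <= b -> is_derive x 1 f (df x)) ->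
  (forall x, a <= x <= b -> `|df x| <= M) ->
  `|f b - f a| <= M * (b - a).
Proof.
rewrite le_eqVlt => /predU1P[->|ab] fd dM; first by rewrite !subrr normr0 mulr0.
have [c /andP[ac cb] ->] := mvt ab fd.
have ba : 0 <= b - a by rewrite subr_ge0 ltW.
rewrite normrM (ger0_norm ba) ler_wpM2r//.
by apply: dM; rewrite !ltW.
Qed.

End MeanValue.

Section Schwarz.
Context {R : realType} {V : normedModType R}.

(** The increment in the direction [v] of the difference of [f] along [w] is
   estimated by the mean value theorem on the segment [s *: v], and the values of
   the derivative along [v] are compared by its first order expansion at [p]. *)
Let second_difference (D : set V) (f : V -> R) p v w : open D -> D p ->
  ck 1 D f -> forall e : R, 0 < e -> exists2 d : R, 0 < d & forall t, 0 < t < d ->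
  `|f (p + t *: v + t *: w) - f (p + t *: v) - f (p + t *: w) + f p
    - t ^+ 2 * 'D_w (fun q => 'D_v f q) p| <= e * t ^+ 2.
Proof.
move=> oD Dp [df d2f] e e0.
pose g (q : V) : R := 'D_v f q.
have dg : differentiable g p by exact: d2f.
pose c := 2 * (`|v| + `|w| + 1).
have c0 : 0 < c by rewrite mulr_gt0// addr_gt0// ltr_pwDr// addr_ge0.
have e'0 : 0 < e / c by rewrite divr_gt0.
have /eqaddoP/(_ _ e'0)/nbhs_ballP[r /= r0 Hr] := diff_locally dg.
have /nbhs_ballP[r' /= r'0 HD] := open_nbhs_nbhs (conj oD Dp).
pose m := Num.min r r'.
have m0 : 0 < m by rewrite lt_min r0.
pose d := m / (`|v| + `|w| + 1).
have k0 : 0 < `|v| + `|w| + 1 by rewrite ltr_pwDr// addr_ge0.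
exists d; first by rewrite divr_gt0.
move=> t /andP[t0 td].
have tm : t * (`|v| + `|w| + 1) < m by rewrite -ltr_pdivlMr.
have small s : 0 <= s <= t -> `|s *: v + t *: w| < m /\ `|s *: v| < m.
  move=> /andP[s0 st].
  have sv : `|s *: v| <= t * `|v| by rewrite normrZ ger0_norm// ler_wpM2r.
  have tw : `|t *: w| = t * `|w| by rewrite normrZ ger0_norm// ltW.
  split.
    apply: le_lt_trans tm; rewrite !mulrDr mulr1 (le_trans (ler_normD _ _))//.
    by rewrite tw -addrA lerD// lerDl ltW.
  apply: le_lt_trans tm; rewrite !mulrDr mulr1 (le_trans sv)//.
  by rewrite -addrA lerDl addr_ge0 ?mulr_ge0// ltW.
have inD h : `|h| < m -> D (p + h).
  move=> hm; apply: HD; rewrite -ball_normE /= opprD addrA subrr sub0r normrN.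
  by apply: lt_le_trans hm _; rewrite ge_min lexx orbT.
pose phi s := f (p + t *: w + s *: v) - f (p + s *: v).
have dphi s : 0 <= s <= t ->
    is_derive s 1 phi (g (p + t *: w + s *: v) - g (p + s *: v)).
  move=> st; have [h1 h2] := small s st.
  apply: is_deriveB; apply: is_derive_line; apply: df.
    by rewrite -addrA (addrC (t *: w)); apply: inD.
  exact: inD.
have [s /andP[s0 st] E] := mvt t0 dphi.
have -> : f (p + t *: v + t *: w) - f (p + t *: v) - f (p + t *: w) + f p =
    phi t - phi 0.
  rewrite /phi scale0r !addr0 (addrAC p (t *: v)); ring.
have pE : p + t *: w + s *: v = p + (s *: v + t *: w).
  by rewrite -addrA (addrC (t *: w)).
rewrite E subr0 pE.
have G h : `|h| < m -> `|g (p + h) - g p - 'D_h g p| <= e / c * `|h|.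
  move=> hm; have := Hr h; rewrite /= !fctE /= opprD addrA (addrC h).
  rewrite deriveE//; apply; rewrite -ball_normE /= sub0r normrN.
  by apply: lt_le_trans hm _; rewrite ge_min lexx.
have st' : 0 <= s <= t by rewrite !ltW.
have [h1 h2] := small s st'.
have := G _ h1; have := G _ h2.
set A := g (p + s *: v); set B := g (p + (_ + _)).
have -> : 'D_(s *: v + t *: w) g p = s * 'D_v g p + t * 'D_w g p.
  by rewrite !deriveE// linearD !linearZ.
have -> : 'D_(s *: v) g p = s * 'D_v g p by rewrite !deriveE// linearZ.
move=> HA HB.
have -> : (B - A) * t - t ^+ 2 * 'D_w g p =
  t * ((B - g p - (s * 'D_v g p + t * 'D_w g p)) - (A - g p - s * 'D_v g p)).
  by generalize B A (g p) ('D_v g p : R) ('D_w g p : R) => *; ring.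
rewrite normrM (gtr0_norm t0) expr2 [leRHS]mulrCA (ler_wpM2l (ltW t0))//.
rewrite (le_trans (ler_normB _ _))//.
have nle : `|s *: v + t *: w| <= t * (`|v| + `|w| + 1) /\
    `|s *: v| <= t * (`|v| + `|w| + 1).
  have sv : `|s *: v| <= t * `|v|.
    by rewrite normrZ ger0_norm ?ler_wpM2r// ltW.
  have tw : `|t *: w| = t * `|w| by rewrite normrZ ger0_norm// ltW.
  rewrite !mulrDr mulr1; split.
    by rewrite (le_trans (ler_normD _ _))// tw -addrA lerD// lerDl ltW.
  by rewrite (le_trans sv)// -addrA lerDl addr_ge0 ?mulr_ge0// ltW.
have [n1 n2] := nle.
have n1' := ler_wpM2l (ltW e'0) n1; have n2' := ler_wpM2l (ltW e'0) n2.
have -> : e * t = e / c * (t * (`|v| + `|w| + 1)) + e / c * (t * (`|v| + `|w| + 1)).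
  rewrite /c; field; exact: lt0r_neq0.
by apply: lerD; [apply: le_trans HB _|apply: le_trans HA _].
Qed.

(** Both mixed derivatives are the limit of one symmetric second difference. *)
Lemma schwarz (D : set V) (f : V -> R) p v w : open D -> D p -> smooth_on D f ->
  'D_w (fun q => 'D_v f q) p = 'D_v (fun q => 'D_w f q) p.
Proof.
move=> oD Dp /smooth_ckP sf.
set A := LHS; set B := RHS.
apply/eqP; rewrite -subr_eq0 -normr_le0; apply/ler_addgt0Pr => e e0; rewrite add0r.
have e20 : 0 < e / 2 by rewrite divr_gt0.
have [d1 d10 H1] := second_difference v w oD Dp (sf 1%N) e20.
have [d2 d20 H2] := second_difference w v oD Dp (sf 1%N) e20.
have m0 : 0 < Num.min d1 d2 by rewrite lt_min d10.
have [t t0 tm] : exists2 t, 0 < t & t < Num.min d1 d2.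
  by exists (Num.min d1 d2 / 2); lra.
have := H1 t; rewrite t0 (lt_le_trans tm) ?ge_min ?lexx// => /(_ isT).
have := H2 t; rewrite t0 (lt_le_trans tm) ?ge_min ?lexx ?orbT// => /(_ isT).
rewrite -/A -/B (addrAC p (t *: w)).
set X := f _; set Y := f (p + t *: v); set Z := f (p + t *: w) => E2 E1.
have t20 : 0 < t ^+ 2 by rewrite exprn_gt0.
rewrite -(ler_pM2l t20) -(gtr0_norm t20) -normrM (gtr0_norm t20).
have alg (a b x y z q s : R) : s * (a - b) =
  (x - z - y + q - s * b) - (x - y - z + q - s * a) by ring.
rewrite (alg _ _ X Y Z (f p)).
rewrite (le_trans (ler_normB _ _))//.
rewrite [leRHS]mulrC [in leRHS](splitr e) mulrDl.
exact: (lerD E2 E1).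
Qed.

End Schwarz.

(** * Linear differential equations on an interval *)

Section LinearODE.
Context {R : realType}.

(** The increment form of the derivative, for functions obtained as limits. *)
Lemma is_derive_eps (f : R -> R) (t l : R) :
  (forall e : R, 0 < e -> exists2 d : R, 0 < d & forall h, `|h| < d ->
    `|f (t + h) - f t - h * l| <= e * `|h|) -> is_derive t 1 f l.
Proof.
move=> H.
suff C : (fun h => h^-1 *: ((f \o shift t) (h *: 1) - f t)) @ 0^' --> l.
  by apply: DeriveDef; [apply/cvg_ex; exists l|apply/cvg_lim].
apply/cvgrPdist_le => e e0; have [d d0 Hd] := H e e0.
near=> h.
have h0 : h != 0 by near: h; exact: nbhs_dnbhs_neq.
have hd : `|h| < d.
  by near: h; apply: dnbhs0_lt.
have := Hd h hd; rewrite /= [h *: 1]mulr1 (addrC h t) -[h^-1 *: _]/(h^-1 * _).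
have -> : l - h^-1 * (f (t + h) - f t) = - (h^-1 * (f (t + h) - f t - h * l)).
  by field.
by rewrite normrN normrM normfV ler_pdivrMl ?normr_gt0// [`|h| * e]mulrC.
Unshelve. all: by end_near. Qed.

Lemma is_derive_continuous (f : R -> R) (t l : R) :
  is_derive t 1 f l -> continuous_at t f.
Proof.
by move=> [df _]; apply: differentiable_continuous; exact/derivable1_diffP.
Qed.

Lemma continuous_for_sum (I : Type) (r : seq I) (f : I -> R -> R) t :
  (forall i, continuous_at t (f i)) ->
  continuous_at t (fun t => \sum_(i <- r) f i t).
Proof.
move=> cf; elim: r => [|i r IH].
  by under eq_fun do rewrite big_nil; exact: cvg_cst.
rewrite (_ : (fun t => _) = f i + fun t => \sum_(j <- r) f j t).
  by apply: continuousD; [exact: cf|exact: IH].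
by apply/funext => s; rewrite big_cons.
Qed.

Let clamp (t : R) : R := Num.max (- (3 / 2)) (Num.min t (3 / 2)).

Let clamp_continuous : continuous clamp.
Proof.
have C : continuous (cst (- (3 / 2)) \max (id \min cst (3 / 2)) : R -> R).
  apply: max_fun_continuous; first by move=> t; exact: cvg_cst.
  by apply: min_fun_continuous => t; [exact: cvg_id|exact: cvg_cst].
exact: C.
Qed.

Let clampP t : -2 < clamp t < 2.
Proof. by rewrite /clamp lt_max gt_max gt_min lt_min; apply/andP; split; lra. Qed.

(** The integral from -2 is a primitive on ]-2, 2[ only.  Precomposing it with
   the truncation [clamp] to [-3/2, 3/2] makes it continuous everywhere, so that
   it can be the input of the next integration. *)
Lemma primitive (f : R -> R) : continuous f -> exists F : R -> R,
  [/\ continuous F, F 0 = 0 &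
      forall t : R, `|t| < 3 / 2 -> is_derive t 1 F (f t)].
Proof.
move=> cf.
pose G x := (\int[lebesgue_measure]_(t in [set` `[(-2 : R), x]]) (f t))%R.
have dG (x : R) : -2 < x < 2 -> is_derive x 1 G (f x).
  move=> /andP[x2 x2'].
  have fi : lebesgue_measure.-integrable [set` `[(-2 : R), 2]] (EFin \o f).
    apply: continuous_compact_integrable; first exact: segment_compact.
    exact: continuous_subspaceT.
  have [dG GE] := @continuous_FTC1_closed R f (-2) x 2 x2' fi x2 (cf x).
  by apply: DeriveDef; [exact: dG|rewrite -derive1E; exact: GE].
have c0 : clamp 0 = 0 by rewrite /clamp min_l ?max_r//; lra.
exists (fun t => G (clamp t) - G (clamp 0)); split.
- move=> t; apply: cvgB; last exact: cvg_cst.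
  apply: continuous_comp; first exact: clamp_continuous.
  exact/is_derive_continuous/dG/clampP.
- by rewrite subrr.
move=> t t3.
have t2 : -2 < t < 2.
  by move: t3; rewrite ltr_norml => /andP[? ?]; apply/andP; split; lra.
apply: (@near_eq_is_derive _ _ _ (fun s => G s - G (clamp 0))).
  have : \forall s \near t, `|s| < 3 / 2.
    exact: (@cvgr_norm_lt _ R^o R^o _ _ id t cvg_id _ t3).
  apply: filterS => s; rewrite ltr_norml => /andP[s1 s2].
  congr (G _ - _); rewrite /clamp min_l ?max_r//; lra.
have D := is_deriveB (dG t t2) (is_derive_cst (G (clamp 0)) t 1).
by apply: is_derive_eq D _; rewrite subr0.
Qed.

(** A linear integral inequality with a small coefficient forces its solution to
   be of the size of the inhomogeneous term: compare at the maximum. *)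
Lemma small_gronwall m (e : R -> 'rV[R]_m) (d : R -> 'rV[R]_m) (delta : R) :
  0 <= delta -> e 0 = 0 ->
  (forall (t : R) i, 0 <= t <= 1 -> is_derive t 1 (fun s => e s 0 i) (d t 0 i)) ->
  (forall t i, 0 <= t <= 1 -> `|d t 0 i| <= 2^-1 * `|e t| + delta) ->
  forall t, 0 <= t <= 1 -> `|e t| <= 2 * delta.
Proof.
move=> delta0 e0 de bd.
have ce : {within `[0, 1], continuous (fun t => `|e t|)}.
  have ce' : {within `[(0 : R), 1], continuous e}.
    apply: derivable_within_continuous => x; rewrite in_itv /= => x01.
    by apply/derivable_mxP => i j; rewrite (ord1 i); have [] := de x j x01.
  move=> x; apply: continuous_comp; first exact: ce'.
  exact: norm_continuous.
have [s] := @EVT_max R (fun t => `|e t|) 0 1 ler01 ce.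
rewrite in_itv /= => s01 smax.
suff es : `|e s| <= 2 * delta.
  by move=> t t01; apply: le_trans es; apply: smax; rewrite in_itv.
suff : `|e s| <= 2^-1 * `|e s| + delta by move=> ?; lra.
have /andP[s0 s1] := s01.
apply: norm_rV_le => [|i]; first by rewrite addr_ge0// mulr_ge0.
have mid x : 0 <= x <= s -> 0 <= x <= 1.
  by move=> /andP[-> /le_trans]; apply.
have := @mean_value_bound R (fun t => e t 0 i) (fun t => d t 0 i) 0 s
  (2^-1 * `|e s| + delta) s0.
rewrite e0 mxE !subr0 => H; apply: le_trans (H _ _) _.
- by move=> x /mid; exact: de.
- move=> x /mid x01; apply: le_trans (bd x i x01) _.
  by rewrite lerD2r ler_pM2l//; apply: smax; rewrite in_itv.
by rewrite ler_piMr// addr_ge0// mulr_ge0.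
Qed.

Variables (m : nat) (B : R -> 'M[R]_m).
Hypothesis cB : forall i j, continuous (fun t => B t i j).
Hypothesis smallB : forall t j, `|t| < 3 / 2 -> \sum_i `|B t i j| <= 4^-1.

Lemma small_mulmx t (x : 'rV[R]_m) j : `|t| < 3 / 2 ->
  `|(x *m B t) 0 j| <= 4^-1 * `|x|.
Proof.
move=> t3; rewrite mxE (le_trans (ler_norm_sum _ _ _))//.
apply: (@le_trans _ _ (\sum_i `|B t i j| * `|x|)).
  by apply: ler_sum => i _; rewrite normrM mulrC ler_wpM2l// norm_coord_le.
by rewrite -mulr_suml ler_wpM2r// smallB.
Qed.

Lemma mulmx_continuous (x : R -> 'rV[R]_m) t j :
  (forall i, continuous_at t (fun t => x t 0 i)) ->
  continuous_at t (fun t => (x t *m B t) 0 j).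
Proof.
move=> cx; rewrite (_ : (fun _ => _) = fun t => \sum_k x t 0 k * B t k j).
  apply: (@continuous_for_sum _ _ (fun k t => x t 0 k * B t k j)) => k.
  by apply: (@cvgM R R^o); [exact: cx|exact: cB].
by apply/funext => s; rewrite mxE.
Qed.

(** One Picard step: the integral from 0 of [x *m B], the primitive being
   chosen among those that [primitive] provides. *)
Definition prim_row (x : R -> 'rV[R]_m) (t : R) : 'rV[R]_m :=
  \row_j xget (fun=> 0) [set F : R -> R | [/\ continuous F, F 0 = 0 &
      forall t : R, `|t| < 3 / 2 -> is_derive t 1 F ((x t *m B t) 0 j)]] t.

Lemma prim_rowP (x : R -> 'rV[R]_m) : (forall i, continuous (fun t => x t 0 i)) ->
  [/\ forall i, continuous (fun t => prim_row x t 0 i), prim_row x 0 = 0 &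
    forall (t : R) i, `|t| < 3 / 2 ->
      is_derive t 1 (fun s => prim_row x s 0 i) ((x t *m B t) 0 i)].
Proof.
move=> cx.
have P j : [set F : R -> R | [/\ continuous F, F 0 = 0 &
      forall t : R, `|t| < 3 / 2 -> is_derive t 1 F ((x t *m B t) 0 j)]]
   (fun t => prim_row x t 0 j).
  have -> : (fun t => prim_row x t 0 j) = xget (fun=> 0) [set F : R -> R |
     [/\ continuous F, F 0 = 0 &
      forall t : R, `|t| < 3 / 2 -> is_derive t 1 F ((x t *m B t) 0 j)]].
    by apply/funext => t; rewrite mxE.
  have [F HF] := primitive (fun t => @mulmx_continuous x t j (cx^~ t)).
  by apply: xgetPex; exists F.
split=> [i||t i]; first by have [] := P i.
  by apply/rowP => j; rewrite [RHS]mxE; have [] := P j.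
by have [_ _] := P i; apply.
Qed.

Variable x0 : 'rV[R]_m.

(* The k-th term of the Picard series; the solution is the sum of all terms. *)
Let inc (k : nat) : R -> 'rV[R]_m := iter k prim_row (fun=> x0).

Let inc_cont k i : continuous (fun t => inc k t 0 i).
Proof.
case: k => [|k]; first by move=> t; exact: cvg_cst.
elim: k i => [|k IH] i /=.
  by have [] := @prim_rowP (fun=> x0) (fun i t => @cvg_cst _ _ _ _ _).
by have [] := prim_rowP IH.
Qed.

Let inc_der k (t : R) i : `|t| < 3 / 2 ->
  is_derive t 1 (fun s => inc k.+1 s 0 i) ((inc k t *m B t) 0 i).
Proof. by have [_ _] := prim_rowP (@inc_cont k); apply. Qed.

Let inc0 k : inc k.+1 0 = 0.
Proof. by have [] := prim_rowP (@inc_cont k). Qed.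

(** The mean value bound from 0, in both directions of time. *)
Lemma mean_value_bound0 (f df : R -> R) (t M : R) : f 0 = 0 -> `|t| < 3 / 2 ->
  (forall s : R, `|s| < 3 / 2 -> is_derive s 1 f (df s)) ->
  (forall s, `|s| < 3 / 2 -> `|df s| <= M) -> `|f t| <= M * `|t|.
Proof.
move=> f0 t3 fd dM.
have [t0|t0] := leP 0 t.
  have := @mean_value_bound R f df 0 t M t0; rewrite f0 !subr0 (ger0_norm t0).
  have b s : 0 <= s <= t -> `|s| < 3 / 2.
    move=> /andP[s0 st]; rewrite ger0_norm// (le_lt_trans st)//.
    by rewrite -(ger0_norm t0).
  by apply=> s /b; [exact: fd|exact: dM].
have := @mean_value_bound R f df t 0 M (ltW t0).
rewrite f0 !sub0r normrN (ltr0_norm t0).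
have b s : t <= s <= 0 -> `|s| < 3 / 2.
  move=> /andP[ts s0]; rewrite ler0_norm//.
  by apply: le_lt_trans t3; rewrite (ltr0_norm t0) lerN2.
by apply=> s /b; [exact: fd|exact: dM].
Qed.

Let inc_bound k t : `|t| < 3 / 2 -> `|inc k t| <= `|x0| * 2^-1 ^+ k.
Proof.
elim: k t => [|k IH] t t3; first by rewrite expr0 mulr1.
apply: norm_rV_le => [|i]; first by rewrite mulr_ge0 ?exprn_ge0.
have := @mean_value_bound0 (fun t => inc k.+1 t 0 i)
   (fun t => (inc k t *m B t) 0 i) t (4^-1 * (`|x0| * 2^-1 ^+ k)) _ t3.
move=> H; apply: le_trans (H _ _ _) _.
- by rewrite inc0 mxE.
- by move=> s s3; exact: inc_der.
- move=> s s3; apply: le_trans (small_mulmx _ _ s3) _.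
  by rewrite ler_pM2l// IH.
have X0 : 0 <= `|x0| * 2^-1 ^+ k by rewrite mulr_ge0 ?exprn_ge0.
rewrite exprSr [leRHS]mulrA; move: (`|x0| * _) X0 => X X0.
by have := ler_wpM2l X0 (ltW t3); lra.
Qed.

Let S n (t : R) : 'rV[R]_m := \sum_(k < n) inc k t.

Let S_coord n t i : S n t 0 i = \sum_(k < n) inc k t 0 i.
Proof. by rewrite /S summxE. Qed.

Let S_der n (t : R) i : `|t| < 3 / 2 ->
  is_derive t 1 (fun s => S n.+1 s 0 i) ((S n t *m B t) 0 i).
Proof.
move=> t3.
have -> : (fun s => S n.+1 s 0 i) =
    \sum_(k < n) (fun s => inc k.+1 s 0 i) + cst (x0 0 i).
  apply/funext => s; rewrite S_coord big_ord_recl addrC.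
  by rewrite fctE fct_sumE.
have -> : (S n t *m B t) 0 i = \sum_(k < n) (inc k t *m B t) 0 i + 0.
  by rewrite /S mulmx_suml summxE addr0.
apply: is_deriveD; apply: is_derive_sum => k; exact: inc_der.
Qed.

Let S_dist n p t : `|t| < 3 / 2 ->
  `|S (n + p) t - S n t| <= 2 * `|x0| * 2^-1 ^+ n.
Proof.
move=> t3.
have -> : S (n + p) t - S n t = \sum_(k < p) inc (n + k) t.
  by rewrite /S big_split_ord /= addrAC subrr add0r.
suff : `|\sum_(k < p) inc (n + k) t| <=
    2 * `|x0| * 2^-1 ^+ n * (1 - 2^-1 ^+ p).
  by move=> H; apply: le_trans H _; rewrite ler_piMr.
elim: p => [|p IH]; first by rewrite big_ord0 normr0 expr0 subrr mulr0.
rewrite big_ord_recr /= (le_trans (ler_normD _ _))//.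
apply: le_trans (lerD IH (inc_bound (n + p) t3)) _.
rewrite exprD [in leRHS]exprS.
have : 0 <= `|x0| * 2^-1 ^+ n * 2^-1 ^+ p.
  by rewrite !mulr_ge0 ?exprn_ge0.
move: (`|x0|) (2^-1 ^+ n) (2^-1 ^+ p) => a b c; lra.
Qed.

Let half_small (c e : R) : 0 <= c -> 0 < e -> exists n, c * 2^-1 ^+ n < e.
Proof.
move=> c0 e0.
have : geometric c 2^-1 @ \oo --> (0 : R).
  by apply: cvg_geometric; rewrite ger0_norm// invf_lt1// ltr1n.
move=> /cvgrPdist_lt/(_ e e0)[n _ /(_ n)] /= Hn; exists n.
move: (Hn (leqnn n)); rewrite sub0r normrN ger0_norm//.
by rewrite mulr_ge0 ?exprn_ge0.
Qed.

Let x (t : R) : 'rV[R]_m := \row_i limn (fun n => S n t 0 i).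

Let S_lim t i : `|t| < 3 / 2 -> (fun n => S n t 0 i) @ \oo --> x t 0 i.
Proof.
move=> t3; rewrite mxE.
suff : cvgn (fun n => S n t 0 i) by [].
apply/cauchy_cvgP/cauchy_exP => e e0.
have c0 : 0 <= 2 * `|x0| by rewrite mulr_ge0.
have [n Hn] := half_small c0 e0.
exists (S n t 0 i); exists n => // p /= np.
rewrite -ball_normE /= distrC; apply: le_lt_trans Hn.
have := S_dist n (p - n) t3; rewrite subnKC// => H.
apply: le_trans H; have := norm_coord_le (S p t - S n t) 0 i.
by rewrite !mxE.
Qed.

(* The tail of the series, uniformly in [t]: the halving comes from the bound
   1/4 on [B] and the length 3/2 < 2 of the time interval. *)
Let S_close n t i : `|t| < 3 / 2 ->
  `|x t 0 i - S n t 0 i| <= 2 * `|x0| * 2^-1 ^+ n.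
Proof.
move=> t3; apply/ler_addgt0Pr => e e0.
have /cvgrPdist_lt/(_ e e0)[p _ /(_ (n + p)%N)] := @S_lim t i t3.
move=> /(_ (leq_addl _ _)) /= H.
have := S_dist n p t3 => H2.
have H3 := le_trans (norm_coord_le (S (n + p) t - S n t) 0 i) H2.
have -> : x t 0 i - S n t 0 i =
  (S (n + p) t - S n t) 0 i + (x t 0 i - S (n + p) t 0 i).
  by rewrite !mxE; ring.
apply: le_trans (ler_normD _ _) _; apply: lerD H3 (ltW H).
Qed.

(** The increments of the partial sums satisfy the mean value bound with the
   derivative of the limit, up to an error that is uniform in the increment; the
   limit is therefore differentiable with the expected derivative. *)
Lemma linear_ode : exists y : R -> 'rV[R]_m, y 0 = x0 /\
  forall (t : R) i, `|t| < 3 / 2 ->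
    is_derive t 1 (fun s => y s 0 i) ((y t *m B t) 0 i).
Proof.
exists x; split.
  apply/rowP => i.
  have S0 n : S n.+1 0 0 i = x0 0 i.
    by rewrite /S big_ord_recl /= big1 ?addr0// => k _; exact: inc0.
  have t0 : `|0 : R| < 3 / 2 by rewrite normr0.
  apply/eqP; rewrite -subr_eq0 -normr_le0; apply/ler_addgt0Pr => e e0.
  have c0 : 0 <= 2 * `|x0| by rewrite mulr_ge0.
  have [n Hn] := half_small c0 e0.
  rewrite -(S0 n) add0r (le_trans (S_close _ _ t0))//.
  apply: le_trans (ltW Hn); rewrite exprS ler_wpM2l//.
  by rewrite ler_piMl ?exprn_ge0// invf_le1// ler1n.
move=> t i t3.
have c0 : 0 <= 2 * `|x0| by rewrite mulr_ge0.
have nbt : \forall s \near t, `|s| < 3 / 2.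
  exact: (@cvgr_norm_lt _ R^o R^o _ _ id t cvg_id _ t3).
have cx j : continuous_at t (fun s => x s 0 j).
  apply/cvgrPdist_lt => e e0; have e30 : 0 < e / 3 by rewrite divr_gt0.
  have [n Hn] := half_small c0 e30.
  have cS : continuous_at t (fun s => S n s 0 j).
    have -> : (fun s => S n s 0 j) = fun s => \sum_(k < n) inc k s 0 j.
      by apply/funext => s; exact: S_coord.
    by apply: continuous_for_sum => k; exact: inc_cont.
  move/cvgrPdist_lt: cS => /(_ _ e30); apply: filterS2 nbt => s s3 H.
  have H1 := S_close n j t3; have H2 := S_close n j s3.
  have -> : x t 0 j - x s 0 j = (x t 0 j - S n t 0 j) +
     (S n t 0 j - S n s 0 j) - (x s 0 j - S n s 0 j) by ring.
  apply: le_lt_trans (ler_normB _ _) _.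
  have := ler_normD (x t 0 j - S n t 0 j) (S n t 0 j - S n s 0 j).
  by move: H H1 H2 Hn; lra.
have cg := @mulmx_continuous x t i cx.
apply: is_derive_eps => e e0; have e20 : 0 < e / 2 by rewrite divr_gt0.
have [n0 Hn0] := half_small c0 e20.
move/cvgrPdist_lt: cg => /(_ _ e20) /(filterI nbt) /nbhs_ballP[d /= d0 Hd].
exists d => // h hd.
apply/ler_addgt0Pr => e' e'0.
have [n1 Hn1] := half_small c0 (divr_gt0 e'0 (ltr0n R 2)).
pose n := maxn n0 n1.
have geo k l : (k <= l)%N -> 2 * `|x0| * 2^-1 ^+ l <= 2 * `|x0| * 2^-1 ^+ k.
  move=> kl; rewrite ler_wpM2l// ler_wiXn2l// ?invr_ge0//.
  by rewrite invf_le1// ler1n.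
have Hn' := le_lt_trans (geo n0 n (leq_maxl _ _)) Hn0.
have Hn1' := le_lt_trans (geo n1 n.+1 (leqW (leq_maxr _ _))) Hn1.
set l := (x t *m B t) 0 i.
have bnd s : `|s - t| <= `|h| -> `|s| < 3 / 2 /\ `|(S n s *m B s) 0 i - l| <= e.
  move=> sth; have [] := Hd s.
    by rewrite -ball_normE /= distrC; exact: le_lt_trans hd.
  rewrite -/l => s3 H; split=> //.
  have xS : `|x s - S n s| <= 2 * `|x0| * 2^-1 ^+ n.
    apply: norm_rV_le => [|j]; first by rewrite mulr_ge0 ?exprn_ge0.
    by have := S_close n j s3; rewrite !mxE.
  have := small_mulmx (x s - S n s) i s3; rewrite mulmxBl.
  rewrite [X in `|X|]mxE [X in _ + X]mxE => H1.
  have -> : (S n s *m B s) 0 i - l =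
    - (l - (x s *m B s) 0 i) - ((x s *m B s) 0 i - (S n s *m B s) 0 i).
    ring.
  apply: le_trans (ler_normB _ _) _; rewrite normrN.
  by move: H H1 xS Hn'; lra.
have mv : `|S n.+1 (t + h) 0 i - S n.+1 t 0 i - h * l| <= e * `|h|.
  pose f s := S n.+1 s 0 i - s * l.
  have df s : `|s - t| <= `|h| -> is_derive s 1 f ((S n s *m B s) 0 i - l).
    move=> /bnd[s3 _]; apply: is_deriveB; first exact: S_der.
    have := is_deriveM (is_derive_id s (1 : R)) (is_derive_cst l s 1).
    by move=> /is_derive_eq; apply; rewrite scaler0 add0r /GRing.scale /= mulr1.
  have -> : S n.+1 (t + h) 0 i - S n.+1 t 0 i - h * l = f (t + h) - f t.
    by rewrite /f; ring.
  have [h0|h0] := leP 0 h.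
    have := @mean_value_bound R f (fun s => (S n s *m B s) 0 i - l) t (t + h) e.
    rewrite lerDl => /(_ h0).
    have b s : t <= s <= t + h -> `|s - t| <= `|h|.
      by move=> /andP[? ?]; rewrite !ger0_norm//; lra.
    move=> /(_ (fun s H => df s (b s H)) (fun s H => (bnd s (b s H)).2)).
    by rewrite (addrC t h) addrK (ger0_norm h0).
  have := @mean_value_bound R f (fun s => (S n s *m B s) 0 i - l) (t + h) t e.
  rewrite gerDl => /(_ (ltW h0)).
  have b s : t + h <= s <= t -> `|s - t| <= `|h|.
    by move=> /andP[? ?]; rewrite !ler0_norm//; lra.
  move=> /(_ (fun s H => df s (b s H)) (fun s H => (bnd s (b s H)).2)).
  have -> : t - (t + h) = - h by ring.
  by rewrite distrC (ltr0_norm h0).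
have th3 : `|t + h| < 3 / 2 by apply: (bnd _ _).1; rewrite (addrC t) addrK.
have H1 := S_close n.+1 i th3; have H2 := S_close n.+1 i t3.
have -> : x (t + h) 0 i - x t 0 i - h * l =
  (S n.+1 (t + h) 0 i - S n.+1 t 0 i - h * l) +
  (x (t + h) 0 i - S n.+1 (t + h) 0 i) - (x t 0 i - S n.+1 t 0 i) by ring.
apply: le_trans (ler_normB _ _) _.
have := ler_normD (S n.+1 (t + h) 0 i - S n.+1 t 0 i - h * l)
  (x (t + h) 0 i - S n.+1 (t + h) 0 i).
by move: mv H1 H2 Hn1'; lra.
Qed.

End LinearODE.

(** * The Frobenius theorem for linear systems *)

Section Frobenius.
Context {R : realType} {n m : nat}.

Lemma open_norm_lt (V : normedModType R) (r : R) : open [set u : V | `|u| < r].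
Proof.
rewrite (_ : [set _ | _] = ball (0 : V) r); first exact: ball_open.
by apply/seteqP; split => u; rewrite -ball_normE /= sub0r normrN.
Qed.

Lemma norm_mulmx p q s (M : 'M[R]_(p, q)) (N : 'M[R]_(q, s)) :
  `|M *m N| <= q%:R * (`|M| * `|N|).
Proof.
apply: norm_mx_le => [|i j]; first by rewrite !mulr_ge0.
rewrite mxE (le_trans (ler_norm_sum _ _ _))//.
rewrite mulr_natl -[X in _ *+ X]card_ord -sumr_const.
by apply: ler_sum => k _; rewrite normrM ler_pM// norm_coord_le.
Qed.

Lemma norm_sum_coord (V : normedModType R) (v : 'rV[R]_n) (g : 'I_n -> V) (M : R) :
  (forall i, `|g i| <= M) -> `|\sum_i v 0 i *: g i| <= n%:R * M * `|v|.
Proof.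
move=> gM; rewrite (le_trans (ler_norm_sum _ _ _))//.
rewrite -mulrA mulr_natl -[X in _ *+ X](card_ord n) -sumr_const.
apply: ler_sum => k _; rewrite normrZ mulrC ler_pM// norm_coord_le//.
Qed.

Lemma local_bound (I : finType) (V : normedModType R) (G : I -> V -> R) p :
  (forall i, {for p, continuous (G i)}) ->
  exists rho M : R, [/\ 0 < rho, 0 <= M &
    forall i q, `|q - p| < rho -> `|G i q| <= M].
Proof.
move=> cG.
have : \forall q \near p, forall i, `|G i q| < `|G i p| + 1.
  apply: filter_forall => i.
  have lt : `|G i p| < `|G i p| + 1 by rewrite ltrDl.
  exact: (cvgr_norm_lt _ (cG i) _ lt).
move=> /nbhs_ballP[rho /= rho0 H].
have M0 : 0 <= \sum_i (`|G i p| + 1) by apply: sumr_ge0 => i _; rewrite addr_ge0.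
exists rho, (\sum_i (`|G i p| + 1)); split=> // i q qp.
have bq : ball p rho q by rewrite -ball_normE /= distrC.
apply: le_trans (ltW (H q bq i)) _; rewrite (bigD1 i)//= lerDl.
by apply: sumr_ge0 => j _; rewrite addr_ge0.
Qed.

Lemma segment_in_ball (V : normedModType R) (q z : V) (s rho : R) :
  0 <= s <= 1 -> `|q| < rho -> `|q + z| < rho -> `|q + s *: z| < rho.
Proof.
move=> /andP[s0 s1] qr qzr.
have -> : q + s *: z = (1 - s) *: q + s *: (q + z).
  by rewrite scalerDr addrA -scalerDl subrK scale1r.
apply: le_lt_trans (ler_normD _ _) _; rewrite !normrZ.
rewrite (ger0_norm s0) ger0_norm ?subr_ge0//.
have [->|s0'] := eqVneq s 0; first by rewrite subr0 mul1r mul0r addr0.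
have : (1 - s) * `|q| <= (1 - s) * rho by rewrite ler_wpM2l ?subr_ge0// ltW.
have : s * `|q + z| < s * rho by rewrite ltr_pM2l// lt_def s0'.
by lra.
Qed.

Lemma lipschitz_ball (g : 'rV[R]_n -> R) (p : 'rV[R]_n) (M rho : R) q z :
  (forall y, `|y - p| < rho -> differentiable g y) ->
  (forall j y, `|y - p| < rho -> `|partial j g y| <= M) ->
  `|q - p| < rho -> `|q + z - p| < rho -> `|g (q + z) - g q| <= n%:R * M * `|z|.
Proof.
move=> dg gM qr qzr.
have inB (s : R) : 0 <= s <= 1 -> `|q + s *: z - p| < rho.
  by move=> s01; rewrite addrAC; apply: segment_in_ball => //; rewrite addrAC.
have := @mean_value_bound R (fun s => g (q + s *: z))
  (fun s => 'D_z g (q + s *: z)) 0 1 (n%:R * M * `|z|) ler01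
  (fun s s01 => is_derive_line (dg _ (inB s s01))).
rewrite scale1r scale0r addr0 subr0 mulr1; apply => s s01.
rewrite derive_rowE; last exact/dg/inB.
by apply: norm_sum_coord => i; apply: gM; exact: inB.
Qed.

Lemma taylor1 (g : 'rV[R]_n -> R) (M rho : R) q z : smooth_on setT g ->
  (forall j p, `|p| < rho -> `|partial j g p| <= M) ->
  `|q| < rho -> `|q + z| < rho -> `|g (q + z) - g q| <= n%:R * M * `|z|.
Proof.
move=> sg gM qr qzr; apply: (@lipschitz_ball g 0 M rho); rewrite ?subr0//.
  by move=> y _; exact: (smooth_diff sg).
by move=> j y; rewrite subr0; exact: gM.
Qed.

Lemma taylor2 (g : 'rV[R]_n -> R) (M rho : R) q z : smooth_on setT g ->
  (forall i j p, `|p| < rho -> `|partial i (partial j g) p| <= M) ->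
  `|q| < rho -> `|q + z| < rho ->
  `|g (q + z) - g q - 'D_z g q| <= n%:R * (n%:R * M * `|z|) * `|z|.
Proof.
move=> sg gM qr qzr.
have dl (s : R) : is_derive s 1 (fun s => g (q + s *: z) - s * 'D_z g q)
    ('D_z g (q + s *: z) - 'D_z g q).
  apply: is_deriveB; first by apply: is_derive_line; exact: smooth_diff sg _.
  have := is_deriveM (is_derive_id s (1 : R)) (is_derive_cst ('D_z g q : R) s 1).
  by move=> /is_derive_eq; apply; rewrite scaler0 add0r /GRing.scale /= mulr1.
have := @mean_value_bound R (fun s => g (q + s *: z) - s * 'D_z g q) _ 0 1
  (n%:R * (n%:R * M * `|z|) * `|z|) ler01 (fun s _ => dl s).
rewrite scale1r scale0r addr0 subr0 mulr1 mul0r subr0 mul1r.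
rewrite addrAC; apply => s s01.
rewrite !derive_rowE; [|exact: smooth_diff sg _..].
rewrite -sumrB; under eq_bigr do rewrite -scalerBr.
apply: norm_sum_coord => i.
have qs := segment_in_ball s01 qr qzr.
have sp : smooth_on setT (partial i g) by exact: smooth_derive.
apply: le_trans (taylor1 sp (fun j p => gM j i p) qr qs) _.
rewrite normrZ; have /andP[s0 s1] := s01.
rewrite ler_wpM2l ?(ger0_norm s0) ?ler_piMl// mulr_ge0//.
by apply: le_trans (gM i i q qr).
Qed.

Variable A : 'I_n -> 'rV[R]_n -> 'M[R]_m.
Hypothesis sA : forall i a b, smooth_on setT (fun q => A i q a b).

Definition mx_partial (i j : 'I_n) (q : 'rV[R]_n) : 'M[R]_m :=
  \matrix_(a, b) partial j (fun q => A i q a b) q.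

Hypothesis flat : forall i j q,
  mx_partial i j q + A j q *m A i q = mx_partial j i q + A i q *m A j q.

(* The connection form [Ad] and its derivative [dA] in the direction [v], both
   contracted with a tangent vector; [flatd] is the flatness equation in these
   terms. *)
Let Ad (q v : 'rV[R]_n) : 'M[R]_m := \sum_i v 0 i *: A i q.
Let dA (q v z : 'rV[R]_n) : 'M[R]_m := \sum_i z 0 i *: \sum_j v 0 j *: mx_partial i j q.

Let flatd q u w : dA q w u + Ad q w *m Ad q u = dA q u w + Ad q u *m Ad q w.
Proof.
have mulE v z : Ad q v *m Ad q z = \sum_i \sum_j z 0 i *: (v 0 j *: (A j q *m A i q)).
  rewrite mulmx_sumr; apply: eq_bigr => i _; rewrite mulmx_suml.
  by apply: eq_bigr => j _; rewrite -scalemxAr -scalemxAl.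
rewrite !mulE /dA.
have dE v z : \sum_i z 0 i *: (\sum_j v 0 j *: mx_partial i j q) =
   \sum_i \sum_j z 0 i *: (v 0 j *: mx_partial i j q).
  by apply: eq_bigr => i _; rewrite scaler_sumr.
rewrite !dE -!big_split /=.
under eq_bigr do rewrite -big_split /=.
under [RHS]eq_bigr do rewrite -big_split /=.
rewrite [RHS]exchange_big /=; apply: eq_bigr => i _; apply: eq_bigr => j _.
by rewrite -!scalerDr flat scalerA mulrC -scalerA.
Qed.

Let AdD q v z : Ad q (v + z) = Ad q v + Ad q z.
Proof. by rewrite /Ad -big_split /=; apply: eq_bigr => i _; rewrite mxE scalerDl. Qed.

Let dADr q w v z : dA q w (v + z) = dA q w v + dA q w z.
Proof. by rewrite /dA -big_split /=; apply: eq_bigr => i _; rewrite mxE scalerDl. Qed.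

Let Ad_entry q v a b : Ad q v a b = \sum_i v 0 i * A i q a b.
Proof. by rewrite /Ad summxE; apply: eq_bigr => i _; rewrite mxE. Qed.

Let dA_entry q v z a b :
  dA q v z a b = \sum_i z 0 i * 'D_v (fun q => A i q a b) q.
Proof.
rewrite /dA summxE; apply: eq_bigr => i _; rewrite mxE summxE; congr (_ * _).
rewrite derive_rowE; last exact: (smooth_diff (@sA i a b)).
by apply: eq_bigr => j _; rewrite !mxE.
Qed.

(** The algebra of [ray_compare].  Put [P] and [Q] for the connection along the
   ray and across it, and [e] for the deviation of [X'] from its expected value
   [X + t X Q]: flatness, [U + Q P = V + P Q], cancels every first order term in
   the derivative of [e]. *)
Lemma transport_identity (X X' e : 'rV[R]_m) (P Q D U V : 'M[R]_m) (t : R) :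
  U + Q *m P = V + P *m Q -> X' = e + X + t *: (X *m Q) ->
  X' *m (P + Q + D) - X *m P - (X *m Q + t *: (X *m P *m Q + X *m V)) =
  e *m (P + Q + D) + X *m (D - t *: U + t *: (Q *m Q) + t *: (Q *m D)).
Proof.
move=> UV ->.
have -> : V = U + Q *m P - P *m Q by rewrite UV addrK.
rewrite !(mulmxDl, mulmxDr, mulmxBr, mulmxN, =^~ scalemxAl, =^~ scalemxAr) !mulmxA.
move: (e *m _) (e *m _) (e *m _) (X *m P) (X *m Q) (X *m D) (X *m U)
  => eP eQ eD XP XQ XD XU.
move: (XQ *m P) (XQ *m Q) (XQ *m D) (XP *m Q) => a b c d.
by apply/rowP => k; rewrite !mxE; ring.
Qed.

Section Estimates.
Variables (rho M : R).
Hypothesis rho0 : 0 < rho.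
Hypothesis M0 : 0 <= M.
Hypothesis bA : forall i a b q, `|q| < rho -> `|A i q a b| <= M.
Hypothesis bA1 : forall i j a b q, `|q| < rho ->
  `|partial j (fun q => A i q a b) q| <= M.
Hypothesis bA2 : forall i j k a b q, `|q| < rho ->
  `|partial k (partial j (fun q => A i q a b)) q| <= M.

Let nM0 : 0 <= n%:R * M. Proof. by rewrite mulr_ge0. Qed.

Let Ad_bound q v : `|q| < rho -> `|Ad q v| <= n%:R * M * `|v|.
Proof.
move=> qr; apply: norm_sum_coord => i; apply: norm_mx_le => // a b.
exact: bA.
Qed.

Let dA_bound q v z : `|q| < rho ->
  `|dA q v z| <= n%:R * (n%:R * M * `|v|) * `|z|.
Proof.
move=> qr; apply: norm_sum_coord => i; apply: norm_sum_coord => j.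
by apply: norm_mx_le => // a b; rewrite mxE; exact: bA1.
Qed.

Let Ad_taylor1 q z v : `|q| < rho -> `|q + z| < rho ->
  `|Ad (q + z) v - Ad q v| <= n%:R * (n%:R * M * `|z|) * `|v|.
Proof.
move=> qr qzr.
rewrite /Ad -sumrB; under eq_bigr do rewrite -scalerBr.
apply: norm_sum_coord => i; apply: norm_mx_le => [|a b].
  by rewrite mulr_ge0.
rewrite !mxE; apply: (taylor1 (rho := rho) (@sA i a b)) => // j p.
exact: bA1.
Qed.

Let Ad_taylor2 q z v : `|q| < rho -> `|q + z| < rho ->
  `|Ad (q + z) v - Ad q v - dA q z v| <=
  n%:R * (n%:R * (n%:R * M * `|z|) * `|z|) * `|v|.
Proof.
move=> qr qzr.
rewrite /Ad /dA -!sumrB; under eq_bigr do rewrite -!scalerBr.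
apply: norm_sum_coord => i; apply: norm_mx_le => [|a b].
  by rewrite !mulr_ge0.
have := @taylor2 (fun q => A i q a b) M rho q z (@sA i a b)
  (fun k j p => bA2 i j k a b (q := p)) qr qzr.
rewrite derive_rowE; last exact: (smooth_diff (@sA i a b)).
rewrite !mxE summxE.
by under [X in _ -> `|_ - X| <= _]eq_bigr do rewrite !mxE.
Qed.

(* For [u] in this ball the rays [t u] with |t| < 3/2 stay where the bounds
   hold, and the coefficient of their equation has size at most 1/4. *)
Let r : R := Num.min (rho * (2 / 3)) (Num.min 1 (4 * (m%:R * (n%:R * M) + 1))^-1).

Let r0 : 0 < r.
Proof.
rewrite !lt_min mulr_gt0//= ltr01 invr_gt0 mulr_gt0//.
by rewrite ltr_wpDl// mulr_ge0.
Qed.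

Let r1 (u : 'rV[R]_n) : `|u| < r -> `|u| <= 1.
Proof. by rewrite !lt_min => /andP[_ /andP[/ltW]]. Qed.

Let ray (u : 'rV[R]_n) (t : R) : `|u| < r -> `|t| < 3 / 2 -> `|t *: u| < rho.
Proof.
rewrite lt_min => /andP[ur _] t3; rewrite normrZ.
have -> : rho = (3 / 2) * (rho * (2 / 3)) by field.
by apply: ltr_pM.
Qed.

Let ray_small (u : 'rV[R]_n) (t : R) b : `|u| < r -> `|t| < 3 / 2 ->
  \sum_a `|Ad (t *: u) u a b| <= 4^-1.
Proof.
move=> ur t3; have tu := ray ur t3.
have Am := Ad_bound u tu.
apply: (@le_trans _ _ (\sum_(a < m) (n%:R * M * `|u|))).
  by apply: ler_sum => a _; apply: le_trans Am; exact: norm_coord_le.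
rewrite sumr_const card_ord -[leLHS]mulr_natl.
have : `|u| <= (4 * (m%:R * (n%:R * M) + 1))^-1.
  by move: ur; rewrite !lt_min => /andP[_ /andP[_ /ltW]].
have mM : 0 <= m%:R * (n%:R * M) by rewrite mulr_ge0.
move=> H; rewrite (_ : m%:R * _ = m%:R * (n%:R * M) * `|u|); last by ring.
move: (m%:R * _) mM H => c c0 H; apply: le_trans (ler_wpM2l c0 H) _.
rewrite ler_pdivrMr ?mulr_gt0 ?ltr_wpDl//; lra.
Qed.

Let dline (g : 'rV[R]_n -> R) u (t : R) : smooth_on setT g ->
  is_derive t 1 (fun s => g (s *: u)) ('D_u g (t *: u)).
Proof.
move=> sg; have := @is_derive_line R _ R g 0 u t.
rewrite add0r => /(_ (smooth_diff sg I)).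
by rewrite (_ : (fun s => g (0 + s *: u)) = fun s => g (s *: u))//;
  apply/funext => s; rewrite add0r.
Qed.

Let Ad_ray_der u w (t : R) a b :
  is_derive t 1 (fun s => Ad (s *: u) w a b) (dA (t *: u) u w a b).
Proof.
rewrite dA_entry.
have -> : (fun s => Ad (s *: u) w a b) =
    \sum_i (fun s => w 0 i * A i (s *: u) a b).
  by apply/funext => s; rewrite fct_sumE Ad_entry.
apply: is_derive_sum => i.
by have := is_deriveZ (w 0 i) (dline u t (@sA i a b)).
Qed.

Let ray_solution (x0 : 'rV[R]_m) u : `|u| < r -> exists X : R -> 'rV[R]_m,
  X 0 = x0 /\ forall (t : R) k, `|t| < 3 / 2 ->
    is_derive t 1 (fun s => X s 0 k) ((X t *m Ad (t *: u) u) 0 k).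
Proof.
move=> ur; apply: linear_ode => [a b t|t b t3]; last exact: ray_small.
exact: is_derive_continuous (Ad_ray_der u u t a b).
Qed.

Let ray_solution_bound (x0 : 'rV[R]_m) u X : `|u| < r -> X 0 = x0 ->
  (forall (t : R) k, `|t| < 3 / 2 ->
    is_derive t 1 (fun s => X s 0 k) ((X t *m Ad (t *: u) u) 0 k)) ->
  forall t : R, 0 <= t <= 1 -> `|X t| <= 2 * `|x0|.
Proof.
move=> ur X0 dX t t01.
have b3 (s : R) : 0 <= s <= 1 -> `|s| < 3 / 2.
  by move=> /andP[s0 s1]; rewrite ger0_norm//; lra.
have := @small_gronwall R m (fun s => X s - x0)
  (fun s => X s *m Ad (s *: u) u) (4^-1 * `|x0|).
move=> /(_ _ _ _ _ t t01) H.
have : `|X t - x0| <= 2 * (4^-1 * `|x0|).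
  apply: H => //.
  - by rewrite X0 subrr.
  - move=> s k /b3 s3.
    rewrite (_ : (fun s => _) = (fun s => X s 0 k) - cst (x0 0 k)).
      have := is_deriveB (dX s k s3) (is_derive_cst (x0 0 k) s 1).
      by rewrite subr0.
    by apply/funext => s'; rewrite !mxE !fctE.
  move=> s k /b3 s3.
  apply: le_trans (small_mulmx (fun t b => @ray_small u t b ur) _ _ s3) _.
  have := ler_normD (X s - x0) x0; rewrite subrK.
  have : 0 <= `|X s - x0| by []. 
  by move: (`|X s|) (`|X s - x0|) (`|x0|) => a b c; lra.
have := ler_normD (X t - x0) x0; rewrite subrK.
have : 0 <= `|x0| by [].
by move: (`|X t|) (`|X t - x0|) (`|x0|) => a b c; lra.
Qed.

(** Comparison of the transports along two neighbouring rays.  Flatness cancels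
   the first order terms, so that the endpoints differ by the expected
   derivative up to a quadratic error. *)
Let ray_compare (x0 : 'rV[R]_m) : exists K : R, forall u w X X',
  `|u| < r -> `|u + w| < r -> X 0 = x0 -> X' 0 = x0 ->
  (forall (t : R) k, `|t| < 3 / 2 ->
    is_derive t 1 (fun s => X s 0 k) ((X t *m Ad (t *: u) u) 0 k)) ->
  (forall (t : R) k, `|t| < 3 / 2 ->
    is_derive t 1 (fun s => X' s 0 k)
      ((X' t *m Ad (t *: (u + w)) (u + w)) 0 k)) ->
  `|X' 1 - X 1 - X 1 *m Ad u w| <= K * `|w| ^+ 2.
Proof.
pose K1 : R := n%:R * (n%:R * (n%:R * M)) + n%:R * (n%:R * M) +
  m%:R * (n%:R * M * (n%:R * M)) + m%:R * (n%:R * M * (n%:R * (n%:R * M))).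
exists (2 * (m%:R * (2 * `|x0| * K1))) => u w X X' ur uwr X0 X'0 dX dX'.
have b3 (s : R) : 0 <= s <= 1 -> `|s| < 3 / 2.
  by move=> /andP[s0 s1]; rewrite ger0_norm//; lra.
pose e t := X' t - X t - t *: (X t *m Ad (t *: u) w).
pose D t := Ad (t *: (u + w)) (u + w) - Ad (t *: u) (u + w).
pose Z t := D t - t *: dA (t *: u) w u + t *: (Ad (t *: u) w *m Ad (t *: u) w)
   + t *: (Ad (t *: u) w *m D t).
pose d t := e t *m Ad (t *: (u + w)) (u + w) + X t *m Z t.
have e1 : X' 1 - X 1 - X 1 *m Ad u w = e 1 by rewrite /e !scale1r.
have K10 : 0 <= K1 by rewrite /K1 !addr_ge0// !mulr_ge0// mulr_ge0.
have Zb (t : R) : 0 <= t <= 1 -> `|Z t| <= K1 * `|w| ^+ 2.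
  move=> t01; have t3 := b3 t t01; have /andP[t0 t1] := t01.
  have qr := ray ur t3; have qr' := ray uwr t3.
  have tw : `|t *: w| <= `|w| by rewrite normrZ ger0_norm// ler_piMl.
  have q'E : t *: (u + w) = t *: u + t *: w by rewrite scalerDr.
  have dAZ z : dA (t *: u) (t *: w) z = t *: dA (t *: u) w z.
    rewrite /dA scaler_sumr; apply: eq_bigr => i _.
    rewrite scalerA mulrC -scalerA; congr (_ *: _).
    by rewrite scaler_sumr; apply: eq_bigr => j _; rewrite mxE scalerA.
  have -> : Z t = (D t - dA (t *: u) (t *: w) (u + w)) + dA (t *: u) (t *: w) w
      + t *: (Ad (t *: u) w *m Ad (t *: u) w) + t *: (Ad (t *: u) w *m D t).
    rewrite /Z dADr -[in RHS](addrA (D t)); congr (D t + _ + _ + _).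
    by rewrite opprD addrNK dAZ.
  have w0 : 0 <= `|w| by [].
  have T1 : `|D t - dA (t *: u) (t *: w) (u + w)| <=
      n%:R * (n%:R * (n%:R * M)) * `|w| ^+ 2.
    have := @Ad_taylor2 (t *: u) (t *: w) (u + w) qr.
    rewrite -q'E => /(_ qr') H; apply: le_trans H _.
    rewrite (_ : _ * _ ^+ 2 = n%:R * (n%:R * (n%:R * M * `|w|) * `|w|) * 1).
      apply: ler_pM => //; first by rewrite !mulr_ge0.
        rewrite ler_wpM2l//; apply: ler_pM => //; first by rewrite !mulr_ge0.
        by rewrite ler_wpM2l// ler_wpM2l.
      exact: r1.
    by ring.
  have T2 : `|dA (t *: u) (t *: w) w| <= n%:R * (n%:R * M) * `|w| ^+ 2.
    apply: le_trans (dA_bound _ _ qr) _.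
    rewrite (_ : _ * _ ^+ 2 = n%:R * (n%:R * M * `|w|) * `|w|); last by ring.
    by rewrite ler_wpM2r// ler_wpM2l// ler_wpM2l.
  have Q := Ad_bound w qr.
  have Db : `|D t| <= n%:R * (n%:R * M * `|w|).
    have := @Ad_taylor1 (t *: u) (t *: w) (u + w) qr.
    rewrite -q'E => /(_ qr') H; apply: le_trans H _.
    rewrite -[leRHS]mulr1; apply: ler_pM => //; first by rewrite !mulr_ge0.
      by rewrite ler_wpM2l// ler_wpM2l.
    exact: r1.
  have T3 : `|t *: (Ad (t *: u) w *m Ad (t *: u) w)| <=
      m%:R * (n%:R * M * (n%:R * M)) * `|w| ^+ 2.
    rewrite normrZ (ger0_norm t0).
    apply: (@le_trans _ _ (1 * `|Ad (t *: u) w *m Ad (t *: u) w|)).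
      by rewrite ler_wpM2r.
    rewrite mul1r (le_trans (norm_mulmx _ _))//.
    rewrite [leRHS](_ : _ = m%:R * ((n%:R * M * `|w|) * (n%:R * M * `|w|))); last by ring.
    by rewrite ler_wpM2l//; apply: ler_pM.
  have T4 : `|t *: (Ad (t *: u) w *m D t)| <=
      m%:R * (n%:R * M * (n%:R * (n%:R * M))) * `|w| ^+ 2.
    rewrite normrZ (ger0_norm t0).
    apply: (@le_trans _ _ (1 * `|Ad (t *: u) w *m D t|)).
      by rewrite ler_wpM2r.
    rewrite mul1r (le_trans (norm_mulmx _ _))//.
    rewrite [leRHS](_ : _ =
      m%:R * ((n%:R * M * `|w|) * (n%:R * (n%:R * M * `|w|)))); last by ring.
    by rewrite ler_wpM2l//; apply: ler_pM.
  rewrite /K1 !mulrDl.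
  by do 3 (apply: le_trans (ler_normD _ _) _; apply: lerD => //).
rewrite e1.
have H := @small_gronwall R m e d (m%:R * (2 * `|x0| * (K1 * `|w| ^+ 2))).
have -> : 2 * (m%:R * (2 * `|x0| * K1)) * `|w| ^+ 2 =
  2 * (m%:R * (2 * `|x0| * (K1 * `|w| ^+ 2))) by ring.
apply: H.
- by rewrite !mulr_ge0// exprn_ge0.
- by rewrite /e X0 X'0 subrr sub0r scale0r oppr0.
- move=> t k t01; have t3 := b3 t t01.
  have PE : Ad (t *: (u + w)) (u + w) =
      Ad (t *: u) u + Ad (t *: u) w + D t.
    by rewrite /D -AdD [RHS]addrC subrK.
  have X'E : X' t = e t + X t + t *: (X t *m Ad (t *: u) w).
    by rewrite /e [RHS]addrAC subrK subrK.
  have := transport_identity (D t) (flatd (t *: u) u w) X'E.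
  rewrite -PE -/(Z t) -/(d t) => <-.
  have -> : (fun s => e s 0 k) = (fun s => X' s 0 k) - (fun s => X s 0 k) -
     (fun s => s * \sum_a X s 0 a * Ad (s *: u) w a k).
    by apply/funext => s; rewrite /e !mxE !fctE.
  have dS : is_derive t 1 (fun s => \sum_a X s 0 a * Ad (s *: u) w a k)
     ((X t *m Ad (t *: u) u *m Ad (t *: u) w + X t *m dA (t *: u) u w) 0 k).
    have -> : (fun s => \sum_a X s 0 a * Ad (s *: u) w a k) =
       \sum_a (fun s => X s 0 a * Ad (s *: u) w a k).
      by apply/funext => s; rewrite fct_sumE.
    rewrite mxE [X in X + _]mxE [X in _ + X]mxE -big_split /=.
    apply: is_derive_sum => a.
    have := is_deriveM (dX t a t3) (Ad_ray_der u w t a k).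
    move=> /is_derive_eq; apply; rewrite /GRing.scale /= addrC.
    by congr (_ + _); rewrite mulrC.
  have := is_deriveB (is_deriveB (dX' t k t3) (dX t k t3))
     (is_deriveM (is_derive_id t (1 : R)) dS).
  move=> /is_derive_eq; apply.
  rewrite [RHS]mxE [X in _ = X + _]mxE [X in _ = _ + X + _]mxE.
  rewrite [X in _ = _ + X]mxE [X in _ = _ + - X]mxE [X in _ = _ - (_ + X)]mxE.
  congr (_ - _); rewrite addrC; congr (_ + _).
  by rewrite /GRing.scale /= mulr1 mxE.
- move=> t k t01; have t3 := b3 t t01.
  rewrite /d mxE (le_trans (ler_normD _ _))// lerD//.
    have := small_mulmx (fun t b => @ray_small (u + w) t b uwr) (e t) k t3.
    move=> /le_trans; apply; rewrite ler_wpM2r//; lra.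
  apply: le_trans (norm_coord_le _ _ _) _.
  apply: le_trans (norm_mulmx _ _) _; rewrite ler_wpM2l//.
  apply: ler_pM => //; last exact: Zb.
  exact: (ray_solution_bound ur X0 dX).
- by rewrite ler01 lexx.
Qed.

(** The value at [u] of the solution is the end point of the transport along the
   segment from the origin to [u]; [ray_compare] is its differentiability. *)
Lemma frobenius_estimates (x0 : 'rV[R]_m) : exists f : 'rV[R]_n -> 'rV[R]_m,
  f 0 = x0 /\ forall u k, `|u| < r ->
    differentiable (fun q => f q 0 k) u /\
    forall v, 'D_v (fun q => f q 0 k) u = (f u *m Ad u v) 0 k.
Proof.
have /choice[X HX] : forall u, exists X : R -> 'rV[R]_m, `|u| < r ->
  X 0 = x0 /\ forall (t : R) k, `|t| < 3 / 2 ->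
    is_derive t 1 (fun s => X s 0 k) ((X t *m Ad (t *: u) u) 0 k).
  move=> u; have [ur|ur] := pselect (`|u| < r); last by exists (fun=> 0).
  by have [X HX] := ray_solution x0 ur; exists X.
have [K HK] := ray_compare x0.
exists (fun u => X u 1); split.
  (* The ray of the zero vector is constant. *)
  have zr : `|0 : 'rV[R]_n| < r by rewrite normr0.
  have [X0 dX] := HX 0 zr.
  have dX0 k (t : R) : 0 <= t <= 1 -> is_derive t 1 (fun s => X 0 s 0 k) 0.
    move=> /andP[t0 t1]; have t3 : `|t| < 3 / 2 by rewrite ger0_norm//; lra.
    have := dX t k t3.
    have -> : Ad (t *: 0) 0 = 0.
      by rewrite /Ad big1// => i _; rewrite mxE scale0r.
    by rewrite mulmx0 mxE.
  apply/rowP => k; rewrite -[in RHS]X0; apply/eqP; rewrite -subr_eq0 -normr_le0.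
  have := @mean_value_bound R _ (fun=> 0) 0 1 0 ler01 (dX0 k).
  by rewrite mul0r; apply=> s _; rewrite normr0.
move=> u k ur; apply: differentiable_lin.
  move=> c v z; rewrite /Ad.
  have -> : \sum_i (c *: v + z) 0 i *: A i u =
      c *: (\sum_i v 0 i *: A i u) + \sum_i z 0 i *: A i u.
    rewrite scaler_sumr -big_split /=; apply: eq_bigr => i _.
    by rewrite !mxE scalerDl scalerA.
  by rewrite mulmxDr -scalemxAr !mxE.
move=> e e0; have [X0 dX] := HX u ur.
have ru0 : 0 < r - `|u| by rewrite subr_gt0.
have K0 : 0 < `|K| + 1 by rewrite ltr_wpDl.
pose dl := Num.min (r - `|u|) (e / (`|K| + 1)).
have dl0 : 0 < dl by rewrite lt_min ru0 divr_gt0.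
apply/nbhs_ballP; exists dl => //= h; rewrite -ball_normE /= sub0r normrN.
rewrite lt_min => /andP[h1 h2].
have uhr : `|u + h| < r.
  by apply: le_lt_trans (ler_normD _ _) _; move: h1; rewrite ltrBrDl.
have [X'0 dX'] := HX _ uhr.
have := HK u h _ _ ur uhr X0 X'0 dX dX' => H.
rewrite (addrC h); have := norm_coord_le (X (u + h) 1 - X u 1 - X u 1 *m Ad u h) 0 k.
rewrite [X in `|X|]mxE [X in _ + X]mxE [X in `|X - _|]mxE [X in _ + X - _]mxE.
move=> /le_trans; apply; apply: le_trans H _.
rewrite expr2 mulrA ler_wpM2r//.
apply: le_trans (ler_wpM2r _ (ler_norm K)) _ => //.
apply: (@le_trans _ _ ((`|K| + 1) * `|h|)); first by rewrite ler_wpM2r// lerDl.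
by rewrite mulrC -ler_pdivlMr// ltW.
Qed.

Lemma frobenius_on_ball : exists2 r : R, 0 < r &
  forall x0 : 'rV[R]_m, exists f : 'rV[R]_n -> 'rV[R]_m,
  [/\ f 0 = x0, smooth_on [set u : 'rV[R]_n | `|u| < r] f &
    forall u i k, `|u| < r ->
      partial i (fun q => f q 0 k) u = (f u *m A i u) 0 k].
Proof.
exists r => // x0; have [f [f0 Hf]] := frobenius_estimates x0.
have oD := @open_norm_lt 'rV[R]_n r.
exists f; split=> //.
  (* The derivative is the solution times smooth coefficients. *)
  apply/(smooth_rVP _ oD) => k; apply/smooth_ckP => l.
  elim: l k => [|l IH] k; first by move=> u /= ur; have [] := Hf u k ur.
  split=> [u ur|v]; first by have [] := Hf u k ur.
  apply: (@ck_ext _ _ _ l _ (fun u => \sum_a f u 0 a *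
      \sum_i v 0 i * A i u a k) _ oD).
    move=> u; rewrite inE => ur; have [_ ->] := Hf u k ur; rewrite mxE.
    by apply: eq_bigr => a _; rewrite Ad_entry.
  apply: ck_sum => // a _; apply: ckM => //; apply: ck_sum => // i _.
  apply: ckM => //; first exact: ck_cst.
  have sub := @subsetT _ [set u : 'rV[R]_n | `|u| < r].
  by have /smooth_ckP := smooth_sub sub (@sA i a k).
move=> u i k ur; have [_ Hd] := Hf u k ur; rewrite /partial Hd; congr ((_ *m _) _ _).
rewrite /Ad (bigD1 i)//= big1 ?addr0 => [|j ji].
  by rewrite mxE !eqxx scale1r.
by rewrite mxE (negbTE ji) andbF scale0r.
Qed.

End Estimates.

(** The Frobenius theorem for linear systems: [flat] is the equality of mixed
   derivatives that a full set of solutions forces, and it suffices.  The radius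
   does not depend on the initial value, by linearity. *)
Lemma frobenius : exists2 r : R, 0 < r &
  forall x0 : 'rV[R]_m, exists f : 'rV[R]_n -> 'rV[R]_m,
  [/\ f 0 = x0, smooth_on [set u : 'rV[R]_n | `|u| < r] f &
    forall u i k, `|u| < r ->
      partial i (fun q => f q 0 k) u = (f u *m A i u) 0 k].
Proof.
have cts g : smooth_on setT g -> {for (0 : 'rV[R]_n), continuous (g : _ -> R)}.
  by move=> sg; apply: differentiable_continuous; exact: (smooth_diff sg).
have [r1 [M1 [r10 M10 H1]]] := @local_bound ('I_n * ('I_m * 'I_m))%type _
  (fun x q => A x.1 q x.2.1 x.2.2) 0
  (fun x => cts _ (@sA x.1 x.2.1 x.2.2)).
have [r2 [M2 [r20 M20 H2]]] := @local_bound ('I_n * ('I_n * ('I_m * 'I_m)))%type _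
  (fun x => partial x.1 (fun q => A x.2.1 q x.2.2.1 x.2.2.2)) 0
  (fun x => cts _ (smooth_derive _ (@sA x.2.1 x.2.2.1 x.2.2.2))).
have [r3 [M3 [r30 M30 H3]]] :=
  @local_bound ('I_n * ('I_n * ('I_n * ('I_m * 'I_m))))%type _
  (fun x => partial x.1 (partial x.2.1 (fun q => A x.2.2.1 q x.2.2.2.1 x.2.2.2.2)))
  0 (fun x => cts _ (smooth_derive _ (smooth_derive _
     (@sA x.2.2.1 x.2.2.2.1 x.2.2.2.2)))).
have rho0 : 0 < Num.min r1 (Num.min r2 r3) by rewrite !lt_min r10 r20.
apply: (@frobenius_on_ball _ (M1 + M2 + M3) rho0).
- by rewrite !addr_ge0.
- move=> i a b q; rewrite !lt_min => /andP[qr _].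
  have := H1 (i, (a, b)) q; rewrite subr0 => /(_ qr) /= h.
  by rewrite -addrA (le_trans h)// lerDl addr_ge0.
- move=> i j a b q; rewrite !lt_min => /andP[_ /andP[qr _]].
  have := H2 (j, (i, (a, b))) q; rewrite subr0 => /(_ qr) /= h.
  by rewrite (le_trans h)// addrAC lerDr addr_ge0.
- move=> i j k a b q; rewrite !lt_min => /andP[_ /andP[_ qr]].
  have := H3 (k, (j, (i, (a, b)))) q; rewrite subr0 => /(_ qr) /= h.
  by rewrite (le_trans h)// lerDr addr_ge0.
Qed.

End Frobenius.

Section Uniqueness.
Context {R : realType} {n : nat} (I : finType).

(** Along a ray the system becomes an ordinary one with a small coefficient, to
   which [small_gronwall] applies with a zero inhomogeneous term. *)
Lemma linear_system_zero (g : I -> 'rV[R]_n -> R) (rho M : R) :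
  0 < rho -> 0 <= M ->
  (forall k u, `|u| < rho -> differentiable (g k) u) ->
  (forall i k u, `|u| < rho -> `|partial i (g k) u| <= M * \sum_l `|g l u|) ->
  (forall k, g k 0 = 0) ->
  exists2 r : R, 0 < r <= rho & forall k u, `|u| < r -> g k u = 0.
Proof.
move=> rho0 M0 dg bg g0.
pose c := n%:R * (M * #|I|%:R).
have c0 : 0 <= c by rewrite !mulr_ge0.
pose r := Num.min rho (2 * (c + 1))^-1.
exists r.
  by rewrite lt_min rho0 invr_gt0 mulr_gt0 ?ltr_wpDl//= ge_min lexx.
move=> k u; rewrite lt_min => /andP[ur uc].
have tur (t : R) : 0 <= t <= 1 -> `|t *: u| < rho.
  move=> /andP[t0 t1]; apply: le_lt_trans ur.
  by rewrite normrZ ger0_norm// ler_piMl.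
pose e (t : R) : 'rV[R]_#|I| := \row_j g (enum_val j) (t *: u).
pose d (t : R) : 'rV[R]_#|I| := \row_j 'D_u (g (enum_val j)) (t *: u).
have := @small_gronwall R _ e d 0 (lexx 0) _ _ _ 1.
rewrite ler01 lexx mulr0 => H.
have : `|e 1| <= 0.
  apply: H => //.
  - by apply/rowP => j; rewrite !mxE scale0r g0.
  - move=> t j t01; rewrite mxE.
    rewrite (_ : (fun s => _) = fun s => g (enum_val j) (0 + s *: u)).
      by have := @is_derive_line R _ R (g (enum_val j)) 0 u t; rewrite add0r;
        apply; exact/dg/tur.
    by apply/funext => s; rewrite mxE add0r.
  move=> t j t01; rewrite addr0 mxE derive_rowE; last exact/dg/tur.
  apply: le_trans (norm_sum_coord _ (fun i => bg i (enum_val j) _ (tur t t01))) _.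
  have eb : \sum_l `|g l (t *: u)| <= #|I|%:R * `|e t|.
    rewrite mulr_natl -sumr_const; apply: ler_sum => l _.
    have := norm_coord_le (e t) 0 (enum_rank l).
    by rewrite mxE enum_rankK.
  apply: (@le_trans _ _ (c * `|e t| * `|u|)).
    by rewrite ler_wpM2r// -mulrA ler_wpM2l// -mulrA ler_wpM2l.
  rewrite mulrAC ler_wpM2r//.
  apply: le_trans (ler_wpM2l c0 (ltW uc)) _.
  rewrite ler_pdivrMr ?mulr_gt0 ?ltr_wpDl//; lra.
rewrite normr_le0 => /eqP/rowP/(_ (enum_rank k)).
by rewrite !mxE enum_rankK scale1r.
Qed.

End Uniqueness.

(** * The inverse function theorem *)

Lemma row_free_of_inj (F : fieldType) m n (A : 'M[F]_(m, n)) :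
  (forall v : 'rV[F]_m, v *m A = 0 -> v = 0) -> row_free A.
Proof.
move=> inj; rewrite -kermx_eq0; apply/eqP/row_matrixP => i.
by rewrite row0; apply: inj; rewrite -row_mul mulmx_ker row0.
Qed.

Section InverseFunction.
Context {R : realType} {n : nat}.

Lemma unitmx_of_inj (A : 'M[R]_n) :
  (forall v : 'rV[R]_n, v *m A = 0 -> v = 0) -> A \in unitmx.
Proof.
by move=> inj; rewrite -row_free_unit; exact: row_free_of_inj.
Qed.

Lemma jacobian_entry m (f : 'rV[R]_n -> 'rV[R]_m) y i j : differentiable f y ->
  'J f y i j = partial i (fun x => f x 0 j) y.
Proof.
move=> df; rewrite /partial -derive_coord// deriveEjacobian//.
by rewrite -rowE [RHS]mxE.
Qed.

Variables (D E : set 'rV[R]_n) (f : 'rV[R]_n -> 'rV[R]_n) (p : 'rV[R]_n).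
Hypotheses (oD : open D) (Dp : D p) (sf : smooth_on D f).
Hypotheses (oE : open E) (Efp : E (f p)).
Hypothesis uJ : 'J f p \in unitmx.

Let L := invmx ('J f p).
Let phi (y : 'rV[R]_n) : 'rV[R]_n := y - f y *m L.

Let dfD y : D y -> differentiable f y. Proof. exact: smooth_diff. Qed.

Let sphi k : smooth_on D (fun y => phi y 0 k).
Proof.
apply: (@smooth_ext _ _ _ D (fun y => y 0 k - \sum_j f y 0 j * L j k)) => //.
  by move=> y _; rewrite !mxE.
apply: smoothB => //; first exact: smooth_coord.
apply: smooth_sum => // j; apply: smoothM => //; last exact: smooth_cst.
by move/(smooth_rVP _ oD): sf.
Qed.

Let dphiE y v k : D y -> 'D_v (fun y => phi y 0 k) y = (v - v *m 'J f y *m L) 0 k.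
Proof.
move=> Dy.
have dphi : differentiable phi y.
  by apply/diff_rVP => j; exact: (smooth_diff (@sphi j)).
have df := dfD Dy.
have -> : (fun y => phi y 0 k) =
    (fun y : 'rV[R]_n => y 0 k) - \sum_j (fun y : 'rV[R]_n => L j k *: f y 0 j).
  apply/funext => x; rewrite !fctE fct_sumE !mxE; congr (_ - _).
  by apply: eq_bigr => j _; rewrite /GRing.scale /= mulrC.
have dfj j : derivable (fun y => f y 0 j) y v.
  by apply: diff_derivable; move/diff_rVP: df.
rewrite deriveB; last 2 first.
- exact/diff_derivable/differentiable_coord.
- by apply: derivable_sum => j; exact: derivableZ.
rewrite derive_sum => [|j]; last exact: derivableZ.
rewrite -[X in X - _](@derive_coord R 'rV[R]_n n id)// derive_id [RHS]mxE.
congr (_ + _); rewrite [RHS]mxE [in RHS]mxE; congr (- _).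
apply: eq_bigr => j _; rewrite deriveZ//= -derive_coord// deriveEjacobian//.
by rewrite /GRing.scale /= mulrC.
Qed.

Let contraction_radius : exists2 r : R, 0 < r &
  forall y, `|y - p| < r -> D y /\
    forall k i, `|partial i (fun y => phi y 0 k) y| <= (2 * (n%:R + 1))^-1.
Proof.
have eta0 : 0 < (2 * (n%:R + 1))^-1 :> R.
  by rewrite invr_gt0 mulr_gt0// ltr_wpDl.
have small : \forall y \near p, forall ki : 'I_n * 'I_n,
    `|partial ki.2 (fun y => phi y 0 ki.1) y| < (2 * (n%:R + 1))^-1.
  apply: (@filter_forall _ _ (fun (ki : 'I_n * 'I_n) y =>
    `|partial ki.2 (fun y => phi y 0 ki.1) y| < (2 * (n%:R + 1))^-1) (nbhs p)).
  move=> [k i] /=.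
  have sp : smooth_on D (partial i (fun y => phi y 0 k)).
    exact: smooth_derive (@sphi k).
  have cp := differentiable_continuous (smooth_diff sp Dp).
  have lt : `|partial i (fun y => phi y 0 k) p| < (2 * (n%:R + 1))^-1.
    by rewrite /partial dphiE// -mulmxA mulmxV// mulmx1 subrr mxE normr0.
  have cp' : {for p, continuous (partial i (fun y => phi y 0 k))} by exact: cp.
  exact: (cvgr_norm_lt _ cp' _ lt).
have nD : nbhs p D by exact: open_nbhs_nbhs.
have /nbhs_ballP[r /= r0 H] : nbhs p (D `&` [set y | forall ki : 'I_n * 'I_n,
    `|partial ki.2 (fun y => phi y 0 ki.1) y| < (2 * (n%:R + 1))^-1]).
  exact: filterI nD small.
exists r => // y yr.
have [Dy Hy] : D y /\ forall ki : 'I_n * 'I_n,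
    `|partial ki.2 (fun y => phi y 0 ki.1) y| < (2 * (n%:R + 1))^-1.
  by apply: H; rewrite -ball_normE /= distrC.
by split=> // k i; exact: ltW (Hy (k, i)).
Qed.

(** The map [phi] has zero differential at [p], hence is a contraction near [p];
   the fixed points of its translate by [z *m L] solve [f y = z].  The inverse
   inherits smoothness because its derivative is a smooth function of the
   inverse itself. *)
Lemma inverse_function : exists U V : set 'rV[R]_n,
  [/\ U p, U `<=` D, V `<=` E & diffeo U V f].
Proof.
have [r r0 Hr] := contraction_radius.
have phi_lip (y y' : 'rV[R]_n) : `|y - p| < r -> `|y' - p| < r ->
    `|phi y' - phi y| <= 2^-1 * `|y' - y|.
  move=> yr y'r; apply: norm_rV_le => [|k]; first by rewrite mulr_ge0.
  have := @lipschitz_ball R n (fun y => phi y 0 k) p (2 * (n%:R + 1))^-1 r y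
    (y' - y).
  rewrite (addrC y (y' - y)) subrK => H.
  rewrite [X in `|X|]mxE [X in _ + X]mxE; apply: le_trans (H _ _ yr y'r) _.
  - by move=> x /Hr[Dx _]; exact: (smooth_diff (@sphi k)).
  - by move=> j x /Hr[_]; apply.
  rewrite ler_wpM2r// ler_pdivrMr ?mulr_gt0 ?ltr_wpDl//.
  by rewrite mulrA mulVf// mul1r lerDl.
pose c := n%:R * `|L|.
have c0 : 0 <= c by rewrite mulr_ge0.
have mulL (v : 'rV[R]_n) : `|v *m L| <= c * `|v|.
  by apply: le_trans (norm_mulmx _ _) _; rewrite /c -mulrA [`|v| * _]mulrC.
have LK (v : 'rV[R]_n) : v *m L = 0 -> v = 0.
  by move=> vL; rewrite -[v]mulmx1 -(mulVmx uJ) mulmxA vL mul0mx.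
have f_inv (y y' : 'rV[R]_n) : `|y - p| < r -> `|y' - p| < r ->
    `|y' - y| <= 2 * c * `|f y' - f y|.
  move=> yr y'r.
  have -> : y' - y = (phi y' - phi y) + (f y' - f y) *m L.
    rewrite /phi mulmxBl; move: (f y *m L) (f y' *m L) => a b.
    by apply/rowP => k; rewrite !mxE; ring.
  have := phi_lip _ _ yr y'r; have := mulL (f y' - f y).
  have := ler_normD (phi y' - phi y) ((f y' - f y) *m L).
  have -> : (phi y' - phi y) + (f y' - f y) *m L = y' - y.
    rewrite /phi mulmxBl; move: (f y *m L) (f y' *m L) => a b.
    by apply/rowP => k; rewrite !mxE; ring.
  by lra.
pose delta := r / (2 * (c + 1)) / 2.
have delta0 : 0 < delta by rewrite !divr_gt0// mulr_gt0// ltr_wpDl.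
pose V := [set z | `|z - f p| < delta] `&` E.
pose U := [set y | `|y - p| < r / 2 /\ V (f y)].
have r2 y : `|y - p| < r / 2 -> `|y - p| < r by move=> ?; lra.
have oball (q : 'rV[R]_n) s : open [set y | `|y - q| < s].
  rewrite (_ : [set _ | _] = ball q s); first exact: ball_open.
  by apply/seteqP; split => y; rewrite -ball_normE /= distrC.
have oV : open V by apply: openI => //; exact: oball.
have oU : open U.
  rewrite openE => y [yr Vfy]; rewrite /interior.
  apply: filterI; first by apply: open_nbhs_nbhs; split=> //; exact: oball.
  apply: (differentiable_continuous (dfD _)); first by have [] := Hr y (r2 y yr).
  exact: open_nbhs_nbhs.
(* Banach's theorem on the closed ball of radius r/2 around [p]. *)
have surj z : V z -> exists2 y, U y & f y = z.
  move=> Vz; have [zd Ez] := Vz.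
  pose B := [set y : 'rV[R]_n | `|y - p| <= r / 2].
  pose T y := phi y + z *m L.
  have rr : r / 2 < r by lra.
  have TBs y : B y -> `|T y - p| < r / 2.
    move=> By; rewrite /T.
    have -> : phi y + z *m L - p = (phi y - phi p) + (z - f p) *m L.
      rewrite /phi mulmxBl; move: (f y *m L) (f p *m L) (z *m L) => a b d.
      by apply/rowP => k; rewrite !mxE; ring.
    have := ler_normD (phi y - phi p) ((z - f p) *m L).
    have pr : `|p - p| < r by rewrite subrr normr0.
    have := phi_lip p y pr (le_lt_trans By rr).
    have : c * `|z - f p| < r / 4.
      apply: le_lt_trans (ler_wpM2l c0 (ltW zd)) _.
      rewrite /delta (_ : c * _ = r / 4 * (c / (c + 1))); last first.
        by field; rewrite gt_eqF// ltr_wpDl.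
      by rewrite gtr_pMr ?divr_gt0// ltr_pdivrMr ?ltr_wpDl// mul1r ltrDl.
    have := mulL (z - f p); rewrite /B /= in By.
    by lra.
  have TB : {homo T : x / B x >-> B x} by move=> y /TBs/ltW.
  pose TF := isFun.Build _ _ B B T TB.
  pose Tf : {fun B >-> B} := HB.pack T TF.
  have ctr : is_contraction Tf.
    have q0 : 0 <= (2^-1 : R) by [].
    exists (NngNum q0); split => /=; first by rewrite invf_lt1// ltr1n.
    move=> [y y'] /= [By By']; rewrite /T opprD addrACA subrr addr0.
    by apply: phi_lip; [exact: le_lt_trans By' rr|exact: le_lt_trans By rr].
  have clB : closed B.
    rewrite (_ : B = closed_ball p (r / 2)); first exact: closed_ball_closed.
    rewrite closed_ballE ?divr_gt0// /closed_ball_.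
    by apply/seteqP; split => y; rewrite /B /= distrC.
  have B0 : B !=set0.
    by exists p; rewrite /B /= subrr normr0 divr_ge0// ltW.
  pose rVc := Uniform_isComplete.Build 'rV[R]_n (@cauchy_cvg 'rV[R]_n).
  pose X : completeNormedModType R := HB.pack 'rV[R]_n rVc.
  have [y By yE] := @banach_fixed_point R X B Tf ctr clB B0.
  have fyz : f y = z.
    apply/eqP; rewrite eq_sym -subr_eq0; apply/eqP/LK.
    move: yE; rewrite /Tf /= /T /phi mulmxBl => /eqP.
    rewrite -addrA eq_sym -subr_eq0 addrAC subrr add0r => /eqP <-.
    by rewrite addrC.
  exists y => //; split; last by rewrite fyz.
  by rewrite yE; exact: TBs.
have /choice[g Hg] : forall z, exists y, V z -> U y /\ f y = z.
  move=> z; have [Vz|nVz] := pselect (V z); last by exists 0.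
  by have [y Uy fyz] := surj z Vz; exists y.
have gK u : U u -> g (f u) = u.
  move=> [ur Vfu]; have [[gr _] fg] := Hg _ Vfu.
  apply/eqP; rewrite -subr_eq0 -normr_le0.
  have := f_inv _ _ (r2 _ ur) (r2 _ gr); by rewrite fg subrr normr0 mulr0.
have UD : U `<=` D by move=> y [yr _]; have [] := Hr y (r2 y yr).
have uJU y : U y -> 'J f y \in unitmx.
  move=> Uy; have [yr _] := Uy; have [Dy Hy] := Hr y (r2 y yr).
  apply: unitmx_of_inj => v vJ.
  suff : `|v| <= 2^-1 * `|v| by have : 0 <= `|v| by []; move=> ? ?;
    apply/eqP; rewrite -normr_eq0; apply/eqP; lra.
  apply: norm_rV_le => [|k]; first by rewrite mulr_ge0.
  have := dphiE v k Dy; rewrite vJ mul0mx subr0 => <-.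
  rewrite derive_rowE; last exact: (smooth_diff (@sphi k)).
  apply: le_trans (norm_sum_coord _ (Hy k)) _.
  rewrite ler_wpM2r// ler_pdivrMr ?mulr_gt0 ?ltr_wpDl//.
  by rewrite mulrA mulVf// mul1r lerDl.
have dg z k : V z -> differentiable (fun z => g z 0 k) z /\
    forall v, 'D_v (fun z => g z 0 k) z = (v *m invmx ('J f (g z))) 0 k.
  move=> Vz; have [Uy fy] := Hg z Vz; have [yr _] := Uy.
  set y := g z in Uy fy yr *; set J := 'J f y.
  apply: differentiable_lin => [a v w|e e0].
    by rewrite mulmxDl -scalemxAl !mxE.
  pose b := n%:R * `|invmx J| * (2 * c).
  have b0 : 0 <= b by rewrite !mulr_ge0.
  have e'0 : 0 < e / (b + 1) by rewrite divr_gt0// ltr_wpDl.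
  have dfy := dfD (UD _ Uy).
  have /eqaddoP/(_ _ e'0)/nbhs_ballP[s /= s0 Hs] := diff_locally dfy.
  have /nbhs_ballP[s' /= s'0 Hs'] := open_nbhs_nbhs (conj oV Vz).
  have c20 : 0 < 2 * c + 1 by rewrite ltr_wpDl// mulr_ge0.
  apply/nbhs_ballP; exists (Num.min s' (s / (2 * c + 1))).
    by rewrite /= lt_min s'0 divr_gt0.
  move=> h /=; rewrite -ball_normE /= sub0r normrN lt_min => /andP[h1 h2].
  have Vzh : V (h + z).
    by apply: Hs'; rewrite -ball_normE /= opprD addrCA subrr addr0 normrN.
  have [[yr' _] fy'] := Hg _ Vzh.
  pose w := g (h + z) - y.
  have wh : `|w| <= 2 * c * `|h|.
    by have := f_inv _ _ (r2 _ yr) (r2 _ yr'); rewrite fy fy' addrK.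
  have ws : `|w| < s.
    apply: le_lt_trans wh _; apply: le_lt_trans (_ : (2 * c + 1) * `|h| < _).
      by rewrite ler_wpM2r// lerDl.
    by rewrite mulrC -ltr_pdivlMr.
  have := Hs w; rewrite -ball_normE /= sub0r normrN => /(_ ws).
  rewrite !fctE /= /w subrK fy' fy opprD addrA addrK -deriveE//.
  rewrite deriveEjacobian// -/J -/w => Hw.
  have -> : g (h + z) 0 k - y 0 k - (h *m invmx J) 0 k =
      - ((h - w *m J) *m invmx J) 0 k.
    rewrite mulmxBl mulmxK; last exact: uJU.
    by rewrite /w !mxE; ring.
  rewrite normrN; apply: le_trans (norm_coord_le _ _ _) _.
  apply: le_trans (norm_mulmx _ _) _.
  rewrite mulrCA; apply: le_trans (ler_wpM2r _ Hw) _; first by rewrite mulr_ge0.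
  have bh : n%:R * `|invmx J| * `|w| <= (b + 1) * `|h|.
    apply: (@le_trans _ _ (b * `|h|)); last by rewrite ler_wpM2r// lerDl.
    rewrite /b -(mulrA (n%:R * `|invmx J|)).
    have nJ0 : 0 <= n%:R * `|invmx J| by rewrite mulr_ge0.
    exact: (ler_wpM2l nJ0 wh).
  rewrite [leLHS](_ : _ = e / (b + 1) * (n%:R * `|invmx J| * `|w|)); last by ring.
  apply: le_trans (ler_wpM2l (ltW e'0) bh) _.
  by rewrite mulrA divfK// gt_eqF// ltr_wpDl.
exists U, V; split=> //.
- split; first by rewrite subrr normr0 divr_gt0.
  by split=> //=; rewrite subrr normr0.
- by move=> z [].
split=> //.
- exact: smooth_sub UD sf.
- apply/seteqP; split=> [_ [y [_ Vy] <-]//|z Vz].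
  by have [Uy fyz] := Hg z Vz; exists (g z).
exists g; split=> //.
apply/(smooth_rVP _ oV) => k; apply/smooth_ckP => l.
elim: l k => [|l IH] k; first by move=> z Vz; have [] := dg z k Vz.
split=> [z Vz|v]; first by have [] := dg z k Vz.
apply: (@ck_ext _ _ _ l _
   (fun z => \sum_j v 0 j * invmx ('J f (g z)) j k) _ oV).
  by move=> z; rewrite inE => Vz; have [_ ->] := dg z k Vz; rewrite mxE.
apply: ck_sum => // j _; apply: ckM => //; first exact: ck_cst.
apply: (@ck_comp _ _ _ l V U g (fun y => invmx ('J f y) j k)) => //.
  by move=> z /Hg[].
suff : smooth_on U (fun y => invmx ('J f y) j k) by move/smooth_ckP.
apply: smooth_invmx => // i j'.
apply: (@smooth_ext _ _ _ U (partial i (fun x => f x 0 j'))) => //.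
  by move=> y; rewrite inE => /UD/dfD/jacobian_entry ->.
apply: smooth_derive; apply: smooth_sub UD _.
by move/(smooth_rVP _ oD): sf.
Qed.

End InverseFunction.

(** * Curvature tensors of metrics of constant curvature *)

(* The rules in pointwise form, which matches functions given by explicit
   expressions. *)
Section DerivativeRules.
Context {R : realType} {V : normedModType R}.
Implicit Types (f g : V -> R) (u v : V).

Lemma is_derive_add f g u v df dg : is_derive u v f df -> is_derive u v g dg ->
  is_derive u v (fun x => f x + g x) (df + dg).
Proof. by move=> hf hg; exact: is_deriveD. Qed.

Lemma is_derive_sub f g u v df dg : is_derive u v f df -> is_derive u v g dg ->
  is_derive u v (fun x => f x - g x) (df - dg).
Proof. by move=> hf hg; exact: is_deriveB. Qed.

Lemma is_derive_mul f g u v df dg : is_derive u v f df -> is_derive u v g dg ->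
  is_derive u v (fun x => f x * g x) (df * g u + f u * dg).
Proof.
move=> hf hg; have := is_deriveM hf hg.
move=> /is_derive_eq; apply.
by rewrite /GRing.scale /= addrC [df * _]mulrC.
Qed.

Lemma is_derive_const (c : R) u v : is_derive u v (fun=> c) 0.
Proof. exact: is_derive_cst. Qed.

Lemma is_derive_scale f u v df (c : R) : is_derive u v f df ->
  is_derive u v (fun x => c * f x) (c * df).
Proof. by move=> hf; exact: is_deriveZ. Qed.

Lemma is_derive_bigsum n (f : 'I_n -> V -> R) u v (df : 'I_n -> R) :
  (forall i, is_derive u v (f i) (df i)) ->
  is_derive u v (fun x => \sum_i f i x) (\sum_i df i).
Proof.
move=> hf; rewrite (_ : (fun x => _) = \sum_i f i); first exact: is_derive_sum.
by apply/funext => x; rewrite fct_sumE.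
Qed.

Lemma differentiable_is_derive f u v : differentiable f u ->
  is_derive u v f ('D_v f u).
Proof. by move=> df; apply: DeriveDef => //; exact: diff_derivable. Qed.

Lemma is_derive_partial n (g : 'rV[R]_n -> R) (q : 'rV[R]_n) i :
  differentiable g q -> is_derive q (delta_mx 0 i : 'rV[R]_n) g (partial i g q).
Proof. by move=> dg; apply: DeriveDef => //; exact: diff_derivable. Qed.

End DerivativeRules.

Section BilinearForms.
Context {R : realType} {n : nat}.
Implicit Types (G : 'M[R]_n) (v w : 'rV[R]_n).

Lemma bilinE G v w : bilin G v w = \sum_i \sum_j G i j * v 0 i * w 0 j.
Proof.
rewrite /bilin mxE exchange_big /=; apply: eq_bigr => j _.
rewrite !mxE mulr_suml; apply: eq_bigr => i _.
by rewrite [v 0 i * _]mulrC.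
Qed.

Lemma bilin_delta G i j : bilin G (delta_mx 0 i) (delta_mx 0 j) = G i j.
Proof.
by rewrite /bilin -rowE mxE (bigD1 j)//= big1 => [|k kj];
  rewrite !mxE ?eqxx ?mulr1 ?addr0// (negbTE kj) mulr0.
Qed.

Lemma bilinDl G v v' w : bilin G (v + v') w = bilin G v w + bilin G v' w.
Proof. by rewrite /bilin !mulmxDl mxE. Qed.

Lemma bilinDr G v w w' : bilin G v (w + w') = bilin G v w + bilin G v w'.
Proof. by rewrite /bilin linearD /= mulmxDr mxE. Qed.

Lemma bilinZl G (c : R) v w : bilin G (c *: v) w = c * bilin G v w.
Proof. by rewrite /bilin -!scalemxAl mxE. Qed.

Lemma bilinZr G (c : R) v w : bilin G v (c *: w) = c * bilin G v w.
Proof. by rewrite /bilin linearZ /= -scalemxAr mxE. Qed.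

Lemma bilin_sym G v w : G^T = G -> bilin G v w = bilin G w v.
Proof.
move=> sG; rewrite /bilin.
have -> : v *m G *m w^T = (w *m G *m v^T)^T.
  by rewrite !trmx_mul trmxK sG mulmxA.
by rewrite mxE.
Qed.

Lemma quadratic_zero G : (forall v, bilin G v v = 0) ->
  forall i j, G i j + G j i = 0.
Proof.
move=> G0 i j; have := G0 (delta_mx 0 i + delta_mx 0 j).
rewrite bilinDl !bilinDr !G0 add0r addr0 !bilin_delta.
by [].
Qed.

Lemma posdef_unit G : posdef G -> G \in unitmx.
Proof.
move=> pG; apply: unitmx_of_inj => v vG.
apply/eqP/negPn/negP => /pG; rewrite /bilin vG mul0mx mxE.
by rewrite ltxx.
Qed.

(** Positivity at [(w,w) v - (v,w) w], divided by [(w,w)]. *)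
Lemma cauchy_schwarz_strict G v w : G^T = G -> posdef G ->
  row_free (col_mx v w) -> 0 < bilin G v v * bilin G w w - bilin G v w ^+ 2.
Proof.
move=> sG pG fvw.
have indep (a b : R) : a *: v + b *: w = 0 -> a = 0 /\ b = 0.
  move=> ab; have : row_mx a%:M b%:M *m col_mx v w = 0.
    by rewrite mul_row_col !mul_scalar_mx.
  move=> /eqP; rewrite mulmx_free_eq0// => /eqP ab0.
  have := congr1 lsubmx ab0; have := congr1 rsubmx ab0.
  rewrite row_mxKl row_mxKr => /matrixP/(_ 0 0) + /matrixP/(_ 0 0).
  by rewrite !mxE /= !mulr1n.
have w0 : w != 0.
  apply/eqP => w0; have [|_ /eqP] := indep 0 1; last by rewrite oner_eq0.
  by rewrite scale0r scale1r add0r.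
have q0 := pG _ w0; set q := bilin G w w in q0 *; set t := bilin G v w.
have z0 : q *: v + (- t) *: w != 0.
  by apply/eqP => /indep[q00 _]; rewrite q00 ltxx in q0.
have := pG _ z0; rewrite !(bilinDl, bilinDr, bilinZl, bilinZr).
rewrite (bilin_sym w v sG) -/t -/q.
move=> H; rewrite -(pmulr_rgt0 (_ - _) q0); apply: lt_le_trans H _.
by rewrite le_eqVlt; apply/orP; left; apply/eqP; ring.
Qed.

(** An algebraic curvature tensor is determined by its sectional curvatures:
   polarizing in [X] and then in [Y] shows that [T] is skew under each
   transposition of indices, and then the three terms of the Bianchi identity agree. *)
Lemma curvature_tensor_zero (T : 'I_n -> 'I_n -> 'I_n -> 'I_n -> R) :
  (forall d c a b, T d c a b = - T d c b a) ->
  (forall d c a b, T d c a b = - T c d a b) ->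
  (forall d c a b, T d c a b + T d a b c + T d b c a = 0) ->
  (forall X Y : 'rV[R]_n, \sum_d \sum_c \sum_a \sum_b
     T d c a b * X 0 d * Y 0 c * X 0 a * Y 0 b = 0) ->
  forall d c a b, T d c a b = 0.
Proof.
move=> anti1 anti2 bianchi T0.
have pair d c a b : T d c a b = T a b d c.
  have := bianchi d c a b; have := bianchi c a b d.
  have := bianchi a b d c; have := bianchi b d c a.
  move: (anti1 d c a b) (anti2 d c a b).
  move: (anti1 d a b c) (anti2 d a b c) (anti1 d b c a) (anti2 d b c a).
  move: (anti1 c a b d) (anti2 c a b d) (anti1 c b d a) (anti2 c b d a).
  move: (anti1 c d a b) (anti2 c d a b).
  move: (anti1 a b d c) (anti2 a b d c) (anti1 a d c b) (anti2 a d c b).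
  move: (anti1 a c b d) (anti2 a c b d) (anti1 b d c a) (anti2 b d c a).
  move: (anti1 b c a d) (anti2 b c a d) (anti1 b a d c) (anti2 b a d c).
  lra.
have polX (Y : 'rV[R]_n) d a : \sum_c \sum_b (T d c a b + T a c d b) * Y 0 c * Y 0 b = 0.
  pose G := \matrix_(d, a) \sum_c \sum_b T d c a b * Y 0 c * Y 0 b.
  have G0 X : bilin G X X = 0.
    rewrite bilinE -[RHS](T0 X Y); apply: eq_bigr => e _.
    rewrite [RHS]exchange_big /=; apply: eq_bigr => f _.
    rewrite mxE !mulr_suml; apply: eq_bigr => c _.
    by rewrite !mulr_suml; apply: eq_bigr => b _; ring.
  have := quadratic_zero G0 d a; rewrite !mxE => H; rewrite -[RHS]H.
  rewrite -big_split /=; apply: eq_bigr => e _.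
  by rewrite -big_split /=; apply: eq_bigr => f _; rewrite !mulrDl.
have polY d c a b : T d c a b + T a c d b + (T d b a c + T a b d c) = 0.
  pose G := \matrix_(c, b) (T d c a b + T a c d b).
  have G0 Y : bilin G Y Y = 0.
    rewrite bilinE -[RHS](polX Y d a); apply: eq_bigr => e _.
    by apply: eq_bigr => f _; rewrite mxE.
  by have := quadratic_zero G0 c b; rewrite !mxE.
have skew d c a b : T d c a b = - T d b a c.
  by have := polY d c a b; rewrite (pair a c d b) (pair a b d c); lra.
move=> d c a b; have := bianchi d c a b.
have := skew d a b c; have := anti1 d c b a; have := skew d b c a.
have := anti1 d a b c; have := anti1 d b c a; have := skew d c a b.
have := anti1 d c a b; have := skew d c b a; have := anti1 d a c b; lra.
Qed.

End BilinearForms.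

Lemma sum_delta (R : pzRingType) n (F : 'I_n -> R) d :
  \sum_e (d == e)%:R * F e = F d.
Proof.
rewrite (bigD1 d)//= eqxx mul1r big1 ?addr0// => e ed.
by rewrite eq_sym (negbTE ed) mul0r.
Qed.

Section Riemann.
Context {R : realType} {n : nat}.
Variable h : 'rV[R]_n -> 'M[R]_n.
Hypothesis sh : forall a b, smooth_on setT (fun u => h u a b).
Hypothesis hT : forall u, (h u)^T = h u.
Hypothesis hpos : forall u, posdef (h u).

Let h_sym u a b : h u a b = h u b a.
Proof. by rewrite -[in LHS]hT mxE. Qed.

Let dh c a b u := partial c (fun v => h v a b) u.

Let dh_sym c a b u : dh c a b u = dh c b a u.
Proof. by congr (partial c _ u); apply/funext => v; exact: h_sym. Qed.

(** The Christoffel symbols of the first kind: unlike those of the second kind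
   they are free of the inverse of the metric. *)
Definition christoffel1 d a b u := 2^-1 * (dh a d b u + dh b d a u - dh d a b u).

Let christoffel1_sym d a b u : christoffel1 d a b u = christoffel1 d b a u.
Proof. by rewrite /christoffel1 (dh_sym d b a) [dh a d b u + _]addrC. Qed.

Let christoffel1_compat a d c u :
  dh a d c u = christoffel1 d a c u + christoffel1 c a d u.
Proof. rewrite /christoffel1 (dh_sym a c d) (dh_sym d a c) (dh_sym c a d); lra. Qed.

Lemma christoffelE c a b u : christoffel h c a b u =
  \sum_d invmx (h u) c d * christoffel1 d a b u.
Proof.
rewrite /christoffel mulr_sumr; apply: eq_bigr => d _.
by rewrite /christoffel1 /dh mulrCA.
Qed.

Lemma christoffel_sym c a b u : christoffel h c a b u = christoffel h c b a u.
Proof. by rewrite !christoffelE; apply: eq_bigr => d _; rewrite christoffel1_sym. Qed.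

Lemma lower_christoffel d a b u :
  \sum_c h u d c * christoffel h c a b u = christoffel1 d a b u.
Proof.
under eq_bigr do rewrite christoffelE mulr_sumr.
rewrite exchange_big /= -[RHS](sum_delta (fun e => christoffel1 e a b u) d).
apply: eq_bigr => e _; under eq_bigr do rewrite mulrA.
rewrite -mulr_suml; have /matrixP/(_ d e) := mulmxV (posdef_unit (@hpos u)).
by rewrite !mxE => ->.
Qed.

Lemma christoffel_metric a d c u : partial a (fun v => h v d c) u =
  \sum_e h u d e * christoffel h e a c u + \sum_e h u c e * christoffel h e a d u.
Proof. by rewrite !lower_christoffel; exact: christoffel1_compat. Qed.

Let sdh c a b : smooth_on setT (dh c a b).
Proof. exact: smooth_derive. Qed.

Let sgam d a b : smooth_on setT (christoffel1 d a b).
Proof.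
have oT : open [set: 'rV[R]_n] by exact: openT.
apply: (smoothM oT); first exact: smooth_cst.
by apply: (smoothB oT) => //; apply: (smoothD oT).
Qed.

#[local] Opaque christoffel1 christoffel.

Lemma smooth_christoffel c a b : smooth_on setT (christoffel h c a b).
Proof.
have oT : open [set: 'rV[R]_n] by exact: openT.
apply: (@smooth_ext _ _ _ setT
  (fun u => \sum_d invmx (h u) c d * christoffel1 d a b u)) => //.
  by move=> u _; rewrite christoffelE.
apply: smooth_sum => // d; apply: smoothM => //.
by apply: smooth_invmx => // u _; exact: posdef_unit.
Qed.

Definition riemann_low d c a b u := \sum_e h u d e * riemann h e c a b u.

(* In terms of the symbols of the first kind the antisymmetry in the first pair
   of indices reduces to the symmetry of second derivatives of the metric. *)
Let riemann_lowE d c a b u : riemann_low d c a b u =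
  partial a (christoffel1 d b c) u - partial b (christoffel1 d a c) u
  - \sum_e christoffel1 e a d u * christoffel h e b c u
  + \sum_e christoffel1 e b d u * christoffel h e a c u.
Proof.
have dgam x y z : partial x (christoffel1 d y z) u =
    \sum_e dh x d e u * christoffel h e y z u +
    \sum_e h u d e * partial x (christoffel h e y z) u.
  have -> : christoffel1 d y z = fun v => \sum_e h v d e * christoffel h e y z v.
    by apply/funext => v; rewrite lower_christoffel.
  rewrite /partial -big_split /=.
  have D := is_derive_bigsum (fun e => is_derive_mul
    (is_derive_partial x (smooth_diff (@sh d e) (I : setT u)))
    (is_derive_partial x (smooth_diff (@smooth_christoffel e y z) (I : setT u)))).
  by rewrite (@derive_val _ _ _ _ _ _ _ D).
have cross x y : \sum_e h u d e * \sum_f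
      christoffel h e x f u * christoffel h f y c u =
    \sum_f christoffel1 d x f u * christoffel h f y c u.
  under eq_bigr do rewrite mulr_sumr.
  rewrite exchange_big /=; apply: eq_bigr => f _.
  under eq_bigr do rewrite mulrA.
  by rewrite -mulr_suml lower_christoffel.
have compat x y : \sum_e dh x d e u * christoffel h e y c u =
    \sum_e christoffel1 d x e u * christoffel h e y c u +
    \sum_e christoffel1 e x d u * christoffel h e y c u.
  by rewrite -big_split /=; apply: eq_bigr => e _; rewrite christoffel1_compat mulrDl.
have -> : riemann_low d c a b u =
  \sum_e h u d e * partial a (christoffel h e b c) u -
  \sum_e h u d e * partial b (christoffel h e a c) u +
  (\sum_e h u d e * \sum_f christoffel h e a f u * christoffel h f b c u -
   \sum_e h u d e * \sum_f christoffel h e b f u * christoffel h f a c u).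
  rewrite /riemann_low -!sumrB -big_split /=; apply: eq_bigr => e _.
  by rewrite /riemann sumrB !mulrDr !mulrN.
rewrite !cross !dgam !compat.
have alg (s s' p p' q q' : R) :
  s - s' + (p - p') = (p + q + s) - (p' + q' + s') - q + q' by ring.
exact: alg.
Qed.

Let riemann_low_anti1 d c a b u : riemann_low d c a b u = - riemann_low d c b a u.
Proof.
rewrite /riemann_low -sumrN; apply: eq_bigr => e _; rewrite -mulrN; congr (_ * _).
by rewrite /riemann !sumrB opprD !opprB.
Qed.

Let riemann_low_bianchi d c a b u :
  riemann_low d c a b u + riemann_low d a b c u + riemann_low d b c a u = 0.
Proof.
rewrite /riemann_low -!big_split /= big1// => e _; rewrite -!mulrDr.
have chs x y : christoffel h e x y = christoffel h e y x.
  by apply/funext => v; exact: christoffel_sym.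
rewrite /riemann !sumrB (chs c a) (chs c b) (chs b a).
have sy x y z : \sum_f christoffel h e x f u * christoffel h f y z u =
    \sum_f christoffel h e x f u * christoffel h f z y u.
  by apply: eq_bigr => f _; congr (_ * _); exact: christoffel_sym.
have cyc (x y z p q r p' q' r' : R) : q = q' -> r = r' -> p = p' ->
  x - y + (p - q) + (y - z + (q' - r)) + (z - x + (r' - p')) = 0.
  by move=> -> -> ->; ring.
by rewrite (cyc _ _ _ _ _ _ _ _ _ (sy b a c) (sy c b a) (sy a b c)) mulr0.
Qed.

Let riemann_low_anti2 d c a b u : riemann_low d c a b u = - riemann_low c d a b u.
Proof.
have alg (x y z w s1 s2 s3 s4 : R) : x + z = y + w -> s3 = s2 -> s4 = s1 ->
    x - y - s1 + s2 + (z - w - s3 + s4) = 0.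
  by move=> E -> ->; have := E; lra.
apply/eqP; rewrite -addr_eq0; apply/eqP; rewrite !riemann_lowE.
have second x y : partial x (dh y d c) u = partial x (christoffel1 d y c) u +
    partial x (christoffel1 c y d) u.
  have -> : dh y d c = fun v => christoffel1 d y c v + christoffel1 c y d v.
    by apply/funext => v; exact: christoffel1_compat.
  have D := is_derive_add (is_derive_partial x (smooth_diff (@sgam d y c) (I : setT u)))
     (is_derive_partial x (smooth_diff (@sgam c y d) (I : setT u))).
  by rewrite [LHS](@derive_val _ _ _ _ _ _ _ D).
have sw : partial a (dh b d c) u = partial b (dh a d c) u.
  exact: (schwarz _ _ openT (I : setT u) (@sh d c)).
have raise x y z w : \sum_e christoffel1 e x y u * christoffel h e z w u =
    \sum_e christoffel1 e z w u * christoffel h e x y u.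
  have E x' y' z' w' : \sum_e christoffel1 e x' y' u * christoffel h e z' w' u =
     \sum_e \sum_f invmx (h u) e f * (christoffel1 e x' y' u * christoffel1 f z' w' u).
    apply: eq_bigr => e _; rewrite christoffelE mulr_sumr.
    by apply: eq_bigr => f _; rewrite mulrCA.
  rewrite !E exchange_big /=; apply: eq_bigr => e _; apply: eq_bigr => f _.
  have -> : invmx (h u) f e = invmx (h u) e f.
    by rewrite -[in LHS](trmxK (invmx (h u))) trmx_inv hT mxE.
  by rewrite [christoffel1 f _ _ _ * _]mulrC.
exact: (alg _ _ _ _ _ _ _ _ (etrans (esym (second a b))
  (etrans sw (second b a))) (raise a c b d) (raise b c a d)).
Qed.

Variable C : R.

Hypothesis hC : forall u (X Y : 'rV[R]_n), row_free (col_mx X Y) ->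
  sectional_curvature h u X Y = C.

Let T u d c a b := riemann_low d c a b u - C * (h u d a * h u c b - h u d b * h u c a).

Let T_anti1 u d c a b : T u d c a b = - T u d c b a.
Proof. by rewrite /T riemann_low_anti1; ring. Qed.

(* For dependent [X] and [Y], where the sectional curvature is undefined, the
   polarized identity is a consequence of antisymmetry. *)
Let same_vanish u (Z : 'rV[R]_n) : \sum_d \sum_c \sum_a \sum_b
  T u d c a b * Z 0 d * Z 0 c * Z 0 a * Z 0 b = 0.
Proof.
rewrite big1// => d _; rewrite big1// => c _.
set S := LHS; suff : S = - S by move=> ?; lra.
rewrite {1}/S exchange_big /= -sumrN; apply: eq_bigr => a _.
rewrite -sumrN; apply: eq_bigr => b _.
by rewrite T_anti1; ring.
Qed.

Let dependent_vanish u (X Y : 'rV[R]_n) : ~~ row_free (col_mx X Y) ->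
  \sum_d \sum_c \sum_a \sum_b
     T u d c a b * X 0 d * Y 0 c * X 0 a * Y 0 b = 0.
Proof.
rewrite -kermx_eq0 => /rowV0Pn[w /sub_kermxP wXY w0].
set al := lsubmx w 0 0; set be := rsubmx w 0 0.
have E : al *: X + be *: Y = 0.
  move: wXY; rewrite -{1}(hsubmxK w) mul_row_col => <-.
  rewrite (mx11_scalar (lsubmx w)) (mx11_scalar (rsubmx w)).
  by rewrite !mul_scalar_mx.
have [al0|al0] := eqVneq al 0; last first.
  have -> : X = (- (be / al)) *: Y.
    have : al^-1 *: (al *: X + be *: Y) = 0 by rewrite E scaler0.
    rewrite scalerDr !scalerA mulVf// scale1r => /eqP.
    by rewrite addr_eq0 => /eqP ->; rewrite scaleNr mulrC.
  rewrite (_ : \sum_d _ = (be / al) ^+ 2 * \sum_d \sum_c \sum_a \sum_b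
     T u d c a b * Y 0 d * Y 0 c * Y 0 a * Y 0 b).
    by rewrite same_vanish mulr0.
  rewrite mulr_sumr; apply: eq_bigr => d _; rewrite mulr_sumr.
  apply: eq_bigr => c _; rewrite mulr_sumr; apply: eq_bigr => a _.
  by rewrite mulr_sumr; apply: eq_bigr => b _; rewrite !mxE; ring.
have be0 : be != 0.
  apply/eqP => be0; move/eqP: w0; apply.
  rewrite -(hsubmxK w) (mx11_scalar (lsubmx w)) (mx11_scalar (rsubmx w)).
  by rewrite -/al -/be al0 be0 !raddf0 row_mx0.
have -> : Y = 0.
  move/eqP: E; rewrite al0 scale0r add0r scaler_eq0 (negbTE be0) /=.
  by move=> /eqP.
rewrite big1// => d _; rewrite big1// => c _; rewrite big1// => a _.
by rewrite big1// => b _; rewrite !mxE mulr0.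
Qed.

Let sum_rot4 (G : 'I_n -> 'I_n -> 'I_n -> 'I_n -> R) :
  \sum_d \sum_c \sum_a \sum_b G d c a b =
  \sum_c \sum_a \sum_b \sum_d G d c a b.
Proof.
rewrite exchange_big /=; apply: eq_bigr => c _; rewrite exchange_big /=.
by apply: eq_bigr => a _; rewrite exchange_big.
Qed.

Let prod_sums (F G : 'I_n -> 'I_n -> R) :
  (\sum_d \sum_a F d a) * (\sum_c \sum_b G c b) =
  \sum_d \sum_c \sum_a \sum_b F d a * G c b.
Proof.
rewrite mulr_suml; apply: eq_bigr => d _.
rewrite [RHS]exchange_big /= mulr_suml; apply: eq_bigr => a _.
by rewrite mulr_sumr; apply: eq_bigr => c _; rewrite mulr_sumr.
Qed.

Let numerator_sub u (X Y : 'rV[R]_n) : \sum_d \sum_c \sum_a \sum_b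
     T u d c a b * X 0 d * Y 0 c * X 0 a * Y 0 b =
  \sum_d \sum_c \sum_a \sum_b \sum_e
     h u e d * riemann h d c a b u * X 0 e * Y 0 c * X 0 a * Y 0 b
  - C * (bilin (h u) X X * bilin (h u) Y Y - bilin (h u) X Y ^+ 2).
Proof.
have -> : \sum_d \sum_c \sum_a \sum_b \sum_e
     h u e d * riemann h d c a b u * X 0 e * Y 0 c * X 0 a * Y 0 b =
   \sum_d \sum_c \sum_a \sum_b riemann_low d c a b u * X 0 d * Y 0 c * X 0 a * Y 0 b.
  rewrite sum_rot4 [RHS]sum_rot4; apply: eq_bigr => c _; apply: eq_bigr => a _.
  apply: eq_bigr => b _; rewrite exchange_big /=; apply: eq_bigr => e _.
  by rewrite /riemann_low !mulr_suml.
have -> : bilin (h u) X X * bilin (h u) Y Y =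
    \sum_d \sum_c \sum_a \sum_b
      (h u d a * X 0 d * X 0 a) * (h u c b * Y 0 c * Y 0 b).
  by rewrite !bilinE prod_sums.
have -> : bilin (h u) X Y ^+ 2 = \sum_d \sum_c \sum_a \sum_b
      (h u d b * X 0 d * Y 0 b) * (h u c a * Y 0 c * X 0 a).
  rewrite expr2 {2}(bilin_sym _ _ (hT u)) !bilinE prod_sums.
  apply: eq_bigr => d _; apply: eq_bigr => c _.
  by rewrite exchange_big.
rewrite -sumrB mulr_sumr -sumrB; apply: eq_bigr => d _.
rewrite -sumrB mulr_sumr -sumrB; apply: eq_bigr => c _.
rewrite -sumrB mulr_sumr -sumrB; apply: eq_bigr => a _.
rewrite -sumrB mulr_sumr -sumrB; apply: eq_bigr => b _.
by rewrite /T; ring.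
Qed.

(** The difference [T] of both sides, lowered, has the symmetries of a curvature
   tensor and vanishing sectional curvatures. *)
Lemma constant_curvature_tensor k c a b u : riemann h k c a b u =
  C * ((k == a)%:R * h u c b - (k == b)%:R * h u c a).
Proof.
have T0 : forall d c a b, T u d c a b = 0.
  apply: curvature_tensor_zero.
  - by move=> d' c' a' b'; rewrite /T riemann_low_anti1; ring.
  - move=> d' c' a' b'; rewrite /T riemann_low_anti2.
    by ring.
  - move=> d' c' a' b'; have := riemann_low_bianchi d' c' a' b' u.
    rewrite /T (h_sym u c' b') (h_sym u c' a') (h_sym u a' b').
    by move=> E; apply/eqP; rewrite -[X in _ == X]E; apply/eqP; ring.
  move=> X Y; have [fXY|] := boolP (row_free (col_mx X Y)); last first.
    exact: dependent_vanish.
  have := hC u fXY; rewrite /sectional_curvature.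
  set num := (X in X / _); set den := (X in _ / X) => Q.
  have den0 : 0 < den by exact: cauchy_schwarz_strict.
  have numE : num = C * den by rewrite -Q divfK// gt_eqF.
  have -> : \sum_d \sum_c0 \sum_a0 \sum_b0
     T u d c0 a0 b0 * X 0 d * Y 0 c0 * X 0 a0 * Y 0 b0 = num - C * den.
    exact: numerator_sub.
  by rewrite numE subrr.
have lowE d : riemann_low d c a b u = C * (h u d a * h u c b - h u d b * h u c a).
  by apply/eqP; rewrite -subr_eq0; apply/eqP; exact: T0.
have uh := posdef_unit (@hpos u).
have delta d : \sum_e invmx (h u) k e * h u e d = (k == d)%:R.
  by have /matrixP/(_ k d) := mulVmx uh; rewrite !mxE.
have -> : riemann h k c a b u = \sum_d invmx (h u) k d * riemann_low d c a b u.
  rewrite /riemann_low; under eq_bigr do rewrite mulr_sumr.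
  rewrite exchange_big /= -[LHS](sum_delta (fun e => riemann h e c a b u) k).
  apply: eq_bigr => e _; under eq_bigr do rewrite mulrA.
  by rewrite -mulr_suml delta.
under eq_bigr do rewrite lowE.
rewrite -!delta !mulr_suml -sumrB mulr_sumr; apply: eq_bigr => d _; ring.
Qed.

End Riemann.

(** * The Hessian equation and model functions *)

Lemma big_option (R : nmodType) (T : finType) (F : option T -> R) :
  \sum_x F x = F None + \sum_i F (Some i).
Proof.
rewrite (bigD1 None)//=; congr (_ + _).
rewrite (reindex_omap Some id) /=; last by case.
by apply: eq_bigl => i; rewrite eqxx.
Qed.

Lemma sum_enum_val (R : nmodType) (I : finType) (F : I -> R) :
  \sum_(a < #|I|) F (enum_val a) = \sum_l F l.
Proof.
rewrite [RHS](reindex (@enum_val I predT))//=.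
exact/onW_bij/enum_val_bij.
Qed.

Section FrobeniusFamily.
Context {R : realType} {n : nat} {I : finType}.
Variable c : 'I_n -> I -> I -> 'rV[R]_n -> R.
Hypothesis sc : forall i k l, smooth_on setT (c i k l).
Hypothesis flat : forall i j k l u,
  partial j (c i k l) u + \sum_p c i k p u * c j p l u =
  partial i (c j k l) u + \sum_p c j k p u * c i p l u.

Lemma frobenius_family : exists2 r : R, 0 < r &
  forall g0 : I -> R, exists g : I -> 'rV[R]_n -> R,
  [/\ forall k, g k 0 = g0 k,
      forall k, smooth_on [set u : 'rV[R]_n | `|u| < r] (g k) &
    forall i k u, `|u| < r -> partial i (g k) u = \sum_l c i k l u * g l u].
Proof.
pose A i q : 'M[R]_#|I| := \matrix_(a, b) c i (enum_val b) (enum_val a) q.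
have AE i a b : (fun q => A i q a b) = c i (enum_val b) (enum_val a).
  by apply/funext => q; rewrite mxE.
have [||r r0 Hr] := @frobenius R n #|I| A.
- by move=> i a b; rewrite AE.
- move=> i j q; apply/matrixP => a b; rewrite !mxE !AE.
  have := flat i j (enum_val b) (enum_val a) q.
  have E i' j' : \sum_k A j' q a k * A i' q k b =
      \sum_p c i' (enum_val b) p q * c j' p (enum_val a) q.
    rewrite -[RHS]sum_enum_val; apply: eq_bigr => k _.
    by rewrite !mxE mulrC.
  by rewrite !E.
exists r => // g0.
have [f [f0 sf Hf]] := Hr (\row_a g0 (enum_val a)).
exists (fun k u => f u 0 (enum_rank k)); split.
- by move=> k; rewrite f0 mxE enum_rankK.
- by move=> k; move/(smooth_rVP _ (@open_norm_lt R 'rV[R]_n r)): sf.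
move=> i k u ur; rewrite Hf// mxE -[RHS]sum_enum_val; apply: eq_bigr => a _.
by rewrite !mxE enum_rankK mulrC enum_valK.
Qed.

End FrobeniusFamily.

Section Algebra.
Context {R : realType}.

(* Elementary algebra of the Hessian equation.  The three lemmas on the
   derivative of a defect differentiate the identities of [model_functions] for
   functions with Hess f = - C f h and Hess p = (1 - C p) h: [x] and [p] stand for
   the values, [y], [z], [pi], [pj], [q] for derivatives, [G] for the derivatives
   of the [x a], and [g] for the Christoffel symbols. *)

Lemma codazzi_swap (x y z : R) : x + 2^-1 * (y + z - x) = y + 2^-1 * (x + z - y).
Proof. lra. Qed.

Lemma hessian_flat_entry (x y s t a b C d e : R) : x - y + (s - t) = C * (d * a - e * b) ->
  x + (a * 0 + (- C * a * d + s)) = y + (b * 0 + (- C * b * e + t)).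
Proof. by move=> E; lra. Qed.

Lemma eq_of_defect0 (x y z : R) : x - y + z = 0 -> x = y - z.
Proof. by move=> E; lra. Qed.

Lemma defect_value_bound (q K1 K2 a : R) : 0 <= q -> 0 <= K1 -> 0 <= K2 ->
  `|a| <= q -> `|2 * a| <= (2 + 2 * K1 + 2 * K2) * q.
Proof.
move=> q0 K10 K20 aq; rewrite normrM ger0_norm//.
have := mulr_ge0 K10 q0; have := mulr_ge0 K20 q0; lra.
Qed.

Lemma defect_gradient_bound (q K1 K2 a b c : R) : 0 <= q -> 0 <= K1 -> 0 <= K2 ->
  `|a| <= q -> `|b| <= K1 * q -> `|c| <= K2 * q ->
  `|a + b - c| <= (2 + 2 * K1 + 2 * K2) * q.
Proof.
move=> q0 K10 K20 aq bq cq.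
have := mulr_ge0 K10 q0; have := mulr_ge0 K20 q0.
have := ler_normB (a + b) c; have := ler_normD a b; lra.
Qed.

Lemma defect_hessian_bound (q K1 K2 a b c d : R) : 0 <= q -> 0 <= K1 -> 0 <= K2 ->
  `|a| <= K1 * q -> `|b| <= K1 * q -> `|c| <= K2 * q -> `|d| <= K2 * q ->
  `|a + b - c - d| <= (2 + 2 * K1 + 2 * K2) * q.
Proof.
move=> q0 K10 K20 aq bq cq dq.
have := ler_normB (a + b - c) d; have := ler_normB (a + b) c.
have := ler_normD a b; lra.
Qed.

Lemma hessian_row (c0 C f h s : R) : h * c0 + (- C * h * f + s) = s + (c0 - C * f) * h.
Proof. ring. Qed.

Variable n : nat.
Implicit Types (x y z w q : 'I_n -> R) (G : 'I_n -> 'I_n -> R).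

Lemma norm_sum_mul_le (x y : 'I_n -> R) (B q : R) : (forall i, `|x i| <= B) ->
  (forall i, `|y i| <= q) -> `|\sum_i x i * y i| <= n%:R * B * q.
Proof.
move=> xB yq; rewrite (le_trans (ler_norm_sum _ _ _))//.
rewrite -mulrA mulr_natl -[X in _ *+ X](card_ord n) -sumr_const.
by apply: ler_sum => i _; rewrite normrM ler_pM.
Qed.

Lemma defect_value_derivative x y (C p dp : R) :
  \sum_a (y a * x a + x a * y a) - 2 * dp + C * (dp * p + p * dp) =
  2 * (\sum_a x a * y a - dp + C * (p * dp)).
Proof.
have -> : \sum_a (y a * x a + x a * y a) = 2 * \sum_a x a * y a.
  by rewrite mulr_sumr; apply: eq_bigr => a _; ring.
ring.
Qed.

Lemma sum_swap (g : 'I_n -> R) G w (C h : R) x :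
  \sum_a w a * (\sum_k g k * G a k + (0 - C * x a) * h) =
  \sum_k g k * (\sum_a w a * G a k) - C * h * \sum_a w a * x a.
Proof.
have -> : \sum_k g k * (\sum_a w a * G a k) = \sum_a w a * \sum_k g k * G a k.
  under eq_bigr do rewrite mulr_sumr.
  rewrite exchange_big /=; apply: eq_bigr => a _; rewrite mulr_sumr.
  by apply: eq_bigr => k _; rewrite mulrCA.
by rewrite mulr_sumr -sumrB; apply: eq_bigr => a _; ring.
Qed.

Lemma defect_gradient_derivative x y z G (g q : 'I_n -> R) (C p pi pj h : R) :
  \sum_a (y a * z a + x a * (\sum_k g k * G a k + (0 - C * x a) * h))
  - (\sum_k g k * q k + (1 - C * p) * h)
  + C * (pi * pj + p * (\sum_k g k * q k + (1 - C * p) * h)) =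
  (\sum_a y a * z a - h + C * (pi * pj)) +
  \sum_k g k * (\sum_a x a * G a k - q k + C * (p * q k)) -
  C * h * (\sum_a x a * x a - 2 * p + C * (p * p)).
Proof.
rewrite big_split /= sum_swap.
have -> : \sum_k g k * (\sum_a x a * G a k - q k + C * (p * q k)) =
    \sum_k g k * (\sum_a x a * G a k) - \sum_k g k * q k
    + C * p * \sum_k g k * q k.
  rewrite mulr_sumr -sumrB -big_split /=; apply: eq_bigr => k _; ring.
ring.
Qed.

Lemma defect_hessian_derivative x y z G (g g' q hi hj : 'I_n -> R)
    (C p pi pj hki hkj : R) :
  \sum_a ((\sum_l g l * G a l + (0 - C * x a) * hki) * z a +
          y a * (\sum_l g' l * G a l + (0 - C * x a) * hkj))
  - (\sum_e hi e * g' e + \sum_e hj e * g e)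
  + C * ((\sum_l g l * q l + (1 - C * p) * hki) * pj +
         pi * (\sum_l g' l * q l + (1 - C * p) * hkj)) =
  \sum_l g l * (\sum_a G a l * z a - hj l + C * (q l * pj))
  + \sum_l g' l * (\sum_a y a * G a l - hi l + C * (pi * q l))
  - C * hki * (\sum_a x a * z a - pj + C * (p * pj))
  - C * hkj * (\sum_a x a * y a - pi + C * (p * pi)).
Proof.
have -> : \sum_a ((\sum_l g l * G a l + (0 - C * x a) * hki) * z a +
          y a * (\sum_l g' l * G a l + (0 - C * x a) * hkj)) =
   \sum_a z a * (\sum_l g l * G a l + (0 - C * x a) * hki) +
   \sum_a y a * (\sum_l g' l * G a l + (0 - C * x a) * hkj).
  by rewrite -big_split /=; apply: eq_bigr => a _; rewrite [_ * z a]mulrC.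
rewrite !sum_swap.
have E (w k : 'I_n -> R) (m : R) t : \sum_l w l * (t l - k l + C * (m * q l)) =
    \sum_l w l * t l - \sum_l k l * w l + C * m * \sum_l w l * q l.
  rewrite mulr_sumr -sumrB -big_split /=; apply: eq_bigr => l _; ring.
under [in RHS]eq_bigr do rewrite [q _ * pj]mulrC.
rewrite !E.
have c1 : \sum_l g l * (\sum_a G a l * z a) = \sum_l g l * (\sum_a z a * G a l).
  by apply: eq_bigr => l _; congr (_ * _); apply: eq_bigr => a _; rewrite mulrC.
have c2 : \sum_a x a * z a = \sum_a z a * x a by apply: eq_bigr => a _; rewrite mulrC.
have c3 : \sum_a x a * y a = \sum_a y a * x a by apply: eq_bigr => a _; rewrite mulrC.
rewrite c1 c2 c3.
ring.
Qed.

End Algebra.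

Section HessianSystem.
Context {R : realType} {n : nat}.
Variable h : 'rV[R]_n -> 'M[R]_n.
Hypothesis sh : forall a b, smooth_on setT (fun u => h u a b).
Hypothesis hT : forall u, (h u)^T = h u.
Hypothesis hpos : forall u, posdef (h u).
Variable C : R.
Hypothesis curv : forall k c a b u, riemann h k c a b u =
  C * ((k == a)%:R * h u c b - (k == b)%:R * h u c a).

Let h_sym u a b : h u a b = h u b a.
Proof. by rewrite -[in LHS]hT mxE. Qed.

(** First order form of Hess f = (c - C f) h, in the unknowns c (constant), f
   and the partial derivatives of f.  Taking c as an unknown makes the system
   homogeneous. *)
Definition hessian_coef (i : 'I_n) (k l : option (option 'I_n)) :
    'rV[R]_n -> R :=
  match k, l with
  | None, _ => fun=> 0
  | Some None, Some (Some j) => fun=> (i == j)%:R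
  | Some None, _ => fun=> 0
  | Some (Some j), None => fun u => h u i j
  | Some (Some j), Some None => fun u => - C * h u i j
  | Some (Some j), Some (Some k') => christoffel h k' i j
  end.

Let coef_smooth i k l : smooth_on setT (hessian_coef i k l).
Proof.
case: k => [[j|]|] /=; [|by case: l => [[j|]|]; exact: smooth_cst|exact: smooth_cst].
case: l => [[k'|]|]; [exact: smooth_christoffel| |exact: sh].
by apply: (smoothM openT) => //; exact: smooth_cst.
Qed.

Let codazzi i i2 j u : partial i2 (fun v => h v i j) u +
    \sum_p christoffel h p i j u * h u i2 p =
  partial i (fun v => h v i2 j) u + \sum_p christoffel h p i2 j u * h u i p.
Proof.
have E x y : \sum_p christoffel h p x j u * h u y p =
    \sum_p h u y p * christoffel h p x j u.
  by apply: eq_bigr => p _; rewrite mulrC.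
have hE x y : (fun v => h v x y) = (fun v => h v y x).
  by apply/funext => v; exact: h_sym.
rewrite !E !(lower_christoffel hpos)//= /christoffel1.
rewrite (hE i2 i); exact: codazzi_swap.
Qed.

(* Only the entries from derivatives to derivatives involve curvature; there the
   flatness is exactly the constancy of the curvature. *)
Let coef_flat i j k l u :
  partial j (hessian_coef i k l) u +
    \sum_p hessian_coef i k p u * hessian_coef j p l u =
  partial i (hessian_coef j k l) u +
    \sum_p hessian_coef j k p u * hessian_coef i p l u.
Proof.
have d0 (w : R) x : partial x (fun=> w : R) u = 0 by exact: derive_cst.
rewrite !big_option; case: k => [[m|]|] /=.
- case: l => [[k'|]|] /=.
  + have := curv k' m j i u; rewrite /riemann sumrB.
    have E x y : \sum_p christoffel h p x m u * christoffel h k' y p u =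
        \sum_p christoffel h k' y p u * christoffel h p x m u.
      by apply: eq_bigr => p _; rewrite mulrC.
    rewrite !E (h_sym u m i) (h_sym u m j) (eq_sym k' j) (eq_sym k' i).
    exact: hessian_flat_entry.
  + have dN x y : partial x (fun v => - C * h v y m) u =
        - C * partial x (fun v => h v y m) u.
      have D := is_derive_scale (- C)
        (is_derive_partial x (smooth_diff (@sh y m) (I : setT u))).
      by rewrite [LHS](@derive_val _ _ _ _ _ _ _ D).
    rewrite !dN !mulr0 !add0r.
    have E x y : \sum_p christoffel h p x m u * (- C * h u y p) =
        - C * \sum_p christoffel h p x m u * h u y p.
      by rewrite mulr_sumr; apply: eq_bigr => p _; rewrite mulrCA.
    by rewrite !E -!mulrDr codazzi.
  + by rewrite !mulr0 !add0r codazzi.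
- have E x y : \sum_p (x == p)%:R * hessian_coef y (Some (Some p)) l u =
      hessian_coef y (Some (Some x)) l u.
    by rewrite (sum_delta (fun p => hessian_coef y (Some (Some p)) l u)).
  rewrite !E !mul0r !add0r.
  case: l {E} => [[k'|]|] /=; rewrite !d0 ?add0r.
  + exact: christoffel_sym.
  + by rewrite h_sym.
  + by rewrite h_sym.
- rewrite !d0 !mul0r; congr (_ + (_ + (_ + _))).
  by rewrite !big1// => p _; rewrite mul0r.
Qed.

Lemma hessian_solution : exists2 r : R, 0 < r &
  forall (c0 f0 : R) (v : 'I_n -> R), exists f : 'rV[R]_n -> R,
  [/\ smooth_on [set u : 'rV[R]_n | `|u| < r] f, f 0 = f0,
      forall i, partial i f 0 = v i &
      forall u i j, `|u| < r -> partial i (partial j f) u =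
        \sum_k christoffel h k i j u * partial k f u + (c0 - C * f u) * h u i j].
Proof.
have [r r0 Hr] := frobenius_family coef_smooth coef_flat.
exists r => // c0 f0 v.
have [g [g0 sg Hg]] := Hr (fun k => match k with
  None => c0 | Some None => f0 | Some (Some j) => v j end).
have dgE j u : `|u| < r -> partial j (g (Some None)) u = g (Some (Some j)) u.
  move=> ur; rewrite Hg// !big_option /= !mul0r !add0r.
  by rewrite (sum_delta (fun k => g (Some (Some k)) u)).
have gc u : `|u| < r -> g None u = c0.
  move=> ur; have : `|g None (0 + u) - g None 0| <= n%:R * 0 * `|u|.
    apply: (@lipschitz_ball R n (g None) 0 0 r).
    - by move=> y; rewrite subr0 => yr; exact: (smooth_diff (sg None)).
    - move=> j y; rewrite subr0 => yr; rewrite Hg// big1 ?normr0// => l _.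
      by rewrite /= mul0r.
    - by rewrite subrr normr0.
    - by rewrite add0r subr0.
  by rewrite mulr0 mul0r normr_le0 add0r g0 subr_eq0 => /eqP.
exists (g (Some None)); split => //.
- by rewrite g0.
- by move=> i; rewrite dgE ?g0// normr0.
move=> u i j ur.
have -> : partial i (partial j (g (Some None))) u =
    partial i (g (Some (Some j))) u.
  apply: near_eq_derive.
  have := open_nbhs_nbhs (conj (@open_norm_lt R 'rV[R]_n r) ur).
  by apply: filterS => q qr; exact: dgE.
rewrite Hg// !big_option /= gc//.
under [X in _ = X + _]eq_bigr do rewrite dgE//.
exact: hessian_row.
Qed.

Variable P : 'M[R]_n.
Hypothesis hP : P^T *m P = h 0.

(** The coordinate functions [f] of the model space, together with a
   function [p] of the distance to the origin: for C = 1 and the unit sphere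
   these are the ambient coordinates tangent at the north pole, and 1 minus the
   ambient height.  The defects of the three identities satisfy a homogeneous
   linear system and vanish at the origin, hence everywhere. *)
Lemma model_functions : exists r (f : 'I_n -> 'rV[R]_n -> R) (p : 'rV[R]_n -> R),
  [/\ 0 < r, forall a, smooth_on [set u : 'rV[R]_n | `|u| < r] (f a),
      smooth_on [set u : 'rV[R]_n | `|u| < r] p,
      (forall a, f a 0 = 0) /\ p 0 = 0 &
      forall u, `|u| < r ->
      [/\ \sum_a f a u * f a u = 2 * p u - C * (p u * p u),
        forall j, \sum_a f a u * partial j (f a) u =
          partial j p u - C * (p u * partial j p u) &
        forall i j, \sum_a partial i (f a) u * partial j (f a) u =
          h u i j - C * (partial i p u * partial j p u)]].
Proof.
have [r r0 Hr] := hessian_solution.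
have [p [sp p0 dp0 ddp]] := Hr 1 0 (fun=> 0).
have /choice[f Hf] : forall a : 'I_n, exists f : 'rV[R]_n -> R,
  [/\ smooth_on [set u : 'rV[R]_n | `|u| < r] f, f 0 = 0,
      forall i, partial i f 0 = P a i &
      forall u i j, `|u| < r -> partial i (partial j f) u =
        \sum_k christoffel h k i j u * partial k f u + (0 - C * f u) * h u i j].
  by move=> a; exact: Hr.
pose J : finType := option ('I_n + 'I_n * 'I_n)%type.
pose g (k : J) (u : 'rV[R]_n) : R := match k with
  | None => \sum_a f a u * f a u - 2 * p u + C * (p u * p u)
  | Some (inl j) => \sum_a f a u * partial j (f a) u - partial j p u
       + C * (p u * partial j p u)
  | Some (inr (i, j)) => \sum_a partial i (f a) u * partial j (f a) u - h u i j
       + C * (partial i p u * partial j p u)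
  end.
have df0 a i u : `|u| < r -> is_derive u (delta_mx 0 i) (f a) (partial i (f a) u).
  by move=> ur; apply: is_derive_partial; have [sf _ _ _] := Hf a; exact: smooth_diff sf ur.
have df1 a i j u : `|u| < r -> is_derive u (delta_mx 0 i) (partial j (f a))
   (\sum_k christoffel h k i j u * partial k (f a) u + (0 - C * f a u) * h u i j).
  move=> ur; have [sf _ _ ddf] := Hf a; rewrite -(ddf u i j ur).
  by apply: is_derive_partial; exact: smooth_diff (smooth_derive _ sf) ur.
have dq0 i u : `|u| < r -> is_derive u (delta_mx 0 i) p (partial i p u).
  by move=> ur; apply: is_derive_partial; exact: smooth_diff sp ur.
have dq1 i j u : `|u| < r -> is_derive u (delta_mx 0 i) (partial j p)
   (\sum_k christoffel h k i j u * partial k p u + (1 - C * p u) * h u i j).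
  move=> ur; rewrite -(ddp u i j ur).
  by apply: is_derive_partial; exact: smooth_diff (smooth_derive _ sp) ur.
have dh i a b u : is_derive u (delta_mx 0 i) (fun v => h v a b)
    (\sum_e h u a e * christoffel h e i b u + \sum_e h u b e * christoffel h e i a u).
  rewrite -(christoffel_metric hT hpos).
  by apply: is_derive_partial; exact: smooth_diff (@sh a b) (I : setT u).
have dgN i u : `|u| < r -> is_derive u (delta_mx 0 i) (g None) (2 * g (Some (inl i)) u).
  move=> ur.
  have D := is_derive_add (is_derive_sub (is_derive_bigsum (fun a =>
    is_derive_mul (df0 a i u ur) (df0 a i u ur)))
    (is_derive_scale 2 (dq0 i u ur)))
    (is_derive_scale C (is_derive_mul (dq0 i u ur) (dq0 i u ur))).
  by apply: (is_derive_eq D); exact: defect_value_derivative.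
have dgL i j u : `|u| < r -> is_derive u (delta_mx 0 i) (g (Some (inl j)))
   (g (Some (inr (i, j))) u + \sum_k christoffel h k i j u * g (Some (inl k)) u
    - C * h u i j * g None u).
  move=> ur.
  have D := is_derive_add (is_derive_sub (is_derive_bigsum (fun a =>
    is_derive_mul (df0 a i u ur) (df1 a i j u ur)))
    (dq1 i j u ur))
    (is_derive_scale C (is_derive_mul (dq0 i u ur) (dq1 i j u ur))).
  by apply: (is_derive_eq D); exact: defect_gradient_derivative.
have dgR k i j u : `|u| < r -> is_derive u (delta_mx 0 k) (g (Some (inr (i, j))))
   (\sum_l christoffel h l k i u * g (Some (inr (l, j))) u
    + \sum_l christoffel h l k j u * g (Some (inr (i, l))) u
    - C * h u k i * g (Some (inl j)) u - C * h u k j * g (Some (inl i)) u).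
  move=> ur.
  have D := is_derive_add (is_derive_sub (is_derive_bigsum (fun a =>
    is_derive_mul (df1 a k i u ur) (df1 a k j u ur)))
    (dh k i j u))
    (is_derive_scale C (is_derive_mul (dq1 k i u ur) (dq1 k j u ur))).
  apply: (is_derive_eq D).
  have hs l : h u l j = h u j l by exact: h_sym.
  under [in RHS]eq_bigr do rewrite /g hs.
  exact: defect_hessian_derivative.
have or := @open_norm_lt R 'rV[R]_n r.
have sf a : smooth_on [set u : 'rV[R]_n | `|u| < r] (f a) by have [] := Hf a.
have sg k : smooth_on [set u : 'rV[R]_n | `|u| < r] (g k).
  have sc : smooth_on [set u : 'rV[R]_n | `|u| < r] (fun=> C) by exact: smooth_cst.
  have s2 : smooth_on [set u : 'rV[R]_n | `|u| < r] (fun=> 2 : R) by exact: smooth_cst.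
  case: k => [[j|[i j]]|] /=.
  - apply: (smoothD or).
      apply: (smoothB or); last exact: smooth_derive sp.
      apply: (@smooth_sum R _ _ _ _ _ (fun a u => f a u * partial j (f a) u) or) => a.
      exact: (smoothM or (sf a) (smooth_derive _ (sf a))).
    exact: (smoothM or sc (smoothM or sp (smooth_derive _ sp))).
  - apply: (smoothD or).
      apply: (smoothB or); last exact: smooth_sub (@subsetT _ _) (@sh i j).
      apply: (@smooth_sum R _ _ _ _ _
        (fun a u => partial i (f a) u * partial j (f a) u) or) => a.
      exact: (smoothM or (smooth_derive _ (sf a)) (smooth_derive _ (sf a))).
    exact: (smoothM or sc (smoothM or (smooth_derive _ sp) (smooth_derive _ sp))).
  - apply: (smoothD or).
      apply: (smoothB or); last exact: (smoothM or s2 sp).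
      apply: (@smooth_sum R _ _ _ _ _ (fun a u => f a u * f a u) or) => a.
      exact: (smoothM or (sf a) (sf a)).
    exact: (smoothM or sc (smoothM or sp sp)).
have cts t : smooth_on setT t -> {for (0 : 'rV[R]_n), continuous (t : _ -> R)}.
  by move=> st; apply: differentiable_continuous; exact: (smooth_diff st).
have [r1 [B1 [r10 B10 H1]]] := @local_bound R ('I_n * ('I_n * 'I_n))%type _
  (fun x => christoffel h x.1 x.2.1 x.2.2) 0
  (fun x => cts _ (smooth_christoffel sh hpos x.1 x.2.1 x.2.2)).
have [r2 [B2 [r20 B20 H2]]] := @local_bound R ('I_n * 'I_n)%type _
  (fun x u => h u x.1 x.2) 0 (fun x => cts _ (@sh x.1 x.2)).
pose rho := Num.min r (Num.min r1 r2).
have rho0 : 0 < rho by rewrite !lt_min r0 r10 r20.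
pose M := 2 + 2 * (n%:R * B1) + 2 * (`|C| * B2).
have M0 : 0 <= M by rewrite !addr_ge0// !mulr_ge0.
have g00 k : g k 0 = 0.
  have fz a : f a 0 = 0 by have [] := Hf a.
  case: k => [[j|[i j]]|] /=.
  - by rewrite p0 !dp0 big1 => [|a _]; rewrite ?fz ?mul0r ?subr0 ?mulr0 ?addr0.
  - rewrite !dp0 mulr0 mulr0 addr0 -hP mxE.
    apply/eqP; rewrite subr_eq0; apply/eqP; apply: eq_bigr => a _.
    by have [_ _ Pa _] := Hf a; rewrite !Pa mxE.
  - by rewrite p0 big1 => [|a _]; rewrite ?fz ?mul0r ?mulr0 ?subr0 ?addr0.
have [||rz /andP[rz0 rzr] gz] := @linear_system_zero R n J g rho M rho0 M0 _ _ g00.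
- by move=> k u; rewrite lt_min => /andP[ur _]; exact: smooth_diff (sg k) ur.
- move=> i k u; rewrite !lt_min => /andP[ur /andP[ur1 ur2]].
  set q := \sum_l _.
  have q0 : 0 <= q by exact: sumr_ge0.
  have gq l : `|g l u| <= q.
    by rewrite /q (bigD1 l)//= lerDl sumr_ge0.
  have hB a b : `|h u a b| <= B2.
    by have := H2 (a, b) u; rewrite subr0; exact.
  have GB a b c : `|christoffel h a b c u| <= B1.
    by have := H1 (a, (b, c)) u; rewrite subr0; exact.
  have Gs (a b : 'I_n) (y : 'I_n -> J) :
      `|\sum_l christoffel h l a b u * g (y l) u| <= n%:R * B1 * q.
    exact: norm_sum_mul_le.
  have Cs a b k' : `|C * h u a b * g k' u| <= `|C| * B2 * q.
    by rewrite !normrM; apply: ler_pM => //; rewrite ?mulr_ge0 ?ler_wpM2l.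
  have K10 : 0 <= n%:R * B1 by rewrite mulr_ge0.
  have K20 : 0 <= `|C| * B2 by rewrite mulr_ge0.
  rewrite /partial; case: k => [[j|[j k]]|].
  + rewrite (@derive_val _ _ _ _ _ _ _ (dgL i j u ur)).
    exact: (defect_gradient_bound q0 K10 K20 (gq _) (Gs i j (fun l => Some (inl l))) (Cs i j _)).
  + rewrite (@derive_val _ _ _ _ _ _ _ (dgR i j k u ur)).
    exact: (defect_hessian_bound q0 K10 K20 (Gs i j (fun l => Some (inr (l, k))))
      (Gs i k (fun l => Some (inr (j, l)))) (Cs i j _) (Cs i k _)).
  + rewrite (@derive_val _ _ _ _ _ _ _ (dgN i u ur)).
    exact: (defect_value_bound q0 K10 K20 (gq _)).
exists rz, f, p.
have sub : [set u : 'rV[R]_n | `|u| < rz] `<=` [set u : 'rV[R]_n | `|u| < r].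
  move=> u /= ur; apply: lt_le_trans ur _; apply: le_trans rzr _.
  by rewrite ge_min lexx.
split => //.
- by move=> a; exact: smooth_sub sub (sf a).
- exact: smooth_sub sub sp.
- by split=> // a; have [] := Hf a.
move=> u ur; split.
- have := gz None u ur; rewrite /g; exact: eq_of_defect0.
- by move=> j; have := gz (Some (inl j)) u ur; rewrite /g; exact: eq_of_defect0.
- by move=> i j; have := gz (Some (inr (i, j))) u ur; rewrite /g; exact: eq_of_defect0.
Qed.

End HessianSystem.

(** * Definite forms and stereographic projection *)

Section Factor.
Context {R : realType}.

Lemma bilin_conj m n (G : 'M[R]_n) (P : 'M[R]_(m, n)) v w :
  bilin (P *m G *m P^T) v w = bilin G (v *m P) (w *m P).
Proof. by rewrite /bilin trmx_mul !mulmxA. Qed.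

(** Gram-Schmidt, by completing the square in the first variable. *)
Lemma posdef_factor n (G : 'M[R]_n) : G^T = G -> posdef G ->
  exists Q : 'M[R]_n, Q *m G *m Q^T = 1%:M.
Proof.
elim: n G => [|n IH] G sG pG.
  by exists (1%:M : 'M[R]_0)%R; apply/matrixP => -[].
pose g := G 0 0; pose b := @ursubmx _ 1 n 1 n G.
pose D := @drsubmx _ 1 n 1 n G.
have g0 : 0 < g.
  have := pG (delta_mx 0 0); rewrite bilin_delta; apply.
  by apply/eqP => /rowP/(_ 0)/eqP; rewrite !mxE eqxx oner_eq0.
pose G' : 'M[R]_(1 + n) := G.
have GE : G' = block_mx g%:M b b^T D.
  rewrite -[LHS](@submxK _ 1 n 1 n); congr block_mx.
    by rewrite [LHS]mx11_scalar !mxE; congr (G _ _)%:M; apply/val_inj.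
  by rewrite /b trmx_ursub sG.
pose P0 : 'M[R]_(1 + n) := block_mx (Num.sqrt g)^-1%:M 0 (- g^-1 *: b^T) 1%:M.
pose D' := D - g^-1 *: (b^T *m b).
have s0 : 0 < Num.sqrt g by rewrite sqrtr_gt0.
have P0E : P0 *m G' *m P0^T = block_mx 1%:M 0 0 D'.
  rewrite GE /P0 tr_block_mx !mulmx_block.
  rewrite !(mul_scalar_mx, mul_mx_scalar, tr_scalar_mx, trmx0, mulmx0, mul0mx,
            mulmx1, mul1mx, addr0, add0r, linearZ, trmxK) /=.
  have z : - g^-1 *: (g *: b^T) + b^T = 0.
    by rewrite scalerA mulNr mulVf ?gt_eqF// scaleN1r addNr.
  rewrite !scale1r trmxK z mul0mx !scaler0 add0r -!scalemxAl mul_scalar_mx.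
  congr block_mx.
  - rewrite !scale_scalar_mx; congr (_%:M).
    by rewrite -{3}(sqr_sqrtr (ltW g0)); field; rewrite gt_eqF.
  - rewrite !scalerA -scalerDl (_ : _ + _ = 0) ?scale0r//.
    by field; rewrite !gt_eqF.
  - by rewrite /D' scaleNr addrC.
have sD' : D'^T = D'.
  rewrite /D' linearB /= linearZ /= trmx_mul trmxK.
  by rewrite /D trmx_drsub sG.
have pD' : posdef D'.
  move=> v v0.
  have -> : bilin D' v v = bilin (P0 *m G' *m P0^T)
     (row_mx 0 v : 'rV_(1 + n)) (row_mx 0 v : 'rV_(1 + n)).
    rewrite P0E /bilin mul_row_block tr_row_mx mul_row_col.
    by rewrite !mul0mx !mulmx0 !add0r trmx0 mulmx0 add0r.
  rewrite bilin_conj; apply: pG; apply: contra_neq v0.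
  rewrite /P0 mul_row_block mul0mx mulmx0 !add0r mulmx1.
  by move=> /(congr1 (@rsubmx _ 1 1 n)); rewrite row_mxKr linear0.
have [Q' Q'E] := IH D' sD' pD'.
pose B : 'M[R]_(1 + n) := block_mx 1%:M 0 0 Q'.
exists (B *m P0).
transitivity (B *m (P0 *m G' *m P0^T) *m B^T).
  by rewrite trmx_mul !mulmxA.
rewrite P0E /B tr_block_mx !mulmx_block.
rewrite !(trmx0, trmx1, mulmx0, mul0mx, mulmx1, mul1mx, addr0, add0r) Q'E.
by rewrite -scalar_mx_block.
Qed.

Lemma posdef_gram n (G : 'M[R]_n) : G^T = G -> posdef G ->
  exists P : 'M[R]_n, P^T *m P = G.
Proof.
move=> sG pG; have [Q QE] := posdef_factor sG pG.
have uQ : Q \in unitmx.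
  by move: QE; rewrite -mulmxA => /mulmx1_unit[].
exists (invmx Q)^T; rewrite trmxK.
have uQT : Q^T \in unitmx by rewrite unitmx_tr.
by rewrite trmx_inv -[RHS](mulKmx uQ) -[Q *m G](mulmxK uQT) QE mul1mx.
Qed.

End Factor.

(** Stereographic projection of the cone
   [sum f^2 + phi^2 = (p + pi) (2 + C (pi - p))]: dividing its points by
   [sg = 2 + C (pi - p)] scales the degenerate metric of the cone by [sg^-2] and
   maps into a flat slice, so that the product metric [tau + h] is conformal to the
   Euclidean one, uniformly in the sign of [C]. *)
Lemma stereographic (R : realType) n (f fv fw : 'I_n -> R)
    (C p pv pw h phi phiv phiw pi piv piw tau sg : R) :
  sg = 2 + C * (pi - p) -> sg != 0 ->
  \sum_a f a * f a = 2 * p - C * (p * p) ->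
  \sum_a f a * fv a = pv - C * (p * pv) ->
  \sum_a f a * fw a = pw - C * (p * pw) ->
  \sum_a fv a * fw a = h - C * (pv * pw) ->
  phi * phi = 2 * pi + C * (pi * pi) ->
  phi * phiv = piv + C * (pi * piv) ->
  phi * phiw = piw + C * (pi * piw) ->
  phiv * phiw = tau + C * (piv * piw) ->
  let dX x xv sv := (xv * sg - x * sv) / sg ^+ 2 in
  let sv := C * (piv - pv) in let sw := C * (piw - pw) in
  dX phi phiv sv * dX phi phiw sw + \sum_a dX (f a) (fv a) sv * dX (f a) (fw a) sw
  = (tau + h) / sg ^+ 2.
Proof.
move=> sgE sg0 S0 Sv Sw S2 T0 Tv Tw T2 /=.
set sv := C * _; set sw := C * _.
have -> : \sum_a (fv a * sg - f a * sv) / sg ^+ 2 * ((fw a * sg - f a * sw) / sg ^+ 2)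
  = ((\sum_a fv a * fw a) * sg ^+ 2 - (\sum_a f a * fv a) * sg * sw
     - (\sum_a f a * fw a) * sg * sv + (\sum_a f a * f a) * sv * sw) / sg ^+ 4.
  rewrite !mulr_suml -!sumrB -big_split /= mulr_suml.
  by apply: eq_bigr => a _; field.
rewrite S0 Sv Sw S2.
have -> : (phiv * sg - phi * sv) / sg ^+ 2 * ((phiw * sg - phi * sw) / sg ^+ 2) =
  ((phiv * phiw) * sg ^+ 2 - (phi * phiv) * sg * sw
     - (phi * phiw) * sg * sv + (phi * phi) * sv * sw) / sg ^+ 4 by field.
rewrite T0 Tv Tw T2 /sv /sw.
have sg0' := sg0; rewrite sgE in sg0' *.
by field.
Qed.

(** * The indicatrix and the cone metric *)

Section Openness.
Context {R : realType}.

Lemma open_neq0 (V : normedModType R) : open [set y : V | y != 0].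
Proof.
rewrite openE => y /= y0; rewrite /interior.
apply/nbhs_ballP; exists `|y| => /=; first by rewrite normr_gt0.
move=> z; rewrite -ball_normE /=; apply: contraTneq => ->.
by rewrite subr0 ltxx.
Qed.

Lemma open_preimage (V W : normedModType R) (D : set V) (B : set W) (f : V -> W) :
  open D -> open B -> (forall y, D y -> differentiable f y) ->
  open (D `&` f @^-1` B).
Proof.
move=> oD oB df; rewrite openE => y [Dy By]; rewrite /interior.
apply: filterI; first exact: open_nbhs_nbhs.
by apply: (differentiable_continuous (df y Dy)); exact: open_nbhs_nbhs.
Qed.

Lemma smooth_exp2 (V : normedModType R) (D : set V) (f : V -> R) : open D ->
  smooth_on D f -> smooth_on D (fun y => f y ^+ 2).
Proof.
move=> oD sf; have := smoothM oD sf sf.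
by apply: smooth_ext => // y _; rewrite expr2.
Qed.

(** Euler's identity, by differentiating at [t = 1]. *)
Lemma euler (V : normedModType R) (G : V -> R) (y : V) k : differentiable G y ->
  (forall t : R, 0 < t -> G (t *: y) = t ^+ k * G y) -> 'D_y G y = k%:R * G y.
Proof.
move=> dG hG.
have d1 : is_derive (1 : R) 1 (fun s => G (0 + s *: y)) ('D_y G y).
  by have := @is_derive_line R V R G 0 y 1; rewrite add0r scale1r; exact.
have d2 : is_derive (1 : R) 1 (fun s : R => s ^+ k * G y) (k%:R * G y).
  have dk : is_derive (1 : R) 1 (fun s : R => s ^+ k) k%:R.
    elim: k {hG} => [|k IH].
      have -> : (fun s : R => s ^+ 0) = fun=> 1.
        by apply/funext => s; rewrite expr0.
      exact: is_derive_const.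
    have -> : (fun s : R => s ^+ k.+1) = fun s => s * s ^+ k.
      by apply/funext => s; rewrite exprS.
    apply: (is_derive_eq (is_derive_mul (is_derive_id (1 : R) (1 : R)) IH)).
    by rewrite expr1n !mul1r -natr1 addrC.
  apply: (is_derive_eq (is_derive_mul dk (is_derive_const (G y) (1 : R) 1))).
  by rewrite mulr0 addr0.
rewrite -(@derive_val _ _ _ _ _ _ _ d1) -(@derive_val _ _ _ _ _ _ _ d2).
apply: near_eq_derive.
have : \forall s \near (1 : R), 0 < s by exact: lt_nbhsr.
by apply: filterS => s s0; rewrite add0r hG.
Qed.

Lemma derive_homogeneous (V : normedModType R) (G : V -> R) (D : set V) y v k (t : R) :
  open D -> D y -> 0 < t -> differentiable G (t *: y) ->
  (forall z, D z -> G (t *: z) = t ^+ k.+1 * G z) -> differentiable G y ->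
  'D_v G (t *: y) = t ^+ k * 'D_v G y.
Proof.
move=> oD Dy t0 dGt hG dG.
have lin : is_diff y (fun z : V => t *: z) (fun z => t *: z) by exact: is_diff_scaler.
have dc : 'D_v (G \o (fun z => t *: z)) y = t * 'D_v G (t *: y).
  rewrite deriveE; last by apply: differentiable_comp.
  by rewrite diff_comp//= diff_val -[LHS]deriveE// !deriveE// linearZ.
have : 'D_v (G \o (fun z => t *: z)) y = t ^+ k.+1 * 'D_v G y.
  have -> : 'D_v (G \o (fun z => t *: z)) y = 'D_v (fun z => t ^+ k.+1 * G z) y.
    apply: near_eq_derive; apply: filterS (open_nbhs_nbhs (conj oD Dy)) => z Dz.
    exact: hG.
  have D1 := is_derive_scale (t ^+ k.+1) (differentiable_is_derive v dG).
  by rewrite (@derive_val _ _ _ _ _ _ _ D1).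
rewrite dc exprS -mulrA => /mulfI; apply.
by rewrite gt_eqF.
Qed.

End Openness.

Section Cone.
Context {R : realType} {n : nat}.
Variable F : 'rV[R]_n.+1 -> R.

Let D0 : set 'rV[R]_n.+1 := [set y | y != 0].

Hypothesis sF : smooth_on D0 F.
Hypothesis F_gt0 : forall y, D0 y -> 0 < F y.
Hypothesis F_hom : forall y (t : R), D0 y -> 0 < t -> F (t *: y) = t * F y.
Hypothesis F_convex : forall y, D0 y -> posdef (metric_tensor F y).

Let oD0 : open D0. Proof. exact: open_neq0. Qed.

Let L z := F z ^+ 2.

Let sL : smooth_on D0 L. Proof. exact: smooth_exp2. Qed.

Let D0Z y (t : R) : D0 y -> 0 < t -> D0 (t *: y).
Proof. by move=> y0 t0; rewrite /D0 /= scaler_eq0 negb_or gt_eqF. Qed.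

Let g := metric_tensor F.

Let gE y i j : g y i j = 2^-1 * partial i (partial j L) y.
Proof. by rewrite /g /metric_tensor mxE. Qed.

Lemma smooth_metric_tensor i j : smooth_on D0 (fun y => g y i j).
Proof.
have -> : (fun y => g y i j) = fun y => 2^-1 * partial i (partial j L) y.
  by apply/funext => y; rewrite gE.
apply: (smoothM oD0); first exact: smooth_cst.
exact/smooth_derive/smooth_derive.
Qed.

Lemma metric_tensor_sym y : D0 y -> (g y)^T = g y.
Proof.
move=> y0; apply/matrixP => i j; rewrite mxE (gE y j i) (gE y i j).
have S : partial j (partial i L) y = partial i (partial j L) y.
  exact: (@schwarz R _ D0 L y (delta_mx 0 i) (delta_mx 0 j) oD0 y0 sL).
by rewrite S.
Qed.

Let L_hom y (t : R) : D0 y -> 0 < t -> L (t *: y) = t ^+ 2 * L y.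
Proof. by move=> y0 t0; rewrite /L F_hom// exprMn. Qed.

Let dL_hom j y (t : R) : D0 y -> 0 < t ->
  partial j L (t *: y) = t ^+ 1 * partial j L y.
Proof.
move=> y0 t0; apply: (derive_homogeneous _ oD0) => //.
- exact: (smooth_diff sL (D0Z y0 t0)).
- by move=> z z0; exact: L_hom.
- exact: (smooth_diff sL y0).
Qed.

Lemma metric_tensor_hom y (t : R) : D0 y -> 0 < t -> g (t *: y) = g y.
Proof.
move=> y0 t0; apply/matrixP => i j.
have sdL := smooth_derive (delta_mx 0 j) sL.
have S : partial i (partial j L) (t *: y) = t ^+ 0 * partial i (partial j L) y.
  apply: (derive_homogeneous _ oD0 y0 t0).
  - exact: (smooth_diff sdL (D0Z y0 t0)).
  - by move=> z z0; exact: dL_hom.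
  - exact: (smooth_diff sdL y0).
rewrite expr0 mul1r in S.
exact: (etrans (gE _ _ _) (etrans (congr1 _ S) (esym (gE _ _ _)))).
Qed.

Lemma bilin_metric_radial y z : D0 y -> bilin (g y) y z = 2^-1 * 'D_z L y.
Proof.
move=> y0; rewrite bilinE exchange_big /=.
rewrite derive_rowE; last exact: (smooth_diff sL y0).
rewrite mulr_sumr; apply: eq_bigr => j _.
have sdL := smooth_derive (delta_mx 0 j) sL.
have E : \sum_i y 0 i * partial i (partial j L) y = partial j L y.
  have := euler (smooth_diff sdL y0) (fun t t0 => dL_hom j y0 t0).
  by rewrite mul1r derive_rowE; last exact: (smooth_diff sdL y0).
transitivity (2^-1 * (z 0 j * partial j L y)); last by [].
rewrite -E mulrCA !mulr_sumr; apply: eq_bigr => i _.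
by rewrite (gE y i j); ring.
Qed.

Lemma bilin_metric_diag y : D0 y -> bilin (g y) y y = L y.
Proof.
move=> y0; rewrite bilin_metric_radial//.
rewrite (euler (smooth_diff sL y0) (fun t t0 => L_hom y0 t0)).
by rewrite mulrA mulVf// mul1r.
Qed.

(** The indicatrix is parametrized radially over the affine hyperplane that
   is spanned, from the first row of [E], by the other rows. *)
Variable E : 'M[R]_n.+1.
Hypothesis uE : E \in unitmx.

Let oT : open [set: 'rV[R]_n] := openT.

Definition affine (u : 'rV[R]_n) : 'rV[R]_n.+1 :=
  \row_i (if unlift ord0 i is Some a then u 0 a else 1).

Let affine0 u : affine u 0 ord0 = 1. Proof. by rewrite mxE unlift_none. Qed.

Let affineS u a : affine u 0 (lift ord0 a) = u 0 a.
Proof. by rewrite mxE liftK. Qed.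

Definition slice (u : 'rV[R]_n) : 'rV[R]_n.+1 := affine u *m E.

Definition radial (u : 'rV[R]_n) : 'rV[R]_n.+1 := (F (slice u))^-1 *: slice u.

Definition height (y : 'rV[R]_n.+1) : R := (y *m invmx E) 0 ord0.

Definition angular (y : 'rV[R]_n.+1) : 'rV[R]_n :=
  \row_a ((y *m invmx E) 0 (lift ord0 a) / height y).

Definition half_space : set 'rV[R]_n.+1 := [set y | 0 < height y].

Let height_linear c y : height (c *: y) = c * height y.
Proof. by rewrite /height -scalemxAl mxE. Qed.

Let smooth_height D : open D -> smooth_on D height.
Proof.
move=> oD; have -> : height = fun y => \sum_j y 0 j * invmx E j ord0.
  by apply/funext => y; rewrite /height mxE.
apply: smooth_sum => // j; apply: (smoothM oD); first exact: smooth_coord.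
exact: smooth_cst.
Qed.

Lemma open_half_space : open half_space.
Proof.
have -> : half_space = setT `&` height @^-1` [set t | 0 < t].
  by apply/seteqP; split=> y //=; case.
apply: open_preimage; [exact: openT|exact: open_gt|].
by move=> y _; exact: (smooth_diff (smooth_height openT)).
Qed.

Lemma half_space_neq0 y : half_space y -> D0 y.
Proof.
apply: contraPneq => ->; rewrite /half_space /= /height mul0mx mxE.
by rewrite ltxx.
Qed.

Let slice_height u : height (slice u) = 1.
Proof. by rewrite /height /slice mulmxK// affine0. Qed.

Let slice_neq0 u : D0 (slice u).
Proof. by apply: half_space_neq0; rewrite /half_space /= slice_height. Qed.

Let Fs0 u : 0 < F (slice u). Proof. exact/F_gt0/slice_neq0. Qed.

Let radial_height u : half_space (radial u).
Proof.
by rewrite /half_space /= /radial height_linear slice_height mulr1 invr_gt0.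
Qed.

Let radial_neq0 u : D0 (radial u). Proof. exact: half_space_neq0. Qed.

Lemma radial_unit u : F (radial u) = 1.
Proof.
by rewrite /radial F_hom ?invr_gt0// mulVf// gt_eqF.
Qed.

Lemma angular_radial u : angular (radial u) = u.
Proof.
apply/rowP => a; rewrite mxE /radial.
have c0 : (F (slice u))^-1 != 0 by rewrite invr_eq0 gt_eqF.
move: (F (slice u))^-1 c0 => c c0.
rewrite height_linear slice_height mulr1 -scalemxAl mxE /slice mulmxK// affineS.
by rewrite mulrAC mulfV// mul1r.
Qed.

Lemma polar y : half_space y -> y = F y *: radial (angular y).
Proof.
move=> y0; have t0 : height y != 0 by rewrite gt_eqF.
have yE : y = height y *: slice (angular y).
  rewrite /slice scalemxAl -[LHS](mulmxKV uE); congr (_ *m _).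
  apply/rowP => i; rewrite [RHS]mxE; case: (unliftP ord0 i) => [a|] ->.
    by rewrite affineS [angular y 0 a]mxE [RHS]mulrC divfK.
  by rewrite affine0 mulr1.
have Fy : F y = height y * F (slice (angular y)).
  by rewrite {1}yE F_hom//; exact: slice_neq0.
rewrite /radial scalerA Fy mulfK; first exact: yE.
by rewrite gt_eqF.
Qed.

Let smooth_slice i : smooth_on setT (fun u => slice u 0 i).
Proof.
have -> : (fun u => slice u 0 i) = fun u => \sum_j affine u 0 j * E j i.
  by apply/funext => u; rewrite /slice mxE.
apply: smooth_sum => // j; apply: (smoothM oT); last exact: smooth_cst.
case: (unliftP ord0 j) => [a|] ->.
  have -> : (fun u => affine u 0 (lift ord0 a)) = fun u : 'rV[R]_n => u 0 a.
    by apply/funext => u; rewrite affineS.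
  exact: smooth_coord.
have -> : (fun u => affine u 0 ord0) = fun=> 1.
  by apply/funext => u; rewrite affine0.
exact: smooth_cst.
Qed.

Lemma smooth_radial : smooth_on setT radial.
Proof.
apply/(smooth_rVP _ oT) => i.
have -> : (fun u => radial u 0 i) = fun u => (F (slice u))^-1 * slice u 0 i.
  by apply/funext => u; rewrite /radial mxE.
apply: (smoothM oT) => //; apply: (smoothV oT).
  by move=> u _; rewrite gt_eqF.
apply: (smooth_comp oT _ _ sF); first by move=> u _; exact: slice_neq0.
exact/(smooth_rVP _ oT).
Qed.

Lemma smooth_angular : smooth_on half_space angular.
Proof.
have oH := open_half_space.
apply/(smooth_rVP _ oH) => a.
have -> : (fun y => angular y 0 a) =
    fun y => (\sum_j y 0 j * invmx E j (lift ord0 a)) * (height y)^-1.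
  by apply/funext => y; rewrite mxE [X in X / _]mxE.
apply: (smoothM oH).
  apply: smooth_sum => // j; apply: (smoothM oH); first exact: smooth_coord.
  exact: smooth_cst.
apply: (smoothV oH); last exact: smooth_height.
by move=> y y0; rewrite gt_eqF.
Qed.

Let dradial u : differentiable radial u.
Proof. exact: (smooth_diff smooth_radial). Qed.

Let pr a i u : (partial a radial u) 0 i = partial a (fun u => radial u 0 i) u.
Proof. exact: derive_coord. Qed.

(** [angular] is a left inverse of [radial], so the chain rule inverts its
   differential. *)
Lemma derive_radial_inj u (X : 'rV[R]_n) : 'D_X radial u = 0 -> X = 0.
Proof.
move=> dX; apply/rowP => k.
have sk : smooth_on half_space (fun y => angular y 0 k).
  by have /(smooth_rVP _ open_half_space) := smooth_angular.
have E1 : 'D_X (fun u' => angular (radial u') 0 k) u = X 0 k.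
  have -> : (fun u' => angular (radial u') 0 k) = fun u' : 'rV[R]_n => u' 0 k.
    by apply/funext => u'; rewrite angular_radial.
  by rewrite -(@derive_coord R _ n id)// derive_id.
have E2 := derive_comp X (dradial u) (smooth_diff sk (radial_height u)).
rewrite [RHS]mxE -E1; apply: (etrans E2); rewrite big1// => i _.
by rewrite -derive_coord// dX mxE scale0r.
Qed.

Let h := induced_metric F radial.

Let hE u a b : h u a b = bilin (g (radial u)) (partial a radial u) (partial b radial u).
Proof. by rewrite /h mxE bilinE. Qed.

Let bilin_suml m (G : 'M[R]_m) (I : Type) (r : seq I) (c : I -> R) V w :
  bilin G (\sum_(a <- r) c a *: V a) w = \sum_(a <- r) c a * bilin G (V a) w.
Proof.
elim: r => [|a r IH]; last by rewrite !big_cons bilinDl bilinZl IH.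
by rewrite !big_nil /bilin !mul0mx mxE.
Qed.

Let bilin_sumr m (G : 'M[R]_m) (I : Type) (r : seq I) (c : I -> R) V w :
  bilin G w (\sum_(a <- r) c a *: V a) = \sum_(a <- r) c a * bilin G w (V a).
Proof.
elim: r => [|a r IH]; last by rewrite !big_cons bilinDr bilinZr IH.
by rewrite !big_nil /bilin trmx0 mulmx0 mxE.
Qed.

Let bilin_expand m (G : 'M[R]_m) (a b c : R) z A B :
  bilin G (a *: z + c *: A) (b *: z + c *: B) =
  a * (b * bilin G z z) + a * (c * bilin G z B) +
  (c * (b * bilin G A z) + c * (c * bilin G A B)).
Proof. by rewrite bilinDl !bilinDr !bilinZl !bilinZr. Qed.

Lemma bilin_induced u X Y :
  bilin (h u) X Y = bilin (g (radial u)) ('D_X radial u) ('D_Y radial u).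
Proof.
rewrite bilinE (derive_rowE X (dradial u)) (derive_rowE Y (dradial u)).
rewrite bilin_suml; apply: eq_bigr => a _; rewrite bilin_sumr mulr_sumr.
by apply: eq_bigr => b _; rewrite hE; ring.
Qed.

Lemma induced_metric_sym u : (h u)^T = h u.
Proof.
apply/matrixP => a b; rewrite mxE !hE; apply: bilin_sym.
exact/metric_tensor_sym/radial_neq0.
Qed.

Lemma induced_metric_posdef u : posdef (h u).
Proof.
move=> X X0; rewrite bilin_induced; apply: F_convex; first exact: radial_neq0.
by apply: contra_neq X0; exact: derive_radial_inj.
Qed.

Lemma smooth_induced_metric a b : smooth_on setT (fun u => h u a b).
Proof.
have -> : (fun u => h u a b) = fun u => \sum_i \sum_j g (radial u) i j *
    partial a (fun u => radial u 0 i) u * partial b (fun u => radial u 0 j) u.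
  apply/funext => u; rewrite /h mxE; apply: eq_bigr => i _; apply: eq_bigr => j _.
  exact: (congr2 (fun s t => g (radial u) i j * s * t) (pr a i u) (pr b j u)).
have sr i : smooth_on setT (fun u => radial u 0 i).
  by have /(smooth_rVP _ oT) := smooth_radial.
apply: smooth_sum => // i; apply: smooth_sum => // j.
apply: (smoothM oT); last exact: smooth_derive (sr j).
apply: (smoothM oT); last exact: smooth_derive (sr i).
apply: (smooth_comp oT _ smooth_radial (@smooth_metric_tensor i j)) => u _.
exact: radial_neq0.
Qed.

Lemma radial_param : @indicatrix_param R n.+1 F setT radial.
Proof.
split=> //.
- exact: smooth_radial.
- move=> u _; apply: row_free_of_inj => X; rewrite -deriveEjacobian//.
  exact: derive_radial_inj.
- by move=> u v _ _ uv; rewrite -(angular_radial u) uv angular_radial.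
move=> B oB _; exists (half_space `&` angular @^-1` B).
  apply: open_preimage => //; first exact: open_half_space.
  by move=> y; exact: (smooth_diff smooth_angular).
apply/seteqP; split=> [_ [u Bu <-]|y [[y0 By] [_ Fy]]].
  split; first by split; [exact: radial_height|rewrite /= angular_radial].
  by split; [exact: radial_neq0|exact: radial_unit].
by exists (angular y) => //; rewrite [RHS]polar// Fy scale1r.
Qed.

(** In polar coordinates [y = F y *: z], with [z] on the indicatrix, the metric
   is the cone over the indicatrix: it is homogeneous of degree 0, and Euler's
   identity gives [z] unit length and makes it orthogonal to the indicatrix. *)
Lemma cone_metric y v w : half_space y ->
  bilin (g y) v w = 'D_v F y * 'D_w F y +
    F y ^+ 2 * bilin (h (angular y)) ('D_v angular y) ('D_w angular y).
Proof.
move=> y0; have Dy := half_space_neq0 y0; have Fy0 := F_gt0 Dy.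
set z := radial (angular y).
have Dz : D0 z by exact: radial_neq0.
have dF := smooth_diff sF Dy.
have da := smooth_diff smooth_angular y0.
have dir v' : v' = 'D_v' F y *: z + F y *: 'D_('D_v' angular y) radial (angular y).
  apply/rowP => i.
  have sr : smooth_on setT (fun u => radial u 0 i).
    by have /(smooth_rVP _ oT) := smooth_radial.
  have dc : differentiable (fun y => radial (angular y) 0 i) y.
    exact: (differentiable_comp da (smooth_diff sr (I : setT (angular y)))).
  have := is_derive_mul (differentiable_is_derive v' dF)
    (differentiable_is_derive v' dc).
  move=> D; have : 'D_v' (fun y : 'rV[R]_n.+1 => y 0 i) y =
      'D_v' (fun y => F y * radial (angular y) 0 i) y.
    apply: near_eq_derive.
    apply: filterS (open_nbhs_nbhs (conj open_half_space y0)) => x x0.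
    by rewrite {1}(polar x0) mxE.
  rewrite (@derive_val _ _ _ _ _ _ _ D) -(@derive_coord R _ n.+1 id)// derive_id => ->.
  have sri := smooth_diff sr (I : setT (angular y)).
  have E1 := etrans (derive_coord ('D_v' angular y) i (dradial (angular y)))
    (derive_rowE ('D_v' angular y) sri).
  have E2 := derive_comp v' da sri.
  rewrite [RHS]mxE [X in _ = X + _]mxE [X in _ = _ + X]mxE; congr (_ + _ * _).
  apply: etrans E2 _; apply: etrans _ (esym E1); apply: eq_bigr => a _.
  by rewrite derive_coord.
have gyz : g y = g z.
  by rewrite {1}(polar y0); exact: (metric_tensor_hom Dz Fy0).
have zz : bilin (g z) z z = 1.
  by rewrite (bilin_metric_diag Dz) /L radial_unit expr1n.
have zX X : bilin (g z) z ('D_X radial (angular y)) = 0.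
  have E1 : 'D_X (fun u => L (radial u)) (angular y) = 0.
    have -> : (fun u => L (radial u)) = fun=> 1.
      by apply/funext => u; rewrite /L radial_unit expr1n.
    exact: derive_cst.
  have E2 := derive_comp X (dradial (angular y)) (smooth_diff sL Dz).
  have E3 : 'D_('D_X radial (angular y)) L z = 0.
    rewrite -E1 derive_rowE; last exact: (smooth_diff sL Dz).
    apply: etrans (esym E2); apply: eq_bigr => i _.
    by rewrite derive_coord.
  by rewrite (bilin_metric_radial _ Dz) E3 mulr0.
have Xz X : bilin (g z) ('D_X radial (angular y)) z = 0.
  exact: (etrans (bilin_sym _ _ (metric_tensor_sym Dz)) (zX X)).
transitivity (bilin (g z)
   ('D_v F y *: z + F y *: 'D_('D_v angular y) radial (angular y))
   ('D_w F y *: z + F y *: 'D_('D_w angular y) radial (angular y))).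
  by rewrite -(dir v) -(dir w) gyz.
rewrite bilin_expand zz zX Xz.
have alg (a b c d : R) :
  a * (b * 1) + a * (c * 0) + (c * (b * 0) + c * (c * d)) = a * b + c ^+ 2 * d.
  by ring.
by rewrite alg bilin_induced.
Qed.

End Cone.

(** * Conformal flatness *)

Section ModelDirections.
Context {R : realType} {n : nat}.
Variables (h : 'rV[R]_n -> 'M[R]_n) (C : R).
Hypothesis sh : forall a b, smooth_on setT (fun u => h u a b).
Hypothesis hT : forall u, (h u)^T = h u.
Hypothesis hpos : forall u, posdef (h u).
Hypothesis curv : forall k c a b u, riemann h k c a b u =
  C * ((k == a)%:R * h u c b - (k == b)%:R * h u c a).

(** [model_functions] in directional form, a factor of the Gram matrix [h 0] being
   chosen. *)
Lemma model_coordinates : exists r (f : 'I_n -> 'rV[R]_n -> R) (p : 'rV[R]_n -> R),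
  [/\ 0 < r, forall a, smooth_on [set u : 'rV[R]_n | `|u| < r] (f a),
      smooth_on [set u : 'rV[R]_n | `|u| < r] p,
      (forall a, f a 0 = 0) /\ p 0 = 0 &
      forall u, `|u| < r ->
      [/\ \sum_a f a u * f a u = 2 * p u - C * (p u * p u),
        forall X, \sum_a f a u * 'D_X (f a) u = 'D_X p u - C * (p u * 'D_X p u) &
        forall X Y, \sum_a 'D_X (f a) u * 'D_Y (f a) u =
          bilin (h u) X Y - C * ('D_X p u * 'D_Y p u)]].
Proof.
have [P hP] := posdef_gram (hT 0) (@hpos 0).
have [r [f [p [r0 sf sp f0 Hf]]]] := model_functions sh hT hpos curv hP.
exists r, f, p; split=> // u ur; have [H0 H1 H2] := Hf u ur; split=> //.
- move=> X.
  have dfE a := derive_rowE X (smooth_diff (sf a) ur).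
  rewrite (derive_rowE X (smooth_diff sp ur)).
  under eq_bigr do rewrite dfE mulr_sumr.
  rewrite exchange_big /= !mulr_sumr -sumrB; apply: eq_bigr => i _.
  have := H1 i; rewrite /GRing.scale /= => H1i.
  rewrite [RHS](_ : _ = X 0 i * (partial i p u - C * (p u * partial i p u))).
    by rewrite -H1i mulr_sumr; apply: eq_bigr => a _; rewrite mulrCA.
  by ring.
- move=> X Y.
  have dfE Z a := derive_rowE Z (smooth_diff (sf a) ur).
  rewrite (derive_rowE X (smooth_diff sp ur)) (derive_rowE Y (smooth_diff sp ur)).
  transitivity (\sum_i \sum_j X 0 i * Y 0 j *
      \sum_a partial i (f a) u * partial j (f a) u).
    under eq_bigr do rewrite !dfE mulr_suml.
    rewrite exchange_big /=; apply: eq_bigr => i _.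
    under eq_bigr do rewrite mulr_sumr.
    rewrite exchange_big /=; apply: eq_bigr => j _.
    by rewrite mulr_sumr; apply: eq_bigr => a _; rewrite /GRing.scale /=; ring.
  rewrite bilinE mulr_suml mulr_sumr -sumrB; apply: eq_bigr => i _.
  rewrite mulr_sumr mulr_sumr -sumrB; apply: eq_bigr => j _.
  by rewrite H2 /GRing.scale /=; ring.
Qed.

End ModelDirections.

(** The curvature identity of dimension one holds for every constant.  For [- C]
   it yields the functions sinh(c s)/c and (cosh(c s) - 1)/c^2 with c^2 = C,
   continued to all signs of [C]. *)
Lemma line_coordinates (R : realType) (C : R) :
  exists r (phi pi : 'rV[R]_1 -> R),
  [/\ 0 < r, smooth_on [set u : 'rV[R]_1 | `|u| < r] phi,
      smooth_on [set u : 'rV[R]_1 | `|u| < r] pi,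
      phi 0 = 0 /\ pi 0 = 0 &
      forall u, `|u| < r ->
      [/\ phi u * phi u = 2 * pi u + C * (pi u * pi u),
        forall X, phi u * 'D_X phi u = 'D_X pi u + C * (pi u * 'D_X pi u) &
        forall X Y, 'D_X phi u * 'D_Y phi u =
          X 0 0 * Y 0 0 + C * ('D_X pi u * 'D_Y pi u)]].
Proof.
have bE (X Y : 'rV[R]_1) : bilin 1%:M X Y = X 0 0 * Y 0 0.
  by rewrite /bilin mulmx1 mxE big_ord_recl big_ord0 addr0 mxE.
have [||||r [f [p [r0 sf sp [f0 p0] Hf]]]] :=
  @model_coordinates R 1 (fun=> 1%:M) (- C).
- by move=> a b; exact: smooth_cst.
- by move=> u; rewrite trmx1.
- move=> u v v0; rewrite bE -expr2 exprn_even_gt0//=.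
  by apply: contra_neq v0 => v0; apply/rowP => i; rewrite (ord1 i) v0 mxE.
- move=> k c a b u; rewrite (ord1 k) (ord1 c) (ord1 a) (ord1 b) /riemann.
  by rewrite !subrr mulr0 add0r big1// => e _; rewrite (ord1 e) subrr.
exists r, (f ord0), p; split=> // u ur; have [H0 H1 H2] := Hf u ur; split.
- by have := H0; rewrite big_ord_recl big_ord0 addr0 mulNr opprK.
- by move=> X; have := H1 X; rewrite big_ord_recl big_ord0 addr0 mulNr opprK.
- by move=> X Y; have := H2 X Y; rewrite big_ord_recl big_ord0 addr0 bE mulNr opprK.
Qed.

Lemma complete_row (R : fieldType) n (y : 'rV[R]_n.+1) : y != 0 ->
  exists2 E : 'M[R]_n.+1, E \in unitmx & row ord0 E = y.
Proof.
move=> y0; have [i0 yi0] : exists i, y 0 i != 0.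
  apply/existsP; apply: contraNT y0 => /existsPn H; apply/eqP/rowP => i.
  by rewrite mxE; apply/eqP; have := H i; rewrite negbK.
pose E : 'M[R]_n.+1 := \matrix_(i, j)
  if unlift ord0 i is Some a then (j == lift i0 a)%:R else y 0 j.
have E0 j : E ord0 j = y 0 j by rewrite mxE unlift_none.
have ES a j : E (lift ord0 a) j = (j == lift i0 a)%:R by rewrite mxE liftK.
exists E; last by apply/rowP => j; rewrite mxE E0.
rewrite -row_free_unit -kermx_eq0; apply/eqP/row_matrixP => k; rewrite row0.
have : row k (kermx E) *m E = 0 by rewrite -row_mul mulmx_ker row0.
move: (row k (kermx E)) => v vE.
have v0 : v 0 ord0 = 0.
  move/rowP/(_ i0): vE; rewrite !mxE big_ord_recl E0 big1 ?addr0.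
    by move/eqP; rewrite mulf_eq0 (negPf yi0) orbF => /eqP.
  by move=> b _; rewrite ES (negPf (neq_lift _ _)) mulr0.
apply/rowP => i; rewrite [RHS]mxE; case: (unliftP ord0 i) => [b|] -> //.
move/rowP/(_ (lift i0 b)): vE; rewrite !mxE big_ord_recl v0 mul0r add0r.
rewrite (bigD1 b) //= ES eqxx mulr1 big1 ?addr0 // => d db.
by rewrite ES (inj_eq lift_inj) eq_sym (negPf db) mulr0.
Qed.

Lemma is_derive_quot (R : realType) (V : normedModType R) (f g : V -> R) u v df dg :
  g u != 0 -> is_derive u v f df -> is_derive u v g dg ->
  is_derive u v (fun x => f x / g x) ((df * g u - f u * dg) / g u ^+ 2).
Proof.
move=> g0 hf hg.
have hi : is_derive u v (fun x => (g x)^-1) (- (g u) ^- 2 * dg).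
  have dg' : derivable g u v by case: hg.
  apply: DeriveDef; first exact: derivableV.
  by rewrite deriveV// (@derive_val _ _ _ _ _ _ _ hg).
apply: (is_derive_eq (is_derive_mul hf hi)).
by field.
Qed.

Section Assembly.
Context {R : realType} {n : nat}.
Variable F : 'rV[R]_n.+1 -> R.
Hypothesis sF : smooth_on [set y | y != 0] F.
Hypothesis F_gt0 : forall y, y != 0 -> 0 < F y.
Hypothesis F_hom : forall y (t : R), y != 0 -> 0 < t -> F (t *: y) = t * F y.
Hypothesis F_convex : forall y, y != 0 -> posdef (metric_tensor F y).
Hypothesis F_curv : @indicatrix_constant_curvature R n.+1 F.
Variable a : 'M[R]_n.+1.
Hypothesis aT : a^T = a.
Hypothesis apos : posdef a.

(** With [S] the logarithm of [F] and [A] the coordinates of the central projection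
   to the indicatrix, the metric is [F^2 (dS^2 + h)] by [cone_metric].  The map [X] is the
   stereographic projection of the product of the two models, so that
   [dS^2 + h = sg^2 |dX|^2]. *)
Lemma conformally_flat (y0 : 'rV[R]_n.+1) : y0 != 0 ->
  exists (U V : set 'rV[R]_n.+1) (zeta : 'rV[R]_n.+1 -> 'rV[R]_n.+1)
         (k : 'rV[R]_n.+1 -> R),
    [/\ U y0, U `<=` [set y | y != 0], V `<=` [set y | y != 0],
        diffeo U V zeta &
        forall y, U y -> 0 < k y /\
          forall v w, bilin (metric_tensor F y) v w =
            k y ^+ 2 * bilin a ('D_v zeta y) ('D_w zeta y)].
Proof.
move=> y00; have [E uE rE] := complete_row y00.
have [C HC] := F_curv.
pose h := induced_metric F (radial F E).
have param := radial_param sF F_gt0 F_hom uE.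
have sh := @smooth_induced_metric R n F sF F_gt0 E uE.
have hT := @induced_metric_sym R n F sF F_gt0 E uE.
have hpos := @induced_metric_posdef R n F sF F_gt0 F_convex E uE.
have curv := constant_curvature_tensor sh hT hpos
  (fun u X Y => HC _ _ param u X Y I).
have [r1 [f [p [r10 sf sp [f0 p0] Hf]]]] := model_coordinates sh hT hpos curv.
have [r2 [phi [pi [r20 sphi spi [phi0 pi0] Hphi]]]] := line_coordinates C.
have [Q QE] := posdef_factor aT apos.
pose D0 : set 'rV[R]_n.+1 := [set y | y != 0].
have oD0 : open D0 by exact: open_neq0.
pose H := half_space E.
have oH : open H by exact: open_half_space.
have HD0 : H `<=` D0 by exact: half_space_neq0.
pose A := angular E.
have sA : smooth_on H A by exact: smooth_angular.
have Fy00 : 0 < F y0 by exact: F_gt0.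
(* A vector with one coordinate, since the model of the line is stated for a
   one-dimensional metric; it vanishes at [y0]. *)
pose S (y : 'rV[R]_n.+1) : 'rV[R]_1 := \row__ ln (F y / F y0).
have sFy : smooth_on D0 (fun y => F y / F y0).
  by apply: (smoothM oD0 sF); exact: smooth_cst.
have Fy_gt0 y : D0 y -> 0 < F y / F y0 by move=> Dy; rewrite divr_gt0// F_gt0.
have sS : smooth_on D0 S.
  apply/(smooth_rVP _ oD0) => i.
  have -> : (fun y => S y 0 i) = fun y => ln (F y / F y0).
    by apply/funext => y; rewrite mxE.
  exact: smooth_ln.
have dS y v : D0 y -> ('D_v S y) 0 0 = 'D_v F y / F y.
  move=> Dy; rewrite derive_coord; last exact: (smooth_diff sS Dy).
  have -> : (fun y => S y 0 0) = fun y => ln (F y / F y0).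
    by apply/funext => z; rewrite mxE.
  rewrite derive_ln; [|exact: (smooth_diff sFy Dy)|exact: Fy_gt0].
  have dF := smooth_diff sF Dy.
  have DF := is_derive_mul (differentiable_is_derive v dF)
    (is_derive_const (F y0)^-1 y v).
  rewrite (@derive_val _ _ _ _ _ _ _ DF) mulr0 addr0.
  by rewrite -mulf_div divff ?mulr1// invr_eq0 gt_eqF.
pose D1 := H `&` A @^-1` [set u | `|u| < r1].
have oD1 : open D1.
  apply: open_preimage oH (@open_norm_lt R 'rV[R]_n r1) _.
  by move=> y; exact: (smooth_diff sA).
have D1H : D1 `<=` H by move=> y [].
pose D2 := D1 `&` S @^-1` [set s | `|s| < r2].
have oD2 : open D2.
  apply: open_preimage oD1 (@open_norm_lt R 'rV[R]_1 r2) _.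
  by move=> y /D1H/HD0; exact: (smooth_diff sS).
have D2H : D2 `<=` H by move=> y [/D1H].
have D2D0 : D2 `<=` D0 by move=> y /D2H/HD0.
have onA (t : 'rV[R]_n -> R) : smooth_on [set u : 'rV[R]_n | `|u| < r1] t ->
    smooth_on D2 (fun y => t (A y)).
  move=> st; apply: (smooth_comp oD2 _ (smooth_sub D2H sA) st).
  by move=> y [[]].
have onS (t : 'rV[R]_1 -> R) : smooth_on [set u : 'rV[R]_1 | `|u| < r2] t ->
    smooth_on D2 (fun y => t (S y)).
  move=> st; apply: (smooth_comp oD2 _ (smooth_sub D2D0 sS) st).
  by move=> y [].
pose sg y := 2 + C * (pi (S y) - p (A y)).
have ssg : smooth_on D2 sg.
  apply: (smoothD oD2); first exact: smooth_cst.
  apply: (smoothM oD2); first exact: smooth_cst.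
  by apply: (smoothB oD2); [exact: onS|exact: onA].
(* The base point has [sg y0 = 2]. *)
pose D := D2 `&` sg @^-1` [set t | 0 < t].
have oD : open D.
  apply: open_preimage oD2 (@open_gt R 0) _.
  by move=> y; exact: (smooth_diff ssg).
have DD2 : D `<=` D2 by move=> y [].
pose x i y := (if unlift ord0 i is Some b then f b (A y) else phi (S y)).
pose X y : 'rV[R]_n.+1 := \row_i (x i y / sg y).
(* [Q] takes the Euclidean norm to that of [a]; the translation makes [y0] a
   fixed point and so keeps the image away from 0. *)
pose zeta y := X y *m Q + y0.
have sx i : smooth_on D (x i).
  rewrite /x; case: (unlift ord0 i) => [b|].
    exact: smooth_sub DD2 (onA _ (sf b)).
  exact: smooth_sub DD2 (onS _ sphi).
have sg0 y : D y -> sg y != 0 by move=> [_ /= s0]; rewrite gt_eqF.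
have sX : smooth_on D X.
  apply/(smooth_rVP _ oD) => i.
  have -> : (fun y => X y 0 i) = fun y => x i y * (sg y)^-1.
    by apply/funext => y; rewrite mxE.
  apply: (smoothM oD (sx i)); apply: (smoothV oD sg0).
  exact: smooth_sub DD2 ssg.
have szeta : smooth_on D zeta.
  apply/(smooth_rVP _ oD) => j.
  have -> : (fun y => zeta y 0 j) = fun y => \sum_i X y 0 i * Q i j + y0 0 j.
    by apply/funext => y; rewrite mxE [X in X + _]mxE.
  apply: (smoothD oD); last exact: smooth_cst.
  apply: smooth_sum => // i; apply: (smoothM oD); last exact: smooth_cst.
  by move/(smooth_rVP _ oD): sX.
have dzeta y v : D y -> 'D_v zeta y = 'D_v X y *m Q.
  move=> Dy; apply/rowP => j.
  rewrite derive_coord; last exact: (smooth_diff szeta Dy).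
  have -> : (fun y => zeta y 0 j) = fun y => \sum_i X y 0 i * Q i j + y0 0 j.
    by apply/funext => z; rewrite mxE [X in X + _]mxE.
  have dX i : is_derive y v (fun y => X y 0 i * Q i j) ('D_v X y 0 i * Q i j).
    have dXy := smooth_diff sX Dy.
    have dXi : differentiable (fun y => X y 0 i) y.
      exact: ((diff_rVP X y).1 dXy i).
    apply: (is_derive_eq (is_derive_mul (differentiable_is_derive v dXi)
      (is_derive_const (Q i j) y v))).
    by rewrite mulr0 addr0 derive_coord.
  have DZ := is_derive_add (is_derive_bigsum dX) (is_derive_const (y0 0 j) y v).
  by rewrite (@derive_val _ _ _ _ _ _ _ DZ) addr0 mxE.
have key y v w : D y -> bilin (metric_tensor F y) v w =
    (F y * sg y) ^+ 2 * bilin a ('D_v zeta y) ('D_w zeta y).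
  move=> Dy; have [[[Hy Ay] Sy] sgy] := Dy.
  have Dy0 : D0 y by exact: HD0.
  have dAy := smooth_diff sA Hy; have dSy := smooth_diff sS Dy0.
  have dfy b : differentiable (f b) (A y) by exact: (smooth_diff (sf b) Ay).
  have dpy : differentiable p (A y) by exact: (smooth_diff sp Ay).
  have dphi : differentiable phi (S y) by exact: (smooth_diff sphi Sy).
  have dpi : differentiable pi (S y) by exact: (smooth_diff spi Sy).
  have dtA (t : 'rV[R]_n -> R) z : differentiable t (A y) ->
      is_derive y z (fun y => t (A y)) ('D_('D_z A y) t (A y)).
    move=> dt; have dc := differentiable_comp dAy dt.
    by apply: (is_derive_eq (differentiable_is_derive z dc)); exact: derive_chain.
  have dtS (t : 'rV[R]_1 -> R) z : differentiable t (S y) ->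
      is_derive y z (fun y => t (S y)) ('D_('D_z S y) t (S y)).
    move=> dt; have dc := differentiable_comp dSy dt.
    by apply: (is_derive_eq (differentiable_is_derive z dc)); exact: derive_chain.
  pose sgv z := C * ('D_('D_z S y) pi (S y) - 'D_('D_z A y) p (A y)).
  have dsg z : is_derive y z sg (sgv z).
    have Dsg := is_derive_add (is_derive_const 2 y z) (is_derive_scale C
      (is_derive_sub (dtS pi z dpi) (dtA p z dpy))).
    by apply: (is_derive_eq Dsg); rewrite add0r.
  have sgy0 := sg0 y Dy.
  have dX z i xv : is_derive y z (x i) xv ->
      'D_z X y 0 i = (xv * sg y - x i y * sgv z) / sg y ^+ 2.
    move=> dx; rewrite derive_coord; last exact: (smooth_diff sX Dy).
    have -> : (fun y => X y 0 i) = fun y => x i y / sg y.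
      by apply/funext => z'; rewrite mxE.
    have DQ := is_derive_quot sgy0 dx (dsg z).
    by rewrite (@derive_val _ _ _ _ _ _ _ DQ).
  have x0E : x ord0 = fun y => phi (S y).
    by apply/funext => z; rewrite /x unlift_none.
  have xSE b : x (lift ord0 b) = fun y => f b (A y).
    by apply/funext => z; rewrite /x liftK.
  have dX0 z : 'D_z X y 0 ord0 =
      ('D_('D_z S y) phi (S y) * sg y - phi (S y) * sgv z) / sg y ^+ 2.
    have Dx : is_derive y z (x ord0) ('D_('D_z S y) phi (S y)).
      by rewrite x0E; exact: dtS.
    by rewrite (dX z ord0 _ Dx) x0E.
  have dXS z b : 'D_z X y 0 (lift ord0 b) =
      ('D_('D_z A y) (f b) (A y) * sg y - f b (A y) * sgv z) / sg y ^+ 2.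
    have Dx : is_derive y z (x (lift ord0 b)) ('D_('D_z A y) (f b) (A y)).
      by rewrite xSE; exact: dtA.
    by rewrite (dX z (lift ord0 b) _ Dx) xSE.
  have [S0 S1 S2] := Hf _ Ay; have [T0 T1 T2] := Hphi _ Sy.
  have T2' : 'D_('D_v S y) phi (S y) * 'D_('D_w S y) phi (S y) =
      'D_v F y / F y * ('D_w F y / F y) +
      C * ('D_('D_v S y) pi (S y) * 'D_('D_w S y) pi (S y)).
    exact: etrans (T2 _ _)
      (congr2 (fun s t => s * t + C * _) (dS y v Dy0) (dS y w Dy0)).
  have main := stereographic (erefl (sg y)) sgy0 S0 (S1 ('D_v A y))
    (S1 ('D_w A y)) (S2 ('D_v A y) ('D_w A y)) T0 (T1 ('D_v S y))
    (T1 ('D_w S y)) T2'.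
  have bX : bilin a ('D_v zeta y) ('D_w zeta y) =
      \sum_i 'D_v X y 0 i * 'D_w X y 0 i.
    rewrite (dzeta y v Dy) (dzeta y w Dy) -bilin_conj QE /bilin mulmx1 mxE.
    by apply: eq_bigr => i _; rewrite mxE.
  have sumE (P T : 'rV[R]_n.+1) : \sum_i P 0 i * T 0 i =
      P 0 ord0 * T 0 ord0 + \sum_b P 0 (lift ord0 b) * T 0 (lift ord0 b).
    by rewrite big_ord_recl.
  have bX' := etrans (etrans bX (sumE _ _)) (congr2 +%R
    (congr2 *%R (dX0 v) (dX0 w))
    (eq_bigr _ (fun b _ => congr2 *%R (dXS v b) (dXS w b)))).
  have {}bX := etrans bX' main.
  have alg (t s Fv Fw b : R) : t != 0 -> s != 0 ->
      Fv * Fw + t ^+ 2 * b = (t * s) ^+ 2 * ((Fv / t * (Fw / t) + b) / s ^+ 2).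
    by move=> t0 s0; field; rewrite t0 s0.
  have F0 : F y != 0 by rewrite gt_eqF// F_gt0.
  apply: etrans (cone_metric sF F_gt0 F_hom uE v w Hy) _.
  exact: etrans (alg _ _ _ _ _ F0 sgy0) (congr1 _ (esym bX)).
have hy0 : y0 *m invmx E = row ord0 1%:M.
  by rewrite -rE -row_mul mulmxV.
have Hy0 : H y0 by rewrite /H /half_space /= /height hy0 !mxE eqxx.
have Ay0 : A y0 = 0.
  apply/rowP => b; rewrite mxE hy0 !mxE.
  by rewrite (negPf (neq_lift _ _)) mul0r.
have Sy0 : S y0 = 0.
  by apply/rowP => b; rewrite !mxE divff ?ln1// gt_eqF.
have sgy0 : sg y0 = 2 by rewrite /sg Sy0 Ay0 pi0 p0 subrr mulr0 addr0.
have Dy0 : D y0.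
  split; last by rewrite /= sgy0.
  by split; [split=> //|]; rewrite /= ?Ay0 ?Sy0 normr0.
have Xy0 : X y0 = 0.
  apply/rowP => i; rewrite [LHS]mxE [RHS]mxE /x.
  by case: (unlift ord0 i) => [b|]; rewrite ?Ay0 ?f0 ?Sy0 ?phi0 mul0r.
have zy0 : zeta y0 = y0 by rewrite /zeta Xy0 mul0mx add0r.
have uJ : 'J zeta y0 \in unitmx.
  (* By [key], a vector killed by the differential is null for the metric. *)
  apply: unitmx_of_inj => v.
  rewrite -deriveEjacobian; last exact: (smooth_diff szeta Dy0).
  move=> dv; apply/eqP/negPn/negP => v0.
  have := F_convex y00 v0; rewrite (key y0 v v Dy0) dv.
  by rewrite /bilin mul0mx mul0mx mxE mulr0 ltxx.
have Ezy : D0 (zeta y0) by rewrite zy0.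
have [U [V [Uy0 UD VD dUV]]] := inverse_function oD Dy0 szeta oD0 Ezy uJ.
exists U, V, zeta, (fun y => F y * sg y); split=> //.
  by move=> y /UD/DD2/D2D0.
move=> y /UD Dy; split; last by move=> v w; exact: key.
by have [Dy2 sgy] := Dy; rewrite mulr_gt0// F_gt0//; exact: D2D0.
Qed.

End Assembly.

(** * Finsler metrics *)

Section FixedFirstVariable.
Context {R : realType} {V W Z : normedModType R}.

Lemma derive_fst_fixed (H : V * W -> Z) p y v :
  'D_((0 : V), v) H (p, y) = 'D_v (fun y => H (p, y)) y.
Proof.
have E (h : R) : h *: ((0 : V), v) + (p, y) = (p, h *: v + y).
  by congr pair; exact: etrans (congr1 (+%R^~ p) (scaler0 V h)) (add0r p).
rewrite /derive; congr (lim _); apply: (congr1 (fun f => f @ (0 : R)^')).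
by apply/funext => h /=; rewrite E.
Qed.

(** The derivatives of the restriction are those in the directions [(0, v)]. *)
Lemma smooth_fst_fixed (D : set (V * W)) (G : V * W -> Z) p :
  smooth_on D G -> smooth_on [set y | D (p, y)] (fun y => G (p, y)).
Proof.
move=> sG s y Dy.
have -> : iter_derive s (fun y => G (p, y)) =
    fun y => iter_derive (map (pair (0 : V)) s) G (p, y).
  elim: s => //= v s IH; apply/funext => z; rewrite IH.
  by rewrite derive_fst_fixed.
apply: (@differentiable_comp _ _ _ _ (fun y => (p, y))); last exact: sG.
by apply: differentiable_pair.
Qed.

End FixedFirstVariable.

Theorem theorem2p4 (R : realType) (N : nat) (M : topologicalType)
    (A : manifold R N M) (K : finsler_metric A) (a : riemannian_metric A)
    (x : M) (c : chart A) (xc : dom c x) :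
  indicatrix_constant_curvature (K c x) ->
  forall y0 : 'rV[R]_N, y0 != 0 ->
  exists (U V : set 'rV[R]_N) (zeta : 'rV[R]_N -> 'rV[R]_N)
         (k : 'rV[R]_N -> R),
    [/\ U y0, U `<=` [set y | y != 0], V `<=` [set y | y != 0],
        diffeo U V zeta &
        forall y, U y ->
          0 < k y /\
          forall m n : 'I_N,
            metric_tensor (K c x) y m n =
            k y ^+ 2 * \sum_i \sum_j
              (partial m zeta y) 0 i * (partial n zeta y) 0 j * a c x i j].
Proof.
case: N A K a c xc => [|n] A K a c xc curv y0 y00.
  by case/eqP: y00; apply/rowP => -[].
have sF : smooth_on [set y | y != 0] (K c x).
  have := smooth_fst_fixed (p := Defs.coord c x) (@finsler_smooth _ _ _ _ K c).
  rewrite /= Defs.coordK//; apply: smooth_sub => y /= y0'.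
  by split=> //; exists x.
have [U [V [zeta [k [Uy0 U0 V0 dz Hk]]]]] := conformally_flat sF
  (fun y => @finsler_gt0 _ _ _ _ K c x y xc)
  (fun y t => @finsler_homogeneous _ _ _ _ K c x y t xc)
  (fun y => @finsler_convex _ _ _ _ K c x y xc) curv
  (@riemannian_sym _ _ _ _ a c x xc) (@riemannian_posdef _ _ _ _ a c x xc) y00.
exists U, V, zeta, k; split=> // y /Hk[k0 E]; split=> // i j.
rewrite -bilin_delta E bilinE; congr (_ * _).
apply: eq_bigr => i' _; apply: eq_bigr => j' _.
by rewrite -mulrA mulrC.
Qed.
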